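(* Let $0<\lambda\le\Lambda_{N,s}$, $f\ge0$ in $\Omega\times(0,T)$ and $u_0\in L^1(\Omega)$, $u_0\ge0$. If $p>p_+(\lambda,s)$, then the problem $$ u_t+(-\Delta)^su=\lambda\frac{u}{|x|^{2s}}+u^p+f\ \text{ in }\Omega\times(0,T),\quad u>0\ \text{ in }\Omega\times(0,T),\quad u=0\ \text{ in }(\mathbb{R}^N\setminus\Omega)\times[0,T),\quad u(x,0)=u_0(x)\ \text{ in }\Omega $$ has no positive weak supersolution. In the case where $f\equiv0$, the unique nonnegative weak supersolution (i.e. dropping the requirement $u>0$) is $u\equiv0$.
   Context: Throughout, $0<s<1$, $N>2s$, $\Omega\subset\mathbb{R}^N$ is a bounded $C^{1,1}$ domain with $0\in\Omega$, and $0<T<\infty$. The fractional Laplacian is $(-\Delta)^su(x)=a_{N,s}\,\mathrm{P.V.}\int_{\mathbb{R}^N}\frac{u(x)-u(y)}{|x-y|^{N+2s}}dy$ with $a_{N,s}=2^{2s}\pi^{-N/2}\frac{\Gamma(\frac{N+2s}{2})}{|\Gamma(-s)|}$, so that $(-\Delta)^su=\mathcal{F}^{-1}(|\xi|^{2s}\mathcal{F}u)$ on the Schwartz class. The fractional Hardy constant is $\Lambda_{N,s}=2^{2s}\frac{\Gamma^2(\frac{N+2s}{4})}{\Gamma^2(\frac{N-2s}{4})}$. For $0<\lambda\le\Lambda_{N,s}$, $\alpha\in[0,\frac{N-2s}{2})$ is determined by $$\lambda=\frac{2^{2s}\,\Gamma(\frac{N+2s+2\alpha}{4})\Gamma(\frac{N+2s-2\alpha}{4})}{\Gamma(\frac{N-2s+2\alpha}{4})\Gamma(\frac{N-2s-2\alpha}{4})},$$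 and $p_+(\lambda,s)=1+\dfrac{2s}{\frac{N-2s}{2}-\alpha}$. Test class: $\mathcal{T}$ is the set of $\phi:\mathbb{R}^N\times[0,T]\to\mathbb{R}$ such that $-\phi_t+(-\Delta)^s\phi=\varphi$ in $\Omega\times(0,T)$ for some bounded $\varphi$ on $\Omega\times(0,T)$ that is Hölder continuous in space and time ($\varphi\in L^\infty\cap\mathcal{C}^{\alpha',\beta'}(\Omega\times(0,T))$ for some exponents), with $\phi=0$ in $(\mathbb{R}^N\setminus\Omega)\times(0,T]$ and $\phi(x,T)=0$ in $\Omega$; such $\phi$ is the bounded finite-energy solution, and it satisfies the equation pointwise (strong solution). Weak supersolution of $u_t+(-\Delta)^su=F(x,t,u)$ with zero exterior datum and initial datum $u_0\in L^1(\Omega)$: $u\in\mathcal{C}([0,T);L^1(\Omega))$ with $F(x,t,u)\in L^1(\Omega\times[0,T))$, $u\ge0$ in $(\mathbb{R}^N\setminus\Omega)\times[0,T)$, $u(x,0)\ge u_0(x)$ in $\Omega$, and for all nonnegative $\phi\in\mathcal{T}$ $$\int_0^T\!\!\int_\Omega-\phi_tu\,dx\,dt+\int_0^T\!\!\int_{\mathbb{R}^N}u(-\Delta)^s\phi\,dx\,dt\ge\int_0^T\!\!\int_\Omega F\phi\,dx\,dt+\int_\Omega u_0(x)\phi(x,0)\,dx .$$ Here $F=\lambda\frac{u}{|x|^{2s}}+u^p+f$.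
   Formalization: For f≡0, every nonnegative weak supersolution is shown to vanish a.e. for any u_0; that u≡0 is itself a weak supersolution is claimed only when u_0=0 a.e., since otherwise u≡0 violates u(x,0)≥u_0(x). *)

(* Defs.v *)
From HB Require Import structures.
From mathcomp Require Import all_boot all_order all_algebra.
From mathcomp Require Import all_classical all_reals all_analysis.

Set Implicit Arguments.
Unset Strict Implicit.
Unset Printing Implicit Defensive.

Import Order.TTheory GRing.Theory Num.Theory.
Import numFieldNormedType.Exports.

Local Open Scope classical_set_scope.
Local Open Scope ring_scope.

(* The product sigma-algebra on row vectors, mirroring the library's instance
   on n.-tuple T; on 'rV[R]_n it is the Borel sigma-algebra. *)
Definition measure_rV_display : measure_display -> measure_display.
Proof. exact. Qed.

Section measurable_rV.
Context {d} {T : sigmaRingType d}.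
Variable n : nat.

Let coors : 'I_n -> 'rV[T]_n -> T := fun i v => v ord0 i.

Let rV_set0 : g_sigma_preimage coors set0.
Proof. exact: sigma_algebra0. Qed.

Let rV_setC A : g_sigma_preimage coors A -> g_sigma_preimage coors (~` A).
Proof. exact: sigma_algebraC. Qed.

Let rV_bigcup (F : _^nat) : (forall i, g_sigma_preimage coors (F i)) ->
  g_sigma_preimage coors (\bigcup_i (F i)).
Proof. exact: sigma_algebra_bigcup. Qed.

HB.instance Definition _ := @isMeasurable.Build (measure_rV_display d)
  'rV[T]_n (g_sigma_preimage coors) rV_set0 rV_setC rV_bigcup.

End measurable_rV.

Lemma measurable_coord d (T : sigmaRingType d) n (i : 'I_n) :
  measurable_fun [set: 'rV[T]_n] (fun v : 'rV[T]_n => v ord0 i).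
Proof.
move=> _ Y mY; rewrite setTI; apply: sub_sigma_algebra => /=.
rewrite -bigcup_seq/=; exists i => /=; first by rewrite mem_index_enum.
by exists Y => //; rewrite setTI.
Qed.

Lemma measurable_fun_rVP d1 d2 (T1 : measurableType d1) (T2 : measurableType d2)
    n (f : T1 -> 'rV[T2]_n) :
  (forall i, measurable_fun [set: T1] (fun x => f x ord0 i)) ->
  measurable_fun [set: T1] f.
Proof.
move=> mf _ A mA; rewrite setTI.
suff: measurable `<=` [set B | measurable (f @^-1` B)] by exact.
apply: smallest_sub; first split.
- by rewrite /= preimage_set0.
- by move=> B mB /=; rewrite setTD preimage_setC; exact: measurableC.
- by move=> F mF /=; rewrite preimage_bigcup; exact: bigcupT_measurable.
move=> B; rewrite -bigcup_seq/= => -[i _ [C mC <-]].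
by rewrite setTI /= -comp_preimage -[X in measurable X]setTI; exact: mf.
Qed.

Lemma sigma_finite_product d1 d2 (T1 : measurableType d1)
    (T2 : measurableType d2) (R : realType)
    (m1 : {sigma_finite_measure set T1 -> \bar R})
    (m2 : {sigma_finite_measure set T2 -> \bar R}) :
  sigma_finite [set: T1 * T2] (m1 \x m2)%E.
Proof.
have /sigma_finiteP[F [TF ndF Foo]] := sigma_finiteT m1.
have /sigma_finiteP[G [TG ndG Goo]] := sigma_finiteT m2.
exists (fun k => F k `*` G k).
  rewrite -setXTT TF TG predeqE => -[x y]; split.
    move=> [/= [i _ Fix] [k _ Gky]]; exists (maxn i k) => //; split.
    - by move: x Fix; exact/subsetPset/ndF/leq_maxl.
    - by move: y Gky; exact/subsetPset/ndG/leq_maxr.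
  by move=> [k _ []/= ? ?]; split; exists k.
move=> k; have [? ?] := Foo k; have [? ?] := Goo k.
split; first exact: measurableX.
by rewrite product_measure1E// lte_mul_pinfty// ge0_fin_numE.
Qed.

Section lebesgue_rV.
Variable R : realType.

Definition rV_cons n (z : measurableTypeR R * 'rV[R]_n) : 'rV[R]_n.+1 :=
  \row_(i < n.+1) oapp (fun j => z.2 ord0 j) (z.1 : R) (unlift ord0 i).

Definition rV_uncons n (v : 'rV[R]_n.+1) : measurableTypeR R * 'rV[R]_n :=
  (v ord0 ord0, \row_(j < n) v ord0 (lift ord0 j)).

Lemma rV_consK n : cancel (@rV_cons n) (@rV_uncons n).
Proof.
move=> [a v]; rewrite /rV_uncons/rV_cons !mxE unlift_none/=; congr pair.
by apply/rowP => j; rewrite !mxE liftK.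
Qed.

Lemma measurable_rV_cons n : measurable_fun setT (@rV_cons n).
Proof.
apply: measurable_fun_rVP => i; rewrite /rV_cons.
under eq_fun do rewrite mxE.
case: (unliftP ord0 i) => [j|] _ /=.
  exact: (measurableT_comp (measurable_coord (T := R) j) measurable_snd).
exact: measurable_fst.
Qed.

Lemma measurable_rV_uncons n : measurable_fun setT (@rV_uncons n).
Proof.
apply/measurable_fun_pairP; split => /=.
  exact: (measurable_coord (T := R) ord0).
apply: measurable_fun_rVP => i /=.
under eq_fun do rewrite mxE.
exact: (measurable_coord (T := R)).
Qed.

Section step.
Variables (n : nat) (mu : {sigma_finite_measure set 'rV[R]_n -> \bar R}).

Definition lebesgue_rV_step : set 'rV[R]_n.+1 -> \bar R :=
  pushforward (lebesgue_measure \x mu)%E (@rV_cons n).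

Let measurable_preimage A : measurable A -> measurable (@rV_cons n @^-1` A).
Proof. by move=> mA; rewrite -[X in measurable X]setTI; exact: measurable_rV_cons. Qed.

Let step0 : lebesgue_rV_step set0 = 0%E.
Proof. by rewrite /lebesgue_rV_step /pushforward preimage_set0 measure0. Qed.

Let step_ge0 A : (0 <= lebesgue_rV_step A)%E.
Proof. by rewrite /lebesgue_rV_step /pushforward measure_ge0. Qed.

Let step_sigma_additive : semi_sigma_additive lebesgue_rV_step.
Proof.
move=> F mF tF mUF; rewrite /lebesgue_rV_step /pushforward preimage_bigcup.
apply: measure_semi_sigma_additive.
- by move=> k; exact: measurable_preimage.
- apply/trivIsetP => /= i j _ _ ij; rewrite -preimage_setI.
  by move/trivIsetP : tF => /(_ _ _ _ _ ij) ->//; rewrite preimage_set0.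
- by rewrite -preimage_bigcup; exact: measurable_preimage.
Qed.

HB.instance Definition _ := isMeasure.Build _ _ _ lebesgue_rV_step
  step0 step_ge0 step_sigma_additive.

Let step_sigma_finite : sigma_finite setT lebesgue_rV_step.
Proof.
have [F TF mF] := sigma_finite_product (@lebesgue_measure R) mu.
exists (fun k => @rV_uncons n @^-1` F k).
  by rewrite -preimage_bigcup -TF preimage_setT.
move=> k; have [mFk Fk] := mF k; split.
  by rewrite -[X in measurable X]setTI; exact: measurable_rV_uncons.
rewrite /lebesgue_rV_step /pushforward -comp_preimage.
by rewrite (_ : _ @^-1` _ = F k)//; apply/seteqP; split => z /=; rewrite rV_consK.
Qed.

HB.instance Definition _ := Measure_isSigmaFinite.Build _ _ _ lebesgue_rV_step
  step_sigma_finite.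

End step.

Fixpoint lebesgue_rV n : {sigma_finite_measure set 'rV[R]_n -> \bar R} :=
  if n is k.+1 then lebesgue_rV_step (lebesgue_rV k) else dirac (0 : 'rV[R]_0).

End lebesgue_rV.

Definition lebesgue_xy (R : realType) (n : nat) :
    {measure set ('rV[R]_n * 'rV[R]_n)%type -> \bar R} :=
  product_measure1 (lebesgue_rV R n) (lebesgue_rV R n).

Definition lebesgue_xt (R : realType) (n : nat) :
    {measure set ('rV[R]_n * measurableTypeR R)%type -> \bar R} :=
  product_measure1 (lebesgue_rV R n) (@lebesgue_measure R).

(* The library norm on 'rV[R]_n is the sup norm, hence these. *)
Definition edot (R : realType) n (x y : 'rV[R]_n) : R :=
  \sum_(i < n) x ord0 i * y ord0 i.

Definition enorm (R : realType) n (x : 'rV[R]_n) : R := Num.sqrt (edot x x).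

(* Euler's integral for x > 0, continued to x <= 0 by
   Gamma x = Gamma (x + m) / (x (x + 1) ... (x + m - 1)); 0 at the poles. *)
Definition Gamma_integral (R : realType) (x : R) : R :=
  \int[@lebesgue_measure R]_(t in `]0, +oo[) (t `^ (x - 1) * expR (- t)).

Definition Gamma (R : realType) (x : R) : R :=
  let m := if 0 < x then 0%N else (Num.truncn (- x)).+1 in
  Gamma_integral (x + m%:R) / \prod_(i < m) (x + i%:R).

Section fractional_laplacian.
Variables (R : realType) (N : nat) (s : R).
Implicit Types (v w : 'rV[R]_N -> R) (x : 'rV[R]_N).

Definition fracLap_const : R :=
  2 `^ (2 * s) * pi `^ (- (N%:R / 2)) * Gamma ((N%:R + 2 * s) / 2)
  / `|Gamma (- s)|.

Definition fracLap_trunc v x (e : R) : R :=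
  fracLap_const * \int[lebesgue_rV R N]_(y in [set y | e < enorm (x - y)])
    ((v x - v y) / enorm (x - y) `^ (N%:R + 2 * s)).

(* The principal value; meaningful when fracLap_trunc v x converges at 0+. *)
Definition fracLap v x : R := lim (fracLap_trunc v x e @[e --> 0^'+]).

Definition gagliardo2 v : \bar R :=
  (\int[lebesgue_xy R N]_z
    ((v z.1 - v z.2) ^+ 2 / enorm (z.1 - z.2) `^ (N%:R + 2 * s))%:E)%E.

Definition energy_form v w : R :=
  fracLap_const / 2 * \int[lebesgue_xy R N]_z
    ((v z.1 - v z.2) * (w z.1 - w z.2)
     / enorm (z.1 - z.2) `^ (N%:R + 2 * s)).

Record H0s (Om : set 'rV[R]_N) w : Prop := {
  H0s_measurable : measurable_fun setT w ;
  H0s_exterior : forall x, ~ Om x -> w x = 0 ;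
  H0s_L2 : (\int[lebesgue_rV R N]_x (w x ^+ 2)%:E < +oo)%E ;
  H0s_seminorm : (gagliardo2 w < +oo)%E }.

Definition hardy_const : R :=
  2 `^ (2 * s) * Gamma ((N%:R + 2 * s) / 4) ^+ 2
  / Gamma ((N%:R - 2 * s) / 4) ^+ 2.

Definition hardy_param (alpha : R) : R :=
  2 `^ (2 * s) * Gamma ((N%:R + 2 * s + 2 * alpha) / 4)
               * Gamma ((N%:R + 2 * s - 2 * alpha) / 4)
  / (Gamma ((N%:R - 2 * s + 2 * alpha) / 4)
     * Gamma ((N%:R - 2 * s - 2 * alpha) / 4)).

(* p_+(lambda, s), where lambda = hardy_param alpha. *)
Definition p_plus (alpha : R) : R :=
  1 + 2 * s / ((N%:R - 2 * s) / 2 - alpha).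

End fractional_laplacian.

Section domain.
Variables (R : realType) (N : nat).

Definition C11 (g : 'rV[R]_N -> R) : Prop :=
  (forall x, differentiable g x) /\
  exists L : R, forall x y v,
    `|'d g x v - 'd g y v| <= L * enorm (x - y) * enorm v.

(* Near each boundary point, in the orthogonal splitting of R^N into the line
   of nu and its complement, Om is the region above the graph of g; the graph
   function is evaluated at the projection of x on the complement of nu. *)
Record bounded_C11_domain (Om : set 'rV[R]_N) : Prop := {
  domain_open : open Om ;
  domain_connected : connected Om ;
  domain_bounded : bounded_set Om ;
  domain_C11 : forall z, (closure Om `\` Om) z ->
    exists (nu : 'rV[R]_N) (r : R) (g : 'rV[R]_N -> R),
      [/\ enorm nu = 1, 0 < r, C11 g &
          forall x, enorm (x - z) < r ->
            (Om x <-> g (x - edot x nu *: nu) < edot x nu)] }.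

End domain.

Section parabolic.
Variables (R : realType) (N : nat) (s : R) (Om : set 'rV[R]_N) (T : R).
Implicit Types (phi u : 'rV[R]_N -> R -> R).

Record bounded_hoelder (h : 'rV[R]_N -> R -> R) : Prop := {
  bh_bounded : exists M : R, forall x (t : R), Om x -> 0 < t < T -> `|h x t| <= M ;
  bh_hoelder : exists a b C : R, [/\ 0 < a < 1, 0 < b < 1 &
    forall x y (t r : R), Om x -> Om y -> 0 < t < T -> 0 < r < T ->
      `|h x t - h y r| <= C * (enorm (x - y) `^ a + `|t - r| `^ b)] }.

(* phi is the bounded finite-energy solution of
     - phi_t + (-Delta)^s phi = h in Om x (0,T),  phi = 0 outside Om,
     phi(., T) = 0,
   and solves the equation pointwise.  tf_energy_solution is the identity
   - <phi_t, w> + energy_form phi w = <h, w> in H^{-s}(Om), integrated over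
   (t1, t2); its validity for all w and t1 <= t2 says that phi_t is in
   L^2(0,T; H^{-s}(Om)) and that the equation holds there. *)
Record test_solution (h phi : 'rV[R]_N -> R -> R) : Prop := {
  tf_measurable : measurable_fun ([set: 'rV[R]_N] `*` `[0, T])
    (fun z : 'rV[R]_N * R => phi z.1 z.2) ;
  tf_bounded : exists M : R, forall x (t : R), 0 <= t <= T -> `|phi x t| <= M ;
  tf_exterior : forall x (t : R), ~ Om x -> 0 < t <= T -> phi x t = 0 ;
  tf_final : forall x, Om x -> phi x T = 0 ;
  tf_finite_energy :
    (\int[@lebesgue_measure R]_(t in `]0%R, T[)
       gagliardo2 s (phi ^~ t) < +oo)%E ;
  tf_continuous_L2 : forall t : R, 0 <= t <= T ->
    (\int[lebesgue_rV R N]_(x in Om) ((phi x r - phi x t) ^+ 2)%:E)%E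
      @[r --> within `[0, T] (nbhs t)] --> 0%E ;
  tf_energy_solution : forall w, H0s s Om w ->
    forall t1 t2 : R, 0 <= t1 -> t1 <= t2 -> t2 <= T ->
    \int[lebesgue_rV R N]_(x in Om) (phi x t1 * w x)
    - \int[lebesgue_rV R N]_(x in Om) (phi x t2 * w x)
    + \int[@lebesgue_measure R]_(t in `]t1, t2[) energy_form s (phi ^~ t) w
    = \int[lebesgue_xt R N]_(z in Om `*` `]t1, t2[) (h z.1 z.2 * w z.1) ;
  tf_strong_solution : forall x (t : R), Om x -> 0 < t < T ->
    [/\ derivable (phi x) t 1,
        cvg (fracLap_trunc s (phi ^~ t) x e @[e --> 0^'+]) &
        - derive1 (phi x) t + fracLap s (phi ^~ t) x = h x t] }.

Definition test_class phi : Prop :=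
  exists2 h, bounded_hoelder h & test_solution h phi.

(* The space-time integrals of the weak inequality are extended-real: the
   integral of u (-Delta)^s phi over the exterior may be -oo, since there only
   u >= 0 is known, and then the inequality fails. *)
Record weak_supersolution (F : 'rV[R]_N -> R -> R -> R) (u0 : 'rV[R]_N -> R)
    u : Prop := {
  ws_measurable : measurable_fun ([set: 'rV[R]_N] `*` `[0, T[)
    (fun z : 'rV[R]_N * R => u z.1 z.2) ;
  ws_L1 : forall t : R, 0 <= t < T ->
    (lebesgue_rV R N).-integrable Om (fun x => (u x t)%:E) ;
  ws_continuous_L1 : forall t : R, 0 <= t < T ->
    (\int[lebesgue_rV R N]_(x in Om) `|u x r - u x t|%:E)%E
      @[r --> within `[0, T[ (nbhs t)] --> 0%E ;
  ws_source : (lebesgue_xt R N).-integrable (Om `*` `]0, T[)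
    (fun z => (F z.1 z.2 (u z.1 z.2))%:E) ;
  ws_exterior : {ae lebesgue_xt R N, forall z,
    ~ Om z.1 -> 0 <= (z.2 : R) < T -> 0 <= u z.1 z.2} ;
  ws_initial : {ae lebesgue_rV R N, forall x, Om x -> u0 x <= u x 0} ;
  ws_inequality : forall phi, test_class phi ->
    (forall x (t : R), 0 <= t <= T -> 0 <= phi x t) ->
    (\int[lebesgue_xt R N]_(z in Om `*` `]0%R, T[)
        (u z.1 z.2 * - derive1 (phi z.1) z.2)%:E
     + \int[lebesgue_xt R N]_(z in [set: 'rV[R]_N] `*` `]0%R, T[)
        (u z.1 z.2 * fracLap s (phi ^~ z.2) z.1)%:E
     >= \int[lebesgue_xt R N]_(z in Om `*` `]0%R, T[)
          (F z.1 z.2 (u z.1 z.2) * phi z.1 z.2)%:E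
        + \int[lebesgue_rV R N]_(x in Om) (u0 x * phi x 0%R)%:E)%E }.

End parabolic.

Definition hardy_source (R : realType) (N : nat) (s lambda p : R)
    (f : 'rV[R]_N -> R -> R) (x : 'rV[R]_N) (t u : R) : R :=
  lambda * (u / enorm x `^ (2 * s)) + u `^ p + f x t.

(* Main.v *)
Require Import Defs.
From mathcomp Require Import all_boot all_order all_algebra.
From mathcomp Require Import all_classical all_reals all_analysis.
From mathcomp Require Import mathcomp_extra real_interval measurable_realfun.
From mathcomp Require Import ring lra.
Set Implicit Arguments.
Unset Strict Implicit.
Unset Printing Implicit Defensive.
Import Order.TTheory GRing.Theory Num.Theory.
Import numFieldNormedType.Exports.
Local Open Scope classical_set_scope.
Local Open Scope ring_scope.

(** A nonnegative weak supersolution $u$ vanishes almost everywhere; both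
    claims follow, since a positive one would make $\Omega\times(0,T)$ null.
    No iteration is used: it is enough to test with one explicit family
    $(T-t)^{n+1}\psi(x)$, where $\psi\ge0$ is supported in a small ball of
    radius $r=\sqrt\rho$ around the singularity.

    Write $b(x)=|x|^2+c$.  The power $b^{-m}$ is mapped by the fractional
    Laplacian to $b^{-m-s}$ times a factor that tends to the Hardy symbol
    $\Lambda(m)$ as $c/b\to0$ ([integral_sdiff_bracket], [jump_bounds],
    [fracLap_bracket]); the formula comes from writing the powers as Beta
    integrals and completing a square.  The exponent
    $2m_1=\frac{N-2s}2+\alpha$ satisfies $\Lambda(m_1)=\lambda$, and
    $\Lambda(m_2)<\lambda$ for $m_2>m_1$, by strict log-convexity of a quotient
    of Gamma functions ([Gammaratio_lt], [hardy_symbol_lt]).  The profile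
    $W=b^{-m_2}-\rho^{m_1-m_2}b^{-m_1}$ is positive only where $b<\rho$, and
    there it is a subsolution of the Hardy equation with some room to spare.
    The barrier $\psi$ is a convex function of $W$ vanishing for $W\le0$, so
    that convexity transfers the inequality ([fracLap_barrier]):
    $(-\Delta)^s\psi\le\lambda b^{-s}\psi-\frac\delta2\rho^{-s}\psi$, except in
    a core $b<Kc$, where an error of size $b^{-s-m_2}$ appears.

    In the weak inequality, the Hardy term $\lambda u|x|^{-2s}\psi$ cancels the
    first term.  The time derivative is absorbed by the second one when $T-t$
    is large compared with $\rho^s$, and otherwise by Young's inequality
    against $u^p$; this costs only $C\rho^M\psi$ with $M>0$
    ([time_absorption]).  In the core Young's inequality leaves an error whose
    integral is of order $c^{N/2-m_2-sp/(p-1)}$ ([barrier_pointwise]).  The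
    exponent is positive for some $m_2>m_1$ exactly when $p>p_+(\lambda,s)$,
    and this error disappears as $c\to0$.

    Outside the ball $\psi$ vanishes, so $(-\Delta)^s\psi$ is negative there, of
    size $\int\psi$ ([fracLap_barrier_far]).  The tested inequality therefore
    bounds a weighted integral of $u$ over the exterior of the ball by
    $C\rho^M$ ([tested_inequality]).  Letting $\rho\to0$ shows that $u=0$ away
    from the origin.

    The test functions belong to the class because $\psi$ is Lipschitz with
    second differences bounded by $C|y|^2$ ([regular]): this makes the
    fractional Laplacian an absolutely convergent, Hoelder continuous integral
    of second differences and yields the energy identity ([energy_formE]). *)

(** * Invariance of Lebesgue measure under affine maps *)

Section one_dim.
Context {R : realType}.
Notation mu := (@lebesgue_measure R).
Local Open Scope ereal_scope.

Lemma lebesgue_measureDr (c : R) (A : set R) : measurable A ->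
  pushforward mu (fun x : measurableTypeR R => (x + c)%R : measurableTypeR R) A
  = mu A.
Proof.
have mshift : measurable_fun setT
    (fun x : measurableTypeR R => (x + c)%R : measurableTypeR R).
  exact: measurable_funD.
move=> mA; apply/esym/lebesgue_measure_unique => //= _ [[a b]] _ <-.
rewrite /pushforward.
rewrite (_ : _ @^-1` _ = `](a - c)%R, (b - c)%R]%classic); last first.
  by apply/seteqP; split => x /=; rewrite !in_itv/= ltrBlDr lerBrDr.
by rewrite !lebesgue_measure_itv/= !lte_fin ltrD2r -EFinB; congr (if _ then _ else _);
  rewrite EFinB -!EFinB; congr EFin; ring.
Qed.

Lemma ge0_integral_affine (b : bool) (c : R) (f : R -> \bar R) :
  measurable_fun setT f -> (forall x, 0 <= f x) ->
  \int[mu]_x f ((-1) ^+ b * x + c)%R = \int[mu]_x f x.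
Proof.
move=> mf f0.
have mshift : measurable_fun setT
    (fun x : measurableTypeR R => (x + c)%R : measurableTypeR R).
  exact: measurable_funD.
transitivity (\int[mu]_x f (x + c)%R); last first.
  rewrite -[RHS](@eq_measure_integral _ _ _ _ _ (pushforward mu
    (fun x : measurableTypeR R => (x + c)%R : measurableTypeR R))).
    by rewrite ge0_integral_pushforward.
  by move=> A mA _; exact: lebesgue_measureDr.
case: b; last by apply: eq_integral => x _; rewrite expr0 mul1r.
have mfc : measurable_fun setT (fun x : R => f (x + c)%R).
  exact: measurableT_comp.
rewrite -[RHS](@eq_measure_integral _ _ _ _ _ (pushforward mu
    (-%R : _ -> measurableTypeR R))).
  rewrite ge0_integral_pushforward//.
  by apply: eq_integral => x _ /=; rewrite expr1 mulN1r.
by move=> A mA _; exact: lebesgue_measureN.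
Qed.

End one_dim.

Section rV.
Context {R : realType}.
Notation mu := (@lebesgue_measure R).
Notation mu_ n := (lebesgue_rV R n).
Local Open Scope ereal_scope.

Lemma ge0_integral_rV_cons n (f : 'rV[R]_n.+1 -> \bar R) :
  measurable_fun setT f -> (forall x, 0 <= f x) ->
  \int[mu_ n.+1]_x f x = \int[mu]_a \int[mu_ n]_v f (rV_cons (a, v)).
Proof.
move=> mf f0.
rewrite [LHS](_ : _ = \int[lebesgue_rV_step (mu_ n)]_x f x)//.
rewrite /lebesgue_rV_step ge0_integral_pushforward//; last first.
  exact: measurable_rV_cons.
rewrite preimage_setT fubini_tonelli1//=.
by apply: measurableT_comp => //; exact: measurable_rV_cons.
Qed.

Lemma measurable_affine_rV n (b : bool) (c : 'rV[R]_n) :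
  measurable_fun setT (fun x : 'rV[R]_n => ((-1) ^+ b *: x + c)%R).
Proof.
apply: measurable_fun_rVP => i.
rewrite (_ : (fun x => _) =
  (fun x : 'rV[R]_n => ((-1) ^+ b * x ord0 i + c ord0 i)%R)); last first.
  by apply/funext => x; rewrite !mxE.
apply: measurable_funD => //; apply: measurable_funM => //.
exact: (measurable_coord (T := R)).
Qed.

Lemma ge0_integral_affine_rV n (b : bool) (c : 'rV[R]_n)
    (f : 'rV[R]_n -> \bar R) :
  measurable_fun setT f -> (forall x, 0 <= f x) ->
  \int[mu_ n]_x f ((-1) ^+ b *: x + c)%R = \int[mu_ n]_x f x.
Proof.
elim: n c f => [|n IH] c f mf f0.
  by apply: eq_integral => x _; rewrite !thinmx0.
rewrite !ge0_integral_rV_cons//; last first.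
  by apply: measurableT_comp => //; exact: measurable_affine_rV.
pose c' : 'rV[R]_n := (\row_i c ord0 (lift ord0 i))%R.
have mfc : measurable_fun setT (f \o @rV_cons R n).
  by apply: measurableT_comp => //; exact: measurable_rV_cons.
transitivity (\int[mu]_a \int[mu_ n]_v
    f (rV_cons ((-1) ^+ b * a + c ord0 ord0, (-1) ^+ b *: v + c')%R)).
  apply: eq_integral => a _; apply: eq_integral => v _; congr f.
  apply/rowP => i; rewrite !mxE/=.
  by case: (unliftP ord0 i) => [j|] ->; rewrite /= ?mxE.
under eq_integral => a _.
  rewrite (IH c' (fun v => f (rV_cons ((-1) ^+ b * a + c ord0 ord0, v)%R)))//;
    last by exact: (measurableT_comp mfc (measurable_pair1 _)).
  over.
rewrite (ge0_integral_affine b (c ord0 ord0)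
  (f := fun a => \int[mu_ n]_v f (rV_cons (a, v))))//.
- exact: (measurable_fun_fubini_tonelli_F (f \o @rV_cons R n) mfc (fun z => f0 _)).
- by move=> x; apply: integral_ge0 => v _; exact: f0.
Qed.

End rV.

(** * The Euclidean norm *)

Section euclid.
Context {R : realType}.
Notation mu_ n := (lebesgue_rV R n).

Lemma edotC n (x y : 'rV[R]_n) : edot x y = edot y x.
Proof. by apply: eq_bigr => i _; rewrite mulrC. Qed.

Lemma edotDl n (x y z : 'rV[R]_n) : edot (x + y) z = edot x z + edot y z.
Proof. by rewrite /edot -big_split; apply: eq_bigr => i _; rewrite mxE mulrDl. Qed.

Lemma edotZl n a (x y : 'rV[R]_n) : edot (a *: x) y = a * edot x y.
Proof. by rewrite /edot mulr_sumr; apply: eq_bigr => i _; rewrite mxE mulrA. Qed.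

Lemma edotDr n (x y z : 'rV[R]_n) : edot z (x + y) = edot z x + edot z y.
Proof. by rewrite edotC edotDl !(edotC z). Qed.

Lemma edotZr n a (x y : 'rV[R]_n) : edot x (a *: y) = a * edot x y.
Proof. by rewrite edotC edotZl edotC. Qed.

Lemma edotNl n (x y : 'rV[R]_n) : edot (- x) y = - edot x y.
Proof. by rewrite -scaleN1r edotZl mulN1r. Qed.

Lemma edotNr n (x y : 'rV[R]_n) : edot x (- y) = - edot x y.
Proof. by rewrite edotC edotNl edotC. Qed.

Lemma edot_ge0 n (x : 'rV[R]_n) : 0 <= edot x x.
Proof. by apply: sumr_ge0 => i _; rewrite -expr2 sqr_ge0. Qed.

Lemma edot_eq0 n (x : 'rV[R]_n) : edot x x = 0 -> x = 0.
Proof.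
move/eqP; rewrite psumr_eq0; last by move=> i _; rewrite -expr2 sqr_ge0.
move/allP => x0; apply/rowP => i; apply/eqP; rewrite mxE.
by have := x0 i; rewrite mem_index_enum => /(_ isT); rewrite mulf_eq0 orbb.
Qed.

Lemma enorm_ge0 n (x : 'rV[R]_n) : 0 <= enorm x.
Proof. exact: sqrtr_ge0. Qed.

Lemma sqr_enorm n (x : 'rV[R]_n) : enorm x ^+ 2 = edot x x.
Proof. by rewrite sqr_sqrtr// edot_ge0. Qed.

Lemma enorm_eq0 n (x : 'rV[R]_n) : enorm x = 0 -> x = 0.
Proof. by move=> x0; apply: edot_eq0; rewrite -sqr_enorm x0 expr0n. Qed.

Lemma enormN n (x : 'rV[R]_n) : enorm (- x) = enorm x.
Proof. by rewrite /enorm edotNl edotNr opprK. Qed.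

Lemma edot_le n (x y : 'rV[R]_n) : `|edot x y| <= enorm x * enorm y.
Proof.
have [y0|y0] := eqVneq (edot y y) 0.
  by rewrite (edot_eq0 y0) -(scale0r 0) edotZr mul0r normr0 mulr_ge0// enorm_ge0.
have yy : 0 < edot y y by rewrite lt_neqAle eq_sym y0 edot_ge0.
rewrite -(@ler_pXn2r _ 2)// ?nnegrE ?mulr_ge0 ?enorm_ge0//.
rewrite exprMn !sqr_enorm real_normK ?num_real//.
have := edot_ge0 (edot y y *: x - edot x y *: y).
rewrite !(edotDl,edotDr,edotNl,edotNr,edotZl,edotZr) (edotC y x).
move=> H; rewrite -subr_ge0 -(pmulr_rge0 _ yy).
by apply: le_trans H _; rewrite le_eqVlt; apply/orP; left; apply/eqP; ring.
Qed.

Lemma ler_enormD n (x y : 'rV[R]_n) : enorm (x + y) <= enorm x + enorm y.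
Proof.
rewrite -(@ler_pXn2r _ 2)// ?nnegrE ?addr_ge0 ?enorm_ge0//.
rewrite sqrrD !sqr_enorm edotDl !edotDr (edotC y x).
have : edot x y <= enorm x * enorm y by exact: le_trans (ler_norm _) (edot_le _ _).
by lra.
Qed.

Lemma measurable_edot d (T : measurableType d) n (f g : T -> 'rV[R]_n) :
  measurable_fun setT f -> measurable_fun setT g ->
  measurable_fun setT (fun z => edot (f z) (g z)).
Proof.
move=> mf mg; apply: measurable_sum => i; apply: measurable_funM.
  exact: (measurableT_comp (measurable_coord (T := R) i)).
exact: (measurableT_comp (measurable_coord (T := R) i)).
Qed.

Lemma measurable_enorm d (T : measurableType d) n (f : T -> 'rV[R]_n) :
  measurable_fun setT f -> measurable_fun setT (fun z => enorm (f z)).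
Proof.
move=> mf; have ms : measurable_fun setT (@Num.sqrt R).
  by apply: continuous_measurable_fun; exact: sqrt_continuous.
exact: (measurableT_comp ms (measurable_edot mf mf)).
Qed.

Lemma measurable_rVD d (T : measurableType d) n (f g : T -> 'rV[R]_n) :
  measurable_fun setT f -> measurable_fun setT g ->
  measurable_fun setT (fun z => f z + g z).
Proof.
move=> mf mg; apply: measurable_fun_rVP => i.
under eq_fun do rewrite mxE.
apply: measurable_funD.
  exact: (measurableT_comp (measurable_coord (T := R) i)).
exact: (measurableT_comp (measurable_coord (T := R) i)).
Qed.

Lemma measurable_rVN d (T : measurableType d) n (f : T -> 'rV[R]_n) :
  measurable_fun setT f -> measurable_fun setT (fun z => - f z).
Proof.
move=> mf; apply: measurable_fun_rVP => i.
under eq_fun do rewrite mxE.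
apply: measurable_funN; exact: (measurableT_comp (measurable_coord (T := R) i)).
Qed.

Lemma measurable_rVB d (T : measurableType d) n (f g : T -> 'rV[R]_n) :
  measurable_fun setT f -> measurable_fun setT g ->
  measurable_fun setT (fun z => f z - g z).
Proof. by move=> mf mg; apply: measurable_rVD => //; exact: measurable_rVN. Qed.

Lemma measurable_cube n (c : 'rV[R]_n) (h : R) :
  measurable [set x : 'rV[R]_n | forall i, `|x ord0 i - c ord0 i| <= h].
Proof.
rewrite (_ : [set x | _] = \bigcap_(i in [set: 'I_n])
    [set x : 'rV[R]_n | `|x ord0 i - c ord0 i| <= h]); last first.
  by apply/seteqP; split => x /= H i; [move=> _; exact: H|exact: (H i)].
apply: fin_bigcap_measurable => // i _.
rewrite -[X in measurable X]setTI.
apply: (@measurable_fun_ler _ _ _ setT (fun x : 'rV[R]_n => `|x ord0 i - c ord0 i|)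
  (cst h) _ _ measurableT [set true]) => //.
apply: measurableT_comp => //; apply: measurable_funB => //.
exact: (measurable_coord (T := R)).
Qed.

Lemma open_measurable_rV n (U : set 'rV[R]_n) : open U -> measurable U.
Proof.
move=> oU.
pose B (q : 'rV[rat]_n * nat) := [set x : 'rV[R]_n |
  forall i, `|x ord0 i - (map_mx ratr q.1 : 'rV[R]_n) ord0 i| <= q.2.+1%:R^-1].
pose F k := if @unpickle ('rV[rat]_n * nat)%type k is Some q then
   if pselect (B q `<=` U) then B q else set0 else set0.
rewrite (_ : U = \bigcup_k F k); last first.
  apply/seteqP; split => [x Ux|x [k _]]; last first.
    by rewrite /F; case: unpickle => // q; case: pselect => // qU /qU.
  have /nbhs_ballP[e /= e0 eU] : nbhs x U by move: oU; rewrite openE => /(_ _ Ux).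
  have [m me] : exists m, m.+1%:R^-1 < e / 2 :> R.
    have e2 : 0 < e / 2 by rewrite divr_gt0.
    exists (Num.truncn (e / 2)^-1); rewrite invf_plt ?posrE//.
    exact: truncnS_gt.
  have /choice[q xq] : forall i, exists q : rat, `|x ord0 i - ratr q| <= m.+1%:R^-1.
    move=> i; have m0 : 0 < m.+1%:R^-1 :> R by rewrite invr_gt0.
    have : x ord0 i < x ord0 i + m.+1%:R^-1 by rewrite ltrDl.
    move=> /rat_in_itvoo[q]; rewrite in_itv/= => /andP[q1 q2]; exists q.
    move: m0 q1 q2; set d := _^-1 => m0 q1 q2.
    by rewrite ler_norml; apply/andP; split; lra.
  exists (pickle (\row_i q i, m)) => //; rewrite /F pickleK.
  case: pselect => [_ i|[]]; first by rewrite !mxE.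
  move=> y By; apply: eU; split=> [//|i j]; rewrite (ord1 i) /ball/=.
  have := By j; have := xq j; rewrite !mxE/=; move: me; set d := _^-1 => me.
  rewrite (distrC (y _ _)) => ha hb.
  by rewrite (le_lt_trans (ler_distD (ratr (q j)) _ _))//; lra.
apply: bigcupT_measurable => k; rewrite /F; case: unpickle => // q.
by case: (pselect _) => qU /=; [exact: measurable_cube|exact: measurable0].
Qed.

Lemma lebesgue_rV_cube n (h : R) : 0 <= h ->
  mu_ n [set x : 'rV[R]_n | forall i, `|x ord0 i| <= h] = ((h *+ 2) ^+ n)%:E.
Proof.
move=> h0; elim: n => [|n IH].
  rewrite expr0 /= diracE mem_set//= => i; by case: i.
rewrite [LHS](_ : _ = lebesgue_rV_step (mu_ n) [set x | forall i, `|x ord0 i| <= h])//.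
rewrite /lebesgue_rV_step /pushforward.
rewrite (_ : _ @^-1` _ = `[- h, h]%classic `*`
    [set x : 'rV[R]_n | forall i, `|x ord0 i| <= h]); last first.
  apply/seteqP; split => -[a v] /=.
    move=> H; split; first by have := H ord0; rewrite !mxE unlift_none/= in_itv/= ler_norml.
    by move=> i; have := H (lift ord0 i); rewrite !mxE liftK.
  rewrite in_itv/= -ler_norml => -[ah vh] i; rewrite !mxE.
  by case: (unliftP ord0 i) => [j|] _ /=; [exact: vh|exact: ah].
rewrite product_measure1E//; last first.
  rewrite [X in measurable X](_ : _ = [set x : 'rV[R]_n |
    forall i, `|x ord0 i - (0 : 'rV[R]_n) ord0 i| <= h]); last first.
    by apply/seteqP; split => x /= H i; have := H i; rewrite mxE subr0.
  exact: measurable_cube.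
rewrite IH; set a := (X in (X * _)%E); have -> : a = (if - h < h then (h - - h)%:E else 0%E).
  by rewrite /a [LHS]lebesgue_measure_itv/= lte_fin EFinB.
case: ltP => hh.
  by rewrite -EFinM exprS opprK mulr2n.
have -> : h = 0 by lra.
by rewrite mul0e mul0rn expr0n.
Qed.

End euclid.

(** * The Gamma function *)

Section real_integrands.
Context d (T : measurableType d) (R : realType) (mu : {measure set T -> \bar R}).
Implicit Types f g : T -> R.
Local Open Scope ereal_scope.

Lemma ge0_integralrZ (k : R) f : measurable_fun setT f ->
  (forall x, 0 <= f x)%R -> (0 <= k)%R ->
  \int[mu]_x (k * f x)%:E = k%:E * \int[mu]_x (f x)%:E.
Proof.
move=> mf f0 k0; under eq_integral do rewrite EFinM.
rewrite ge0_integralZl//; first exact/measurable_EFinP.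
by move=> x _; rewrite lee_fin.
Qed.

Lemma ge0_integralrD f g : measurable_fun setT f -> (forall x, 0 <= f x)%R ->
  measurable_fun setT g -> (forall x, 0 <= g x)%R ->
  \int[mu]_x (f x + g x)%:E = \int[mu]_x (f x)%:E + \int[mu]_x (g x)%:E.
Proof.
move=> mf f0 mg g0; under eq_integral do rewrite EFinD.
rewrite ge0_integralD//; [by move=> x _; rewrite lee_fin|exact/measurable_EFinP|
  by move=> x _; rewrite lee_fin|exact/measurable_EFinP].
Qed.

Lemma ge0_le_integralr f g : measurable_fun setT f -> (forall x, 0 <= f x)%R ->
  measurable_fun setT g -> (forall x, f x <= g x)%R ->
  \int[mu]_x (f x)%:E <= \int[mu]_x (g x)%:E.
Proof.
move=> mf f0 mg fg; apply: ge0_le_integral => //; first by move=> x _; rewrite lee_fin.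
- exact/measurable_EFinP.
- exact/measurable_EFinP.
- by move=> x _; rewrite lee_fin.
Qed.

Lemma ge0_integrabler f : measurable_fun setT f -> (forall x, 0 <= f x)%R ->
  \int[mu]_x (f x)%:E < +oo -> mu.-integrable setT (fun x => (f x)%:E).
Proof.
move=> mf f0 foo; apply/integrableP; split; first exact/measurable_EFinP.
by under eq_integral do rewrite gee0_abs ?lee_fin//.
Qed.

End real_integrands.

Section line.
Context {R : realType}.
Notation mu := (@lebesgue_measure R).
Local Open Scope ereal_scope.

Lemma ge0_integral_opp (f : R -> R) : measurable_fun setT f ->
  (forall x, 0 <= f x)%R -> \int[mu]_x (f (- x)%R)%:E = \int[mu]_x (f x)%:E.
Proof.
move=> mf f0; rewrite -[RHS](ge0_integral_affine true 0%R).
- by apply: eq_integral => x _; rewrite expr1 mulN1r addr0.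
- exact/measurable_EFinP.
- by move=> x; rewrite lee_fin.
Qed.

Lemma ge0_integral_shift (c : R) (f : R -> R) : measurable_fun setT f ->
  (forall x, 0 <= f x)%R -> \int[mu]_x (f (x + c)%R)%:E = \int[mu]_x (f x)%:E.
Proof.
move=> mf f0; rewrite -[RHS](ge0_integral_affine false c).
- by apply: eq_integral => x _; rewrite expr0 mul1r.
- exact/measurable_EFinP.
- by move=> x; rewrite lee_fin.
Qed.

End line.

Section log_integrals.
Context {R : realType}.
Notation mu := (@lebesgue_measure R).
Implicit Types (a s X : R).

Lemma measurable_expR_comp d (T : measurableType d) (f : T -> R) :
  measurable_fun setT f -> measurable_fun setT (fun x => expR (f x)).
Proof. by move=> mf; exact: (measurableT_comp (@measurable_expR R) mf). Qed.

(** The fundamental theorem of calculus on a half line going to $-\infty$, by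
    reflection of the one going to $+\infty$. *)
Lemma integral_Ny_ge0_FTC (F f : R -> R) (u l : R) :
  (forall x, 0 <= f x) -> continuous f ->
  (forall x, is_derive x (1 : R) F (f x)) ->
  F x @[x --> -oo] --> l ->
  (\int[mu]_x ((x <= u)%R%:R * f x)%:E = (F u - l)%:E)%E.
Proof.
move=> f0 cf dF Fl.
have dFN x : is_derive x (1 : R) (fun x : R => - F (- x)) (f (- x)).
  have h : is_derive x (1 : R) (F \o -%R) (f (- x) * -1).
    apply: is_derive1_comp; apply: is_deriveN.
  rewrite (_ : f (- x) = - (f (- x) * -1)); last by ring.
  exact: is_deriveN.
have cfN : continuous (fun x => f (- x)).
  by move=> x; apply: continuous_comp; [exact: opp_continuous|exact: cf].
rewrite -(ge0_integral_affine true 0); last 2 first.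
- apply/measurable_EFinP; apply: measurable_funM.
    rewrite (_ : (fun x => _) = \1_[set` `]-oo, u]]); last first.
      by apply/funext => x; rewrite indicE mem_setE in_itv.
    exact: measurable_indic.
  exact: continuous_measurable_fun.
- by move=> x; rewrite lee_fin mulr_ge0// ler0n.
transitivity (\int[mu]_(x in `[(- u)%R, +oo[) (f (- x)%R)%:E)%E.
  rewrite [RHS]integral_mkcond; apply: eq_integral => x _.
  rewrite patchE mem_setE in_itv/= andbT expr1 mulN1r addr0 lerNl.
  by case: ifP => _; rewrite ?mul1r ?mul0r.
rewrite (@ge0_continuous_FTC2y _ _ (fun x => - F (- x)) (- u) (- l))//=.
- by rewrite !opprK addeC -EFinD.
- exact: continuous_subspaceT.
- by apply: cvgN; apply/(cvgNy_compNP _ _).1 : Fl.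
- apply: cvg_at_right_filter.
  have /derivable1_diffP/differentiable_continuous := @ex_derive _ _ _ _ _ _ _ (dFN (- u)).
  by [].
- by move=> x _; rewrite derive1E derive_val.
Qed.

End log_integrals.

Section gamma.
Context {R : realType}.
Notation mu := (@lebesgue_measure R).
Implicit Types (a s X : R).
Local Open Scope ereal_scope.

Lemma integral_expR_Ny s (u : R) : (0 < s)%R ->
  \int[mu]_x ((x <= u)%R%:R * expR (s * x))%:E = (expR (s * u) / s)%:E.
Proof.
move=> s0.
have dF x : is_derive x (1 : R)%R (fun x => expR (s * x) / s)%R (expR (s * x)).
  have h : is_derive x (1 : R)%R (expR \o ( *%R s)) (expR (s * x) * s)%R.
    apply: is_derive1_comp; rewrite -[X in is_derive _ _ _ X]mulr1.
    exact: is_deriveZ.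
  rewrite (_ : expR (s * x) = s^-1 *: (expR (s * x) * s))%R; last first.
    by rewrite /GRing.scale/= mulrCA mulVf ?mulr1// gt_eqF.
  rewrite (_ : (fun x => _) = (s^-1 \*: (expR \o ( *%R s)))%R); last first.
    by apply/funext => y /=; rewrite /GRing.scale/= mulrC.
  exact: is_deriveZ.
rewrite (@integral_Ny_ge0_FTC R (fun x => expR (s * x) / s)%R _ _ 0%R _ _ dF).
- by rewrite subr0.
- by move=> x; exact: expR_ge0.
- move=> x; apply: continuous_comp; last exact: continuous_expR.
  exact: mulrl_continuous.
- rewrite -[X in _ --> X](mul0r s^-1%R); apply: cvgM; last exact: cvg_cst.
  apply/cvgNy_compNP => /=.
  under eq_fun do rewrite mulrN.
  apply: (@cvg_comp _ _ _ (fun x => s * x)%R (fun x => expR (- x)%R) _ (pinfty_nbhs R)).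
    exact: gt0_cvgMry.
  exact: cvgr_expR.
Qed.

Lemma integral_Gumbel (u : R) :
  \int[mu]_x ((x <= u)%R%:R * expR (x - expR x))%:E = (1 - expR (- expR u))%:E.
Proof.
have dF x : is_derive x (1 : R)%R (fun x => - expR (- expR x))%R (expR (x - expR x)).
  have h : is_derive x (1 : R)%R (expR \o -%R \o expR) (expR (- expR x) * (- 1) * expR x)%R.
    apply: is_derive1_comp; apply: is_derive1_comp; exact: is_deriveN.
  rewrite (_ : expR (x - expR x) = - (expR (- expR x) * (- 1) * expR x))%R; last first.
    by rewrite expRD mulrN1 mulNr opprK mulrC.
  exact: is_deriveN.
rewrite (@integral_Ny_ge0_FTC R (fun x => - expR (- expR x))%R _ _ (- 1)%R _ _ dF).
- by rewrite opprK addrC.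
- by move=> x; exact: expR_ge0.
- move=> x; apply: continuous_comp; last exact: continuous_expR.
  by apply: continuousB => //; exact: continuous_expR.
- apply: cvgN; rewrite -expR0 -oppr0.
  apply: (@cvg_comp _ _ _ expR (fun x => expR (- x))%R _ (nbhs (0 : R))%R).
    by apply/cvgNy_compNP; exact: cvgr_expR.
  apply: continuous_comp; [exact: opp_continuous|exact: continuous_expR].
Qed.

Lemma measurable_Gamma_integrand a X :
  measurable_fun setT (fun u : R => (expR (a * u - X * expR u))%:E).
Proof.
apply/measurable_EFinP; apply: measurable_expR_comp; apply: measurable_funB.
  exact: mulrl_measurable.
by apply: measurable_funM => //; exact: measurable_expR.
Qed.

Lemma Gamma_integral_lty a : (0 < a)%R ->
  \int[mu]_u (expR (a * u - expR u))%:E < +oo.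
Proof.
move=> a0.
pose c := expR ((a + 1) ^+ 2)%R.
pose h s (x : R) : R := ((x <= 0)%R%:R * expR (s * x))%R.
have mh s : measurable_fun setT (h s).
  apply: measurable_funM; last by apply: measurable_expR_comp; exact: mulrl_measurable.
  rewrite (_ : (fun x => _) = \1_[set` `]-oo, 0]%R])%R; last first.
    by apply/funext => x; rewrite indicE mem_setE in_itv.
  exact: measurable_indic.
have h0 s x : (0 <= h s x)%R by rewrite mulr_ge0 ?expR_ge0 ?ler0n.
have c0 : (0 <= c)%R by rewrite expR_ge0.
have mhN : measurable_fun setT (fun x : R => h 1 (- x))%R.
  exact: (measurableT_comp (mh 1%R)).
apply: (@le_lt_trans _ _ (\int[mu]_u (h a u + c * h 1 (- u))%:E)).
  apply: ge0_le_integralr => [|u||u].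
  - apply: measurable_expR_comp; apply: measurable_funB.
      exact: mulrl_measurable.
    exact: measurable_expR.
  - exact: expR_ge0.
  - by apply: measurable_funD; [exact: mh|apply: measurable_funM].
  rewrite /h; have [u0|u0] := leP u 0%R.
    rewrite /= mulr1n mul1r -[leLHS]addr0 lerD//; first by rewrite ler_expR gerBl expR_ge0.
    by rewrite mulr_ge0 ?expR_ge0// mulr_ge0 ?expR_ge0 ?ler0n.
  rewrite /= mulr0n mul0r add0r oppr_le0 (ltW u0) mulr1n !mul1r -expRD ler_expR.
  have : ((1 + u / 2) ^+ 2 <= expR u)%R.
    rewrite [X in (_ <= expR X)%R](_ : u = 2%:R * (u / 2))%R; last by field.
    rewrite expRM_natl ler_pXn2r ?nnegrE ?expR_ge0 ?expR_ge1Dx//.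
    by rewrite addr_ge0// divr_ge0// ltW.
  have := sqr_ge0 (a + 1 - u / 2)%R; nra.
rewrite ge0_integralrD//; last 2 first.
- exact: measurable_funM.
- by move=> u; rewrite mulr_ge0.
rewrite ge0_integralrZ//.
rewrite {1}/h integral_expR_Ny// (ge0_integral_opp (mh 1%R))// /h integral_expR_Ny// -EFinM ltry//.
exact: mh.
Qed.

Lemma Gamma_gt0E a : (0 < a)%R -> Gamma a = Gamma_integral a.
Proof. by move=> a0; rewrite /Gamma a0 big_ord0 divr1 addr0. Qed.

(** In the logarithmic variable $t = e^u$ Euler's integral runs over the whole
    line, dilations become translations, and no singularity is left. *)
Lemma Gamma_log a : (0 < a)%R ->
  \int[mu]_u (expR (a * u - expR u))%:E = (Gamma a)%:E.
Proof.
move=> a0; rewrite Gamma_gt0E// /Gamma_integral /Rintegral.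
pose G (t : R) := (t `^ (a - 1) * expR (- t))%R.
have G0 t : (0 <= G t)%R by rewrite mulr_ge0 ?powR_ge0 ?expR_ge0.
have mG : measurable_fun setT (fun t : R => (G t)%:E).
  apply/measurable_EFinP; apply: measurable_funM; first exact: measurable_powR.
  exact: measurable_expR_comp.
suff E : \int[mu]_(t in `]0%R, +oo[) (G t)%:E = \int[mu]_u (expR (a * u - expR u))%:E.
  rewrite /G in E; rewrite E fineK//; apply/fin_numPlt.
  rewrite Gamma_integral_lty// andbT.
  by rewrite (lt_le_trans (ltNyr 0%R))// integral_ge0// => x _; rewrite lee_fin expR_ge0.
pose A (n : nat) : set R := [set` `[expR (- n%:R), expR n%:R]%R].
pose B (n : nat) : set R := [set` `[(- n%:R)%R, n%:R]%R].
have AU : \bigcup_n A n = [set` `]0%R, +oo[].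
  apply/seteqP; split => [x [n _]|x].
    rewrite /A/= !in_itv/= andbT => /andP[h _].
    exact: lt_le_trans (expR_gt0 _) h.
  rewrite /= in_itv/= andbT => x0.
  exists (Num.truncn `|ln x|).+1 => //.
  rewrite /A/= in_itv/= -[X in (_ <= X <= _)%R](@lnK _ x)// !ler_expR -ler_norml.
  exact/ltW/truncnS_gt.
have BU : \bigcup_n B n = setT.
  apply/seteqP; split => // x _; exists (Num.truncn `|x|).+1 => //.
  rewrite /B/= in_itv/= -ler_norml.
  exact/ltW/truncnS_gt.
have cA : \int[mu]_(x in A i) (G x)%:E @[i --> \oo] --> \int[mu]_(x in \bigcup_i A i) (G x)%:E.
  apply: ge0_nondecreasing_set_cvg_integral.
  - move=> m n mn; apply/subsetPset => x; rewrite /A/= !in_itv/= => /andP[h1 h2].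
    by rewrite (le_trans _ h1) ?(le_trans h2)// ler_expR ?lerN2 ler_nat.
  - by move=> i; exact: measurable_itv.
  - by move=> i; exact: measurable_funTS mG.
  - by move=> i x _; rewrite lee_fin.
have cB : \int[mu]_(x in B i) (expR (a * x - expR x))%:E @[i --> \oo] -->
    \int[mu]_(x in \bigcup_i B i) (expR (a * x - expR x))%:E.
  apply: ge0_nondecreasing_set_cvg_integral.
  - move=> m n mn; apply/subsetPset => x; rewrite /B/= !in_itv/= => /andP[h1 h2].
    by rewrite (le_trans _ h1) ?(le_trans h2)// ?lerN2 ler_nat.
  - by move=> i; exact: measurable_itv.
  - move=> i; apply: measurable_funTS.
    by have := measurable_Gamma_integrand a 1%R; under eq_fun do rewrite mul1r.
  - by move=> i x _; rewrite lee_fin expR_ge0.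
rewrite AU in cA; rewrite BU in cB.
have {}cA : \int[mu]_(x in B i) (expR (a * x - expR x))%:E @[i --> \oo] -->
    \int[mu]_(x in `]0%R, +oo[) (G x)%:E.
  move: cA; rewrite (_ : (fun i => _) = (fun i => \int[mu]_(x in B i) (expR (a * x - expR x))%:E))//.
  apply/funext => n; have dE : (@expR R)^`()%classic = expR.
    by apply/funext => x; rewrite derive1E derive_val.
  rewrite /A (@integration_by_substitution_increasing R expR G)//.
  - apply: eq_integral => x _; congr EFin.
    rewrite dE [LHS](_ : _ = G (expR x) * expR x)%R// /G /powR gt_eqF ?expR_gt0// expRK -expRD -expRD; congr expR; ring.
  - by rewrite (@le_trans _ _ 0%R)// ?oppr_le0 ler0n.
  - by move=> x y _ _; rewrite ltr_expR.
  - by rewrite dE => x _; exact: continuous_expR.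
  - by rewrite dE; apply/cvg_ex; eexists; apply/cvg_at_right_filter; exact: continuous_expR.
  - by rewrite dE; apply/cvg_ex; eexists; apply/cvg_at_left_filter; exact: continuous_expR.
  - split.
    + by move=> x _; exact: derivable_expR.
    + by apply/cvg_at_right_filter; exact: continuous_expR.
    + by apply/cvg_at_left_filter; exact: continuous_expR.
  - apply: continuous_in_subspaceT => x; rewrite inE/= in_itv/= => /andP[h _].
    have x0 : (0 < x)%R by exact: lt_le_trans (expR_gt0 _) h.
    apply: cvgM; last first.
      apply: continuous_comp; [exact: opp_continuous|exact: continuous_expR].
    have /derivable1_diffP/differentiable_continuous h' :
        derivable (@powR R ^~ (a - 1)%R) x 1%R.
      by apply: derivable_powR; rewrite in_itv/= x0.
    exact: h'.
exact: cvg_unique cA cB.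
Qed.

Lemma Gamma_gt0 a : (0 < a)%R -> (0 < Gamma a)%R.
Proof.
move=> a0; rewrite -lte_fin -Gamma_log// lt_neqAle; apply/andP; split; last first.
  by apply: integral_ge0 => x _; rewrite lee_fin expR_ge0.
apply/eqP => /esym E.
have /ae_eq_integral_abs : \int[mu]_u `|(expR (a * u - expR u))%:E| = 0.
  by under eq_integral do rewrite /= ger0_norm ?expR_ge0//.
move=> /(_ measurableT) [].
  by have := @measurable_Gamma_integrand a 1%R; under eq_fun do rewrite mul1r.
move=> N [mN N0 sub].
have : mu [set` `[0%R, 1%R]] <= mu N.
  apply: le_measure; rewrite ?inE//.
  apply: subset_trans sub => x _ /= /(_ Logic.I) [] /eqP.
  by rewrite expR_eq0.
rewrite N0 [X in X <= _](_ : _ = 1); first by rewrite lee_fin ler10.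
by rewrite [LHS]lebesgue_measure_itv/= lte_fin ltr01 EFinN sube0.
Qed.

(** Euler's integral after the dilation $t \mapsto t X$. *)
Lemma Gamma_dilation a X : (0 < a)%R -> (0 < X)%R ->
  \int[mu]_u (expR (a * u - X * expR u))%:E = (Gamma a * X `^ (- a))%:E.
Proof.
move=> a0 X0; have mg : measurable_fun setT (fun u : R => expR (a * u - expR u)).
  by have /measurable_EFinP := @measurable_Gamma_integrand a 1%R;
    under eq_fun do rewrite mul1r.
rewrite EFinM -Gamma_log// muleC -ge0_integralrZ//.
rewrite -[RHS](ge0_integral_shift (ln X)).
- apply: eq_integral => u _; congr EFin; rewrite expRD lnK// /powR gt_eqF// -expRD.
  by congr expR; rewrite (mulrC X); ring.
- exact: measurable_funM.
- by move=> x; rewrite mulr_ge0 ?powR_ge0 ?expR_ge0.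
- exact: powR_ge0.
Qed.

End gamma.

(** * Gaussian and Beta integrals *)

Section measurability.
Context {R : realType}.

Lemma measurable_powR_comp d (T : measurableType d) (a : R) (f : T -> R) :
  measurable_fun setT f -> measurable_fun setT (fun x => f x `^ a).
Proof. by move=> mf; exact: (measurableT_comp (@measurable_powR R a) mf). Qed.

Lemma measurable_normr_comp d (T : measurableType d) (f : T -> R) :
  measurable_fun setT f -> measurable_fun setT (fun x => `|f x|).
Proof. by move=> mf; exact: (measurableT_comp (@normr_measurable R setT) mf). Qed.

End measurability.

Ltac meas := repeat first
  [ exact: measurable_cst | exact: measurable_fst | exact: measurable_snd
  | exact: measurable_id | assumption
  | apply: measurable_expR_comp | apply: measurable_powR_comp
  | apply: measurable_normr_comp | apply: measurable_funX
  | apply: measurable_edot | apply: measurable_enorm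
  | apply: measurable_rVB | apply: measurable_rVD | apply: measurable_rVN
  | apply: measurable_funB | apply: measurable_funD | apply: measurable_funM
  | apply: measurable_funN | apply: measurable_maxr | apply: measurable_minr ].

Section tonelli.
Context d1 d2 (T1 : measurableType d1) (T2 : measurableType d2) (R : realType).
Variables (m1 : {sigma_finite_measure set T1 -> \bar R})
          (m2 : {sigma_finite_measure set T2 -> \bar R}).
Local Open Scope ereal_scope.

Lemma tonelli (f : T1 -> T2 -> R) :
  measurable_fun setT (fun z : T1 * T2 => f z.1 z.2) ->
  (forall x y, 0 <= f x y)%R ->
  \int[m1]_x \int[m2]_y (f x y)%:E = \int[m2]_y \int[m1]_x (f x y)%:E.
Proof.
move=> mf f0; apply: (@fubini_tonelli _ _ _ _ _ m1 m2 (fun z => (f z.1 z.2)%:E)).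
  exact/measurable_EFinP.
by move=> z; rewrite lee_fin.
Qed.

End tonelli.

Section beta_gauss.
Context {R : realType}.
Notation mu := (@lebesgue_measure R).
Notation mu_ n := (lebesgue_rV R n).
Local Open Scope ereal_scope.

Lemma powR_log (x a : R) : (0 < x)%R -> (x `^ a = expR (a * ln x))%R.
Proof. by move=> x0; rewrite /powR gt_eqF. Qed.

Lemma powR_expR (u a : R) : (expR u `^ a = expR (a * u))%R.
Proof. by rewrite powR_log ?expR_gt0// expRK. Qed.

Lemma powRV (x a : R) : (0 < x)%R -> (x^-1 `^ a = x `^ (- a))%R.
Proof. by move=> x0; rewrite !powR_log ?invr_gt0// lnV ?posrE// mulrN mulNr. Qed.

(** The Beta integral in logarithmic variable. *)
Lemma Beta_log (n m A B : R) : (0 < n)%R -> (0 < m)%R -> (0 < A)%R -> (0 < B)%R ->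
  \int[mu]_w (expR (n * w) * (A + B * expR w) `^ (- (n + m)))%:E =
  (Gamma n * Gamma m / Gamma (n + m) * (A `^ (- m) * B `^ (- n)))%:E.
Proof.
move=> n0 m0 A0 B0; have q0 : (0 < n + m)%R by rewrite addr_gt0.
have P w : (0 < A + B * expR w)%R by rewrite addr_gt0// mulr_gt0// expR_gt0.
have G0 := Gamma_gt0 q0.
transitivity ((Gamma (n + m))^-1%:E * \int[mu]_w (Gamma (n + m) *
   (expR (n * w) * (A + B * expR w) `^ (- (n + m))))%:E).
  rewrite ge0_integralrZ; [|by meas| |by rewrite ltW].
    by rewrite muleA -EFinM mulVf ?mul1e// gt_eqF.
  by move=> w; rewrite mulr_ge0 ?expR_ge0 ?powR_ge0.
have -> : \int[mu]_w (Gamma (n + m) *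
   (expR (n * w) * (A + B * expR w) `^ (- (n + m))))%:E =
   \int[mu]_w \int[mu]_u (expR (n * w) *
     expR ((n + m) * u - (A + B * expR w) * expR u))%:E.
  apply: eq_integral => w _.
  rewrite ge0_integralrZ; [|by meas| |exact: expR_ge0]; last by move=> u; exact: expR_ge0.
  by rewrite Gamma_dilation// -EFinM mulrCA.
rewrite tonelli; last 2 first.
- by meas.
- by move=> x y; rewrite mulr_ge0 ?expR_ge0.
have -> : \int[mu]_u \int[mu]_w (expR (n * w) *
     expR ((n + m) * u - (A + B * expR w) * expR u))%:E =
   \int[mu]_u ((Gamma n * B `^ (- n)) * expR (m * u - A * expR u))%:E.
  apply: eq_integral => u _.
  transitivity (\int[mu]_w (expR ((n + m) * u - A * expR u) *
      expR (n * w - (B * expR u) * expR w))%:E).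
    by apply: eq_integral => w _; rewrite -!expRD; congr (expR _)%:E; ring.
  rewrite ge0_integralrZ; [|by meas|by move=> ?; exact: expR_ge0|exact: expR_ge0].
  rewrite Gamma_dilation// ?mulr_gt0 ?expR_gt0// -EFinM; congr EFin.
  rewrite powRM ?expR_ge0 ?ltW// powR_expR mulrCA -mulrA; congr (_ * _)%R.
  rewrite mulrCA -expRD; congr (_ * expR _)%R; ring.
rewrite ge0_integralrZ; [|by meas|by move=> u; exact: expR_ge0|]; last first.
  by rewrite mulr_ge0 ?powR_ge0// ltW// Gamma_gt0.
rewrite Gamma_dilation// -!EFinM; congr EFin; field.
by rewrite gt_eqF.
Qed.

Lemma integral_gauss (c : R) : (0 < c)%R ->
  \int[mu]_x (expR (- (c * x ^+ 2)))%:E = (Num.sqrt (pi / c))%:E.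
Proof.
move=> c0; pose k := Num.sqrt c.
have k0 : (0 < k)%R by rewrite sqrtr_gt0.
have dF (x : R) : is_derive x (1 : R)%R ( *%R k) k.
  rewrite -[X in is_derive _ _ _ X]mulr1; exact: is_deriveZ.
have dFE : ( *%R k)^`()%classic = cst k.
  by apply/funext => x; rewrite derive1E (@derive_val _ _ _ _ _ _ _ (dF x)).
have := @increasing_ge0_integration_by_substitutionT R ( *%R k) gauss_fun.
rewrite integralT_gauss => E.
have {}E : (Num.sqrt pi)%:E = \int[mu]_x (k * expR (- (c * x ^+ 2)))%:E :> \bar R.
  rewrite E; last first.
  - by move=> x; exact: gauss_fun_ge0.
  - exact: continuous_gauss_fun.
  - exact: gt0_cvgMry.
  - exact: gt0_cvgMrNy.
  - by move=> x; exact: ex_derive.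
  - by rewrite dFE; exact: is_cvg_cst.
  - by rewrite dFE; exact: is_cvg_cst.
  - by rewrite dFE; exact: cst_continuous.
  - by move=> x y xy; rewrite ltr_pM2l.
  apply: eq_integral => x _; congr EFin; rewrite dFE.
  rewrite [LHS](_ : _ = gauss_fun (k * x) * k)%R// /gauss_fun exprMn sqr_sqrtr 1?mulrC//.
  exact: ltW.
rewrite ge0_integralrZ in E; [|by meas|by move=> x; exact: expR_ge0|exact: ltW].
transitivity ((k^-1)%:E * (Num.sqrt pi)%:E).
  by rewrite E muleA -EFinM mulVf ?mul1e// gt_eqF.
by rewrite -EFinM sqrtrM ?pi_ge0// sqrtrV ?ltW// mulrC.
Qed.

Lemma integral_gauss_rV n (c : R) : (0 < c)%R ->
  \int[mu_ n]_x (expR (- (c * edot x x)))%:E = ((pi / c) `^ (n%:R / 2))%:E.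
Proof.
move=> c0; have pc0 : (0 <= pi / c)%R by rewrite divr_ge0 ?pi_ge0 ?ltW.
rewrite (mulrC n%:R) powRrM powR12_sqrt// powR_mulrn ?sqrtr_ge0//.
elim: n => [|n IH].
  rewrite expr0 /= integral_dirac//.
    by rewrite diracE mem_set// mul1e /edot big_ord0 mulr0 oppr0 expR0.
  by apply/measurable_EFinP; meas.
rewrite ge0_integral_rV_cons; last 2 first.
- by apply/measurable_EFinP; meas.
- by move=> x; rewrite lee_fin expR_ge0.
transitivity (\int[mu]_a (Num.sqrt (pi / c) ^+ n * expR (- (c * a ^+ 2)))%:E).
  apply: eq_integral => a _; rewrite mulrC EFinM -IH -ge0_integralrZ;
    [|by meas|by move=> v; exact: expR_ge0|exact: expR_ge0].
  apply: eq_integral => v _; congr EFin; rewrite -expRD; congr expR.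
  rewrite /edot big_ord_recl !mxE unlift_none/=.
  under eq_bigr => i _ do rewrite !mxE liftK/=.
  by rewrite mulrDr opprD expr2.
rewrite ge0_integralrZ; [|by meas|by move=> x; exact: expR_ge0|
  by rewrite exprn_ge0 ?sqrtr_ge0].
by rewrite integral_gauss// -EFinM exprSr.
Qed.

(** The analogue on $\mathbb{R}^N$ of the Beta integral. *)
Lemma Beta_rV N (m A B : R) : (0 < m)%R -> (0 < A)%R -> (0 < B)%R ->
  \int[mu_ N]_y ((A + B * edot y y) `^ (- (N%:R / 2 + m)))%:E =
  (pi `^ (N%:R / 2) * Gamma m / Gamma (N%:R / 2 + m) *
     (A `^ (- m) * B `^ (- (N%:R / 2))))%:E.
Proof.
move=> m0 A0 B0; set n := (N%:R / 2)%R.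
have n0 : (0 <= n)%R by rewrite divr_ge0.
have q0 : (0 < n + m)%R by rewrite ltr_wpDl.
have P y : (0 < A + B * edot y y :> R)%R.
  by rewrite ltr_pwDl// mulr_ge0 ?edot_ge0// ltW.
have G0 := Gamma_gt0 q0.
transitivity ((Gamma (n + m))^-1%:E * \int[mu_ N]_y (Gamma (n + m) *
   (A + B * edot y y) `^ (- (n + m)))%:E).
  rewrite ge0_integralrZ; [|by meas| |by rewrite ltW]; last first.
    by move=> y; exact: powR_ge0.
  by rewrite muleA -EFinM mulVf ?mul1e// gt_eqF.
have -> : \int[mu_ N]_y (Gamma (n + m) * (A + B * edot y y) `^ (- (n + m)))%:E =
   \int[mu_ N]_y \int[mu]_u (expR ((n + m) * u - (A + B * edot y y) * expR u))%:E.
  by apply: eq_integral => y _; rewrite Gamma_dilation.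
rewrite tonelli; last 2 first.
- by meas.
- by move=> x y; exact: expR_ge0.
have -> : \int[mu]_u \int[mu_ N]_y (expR ((n + m) * u - (A + B * edot y y) * expR u))%:E =
   \int[mu]_u ((pi `^ n * B `^ (- n)) * expR (m * u - A * expR u))%:E.
  apply: eq_integral => u _.
  transitivity (\int[mu_ N]_y (expR ((n + m) * u - A * expR u) *
      expR (- ((B * expR u) * edot y y)))%:E).
    by apply: eq_integral => y _; rewrite -!expRD; congr (expR _)%:E; ring.
  rewrite ge0_integralrZ; [|by meas|by move=> ?; exact: expR_ge0|exact: expR_ge0].
  rewrite integral_gauss_rV ?mulr_gt0 ?expR_gt0// -EFinM; congr EFin.
  rewrite powRM ?pi_ge0// ?invr_ge0 ?mulr_ge0 ?expR_ge0 ?ltW//.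
  rewrite powRV ?mulr_gt0 ?expR_gt0// powRM ?expR_ge0 ?ltW// powR_expR -/n mulrCA -!mulrA; congr (_ * _)%R.
  rewrite mulrCA -expRD; congr (_ * expR _)%R; ring.
rewrite ge0_integralrZ; [|by meas|by move=> u; exact: expR_ge0|
  by rewrite mulr_ge0 ?powR_ge0].
rewrite Gamma_dilation// -!EFinM; congr EFin; field.
by rewrite gt_eqF.
Qed.

End beta_gauss.

(** * The kernel of the fractional Laplacian *)

Section kernel.
Context {R : realType}.
Notation mu := (@lebesgue_measure R).
Notation mu_ n := (lebesgue_rV R n).

Lemma enorm_powR n (x : 'rV[R]_n) (p : R) : enorm x `^ p = edot x x `^ (p / 2).
Proof. by rewrite /enorm -powR12_sqrt ?edot_ge0// -powRrM mulrC. Qed.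

Lemma measurable_minr1 d (T : measurableType d) (f : T -> R) :
  measurable_fun setT f -> measurable_fun setT (fun x => Num.min (f x) 1).
Proof. by move=> mf; apply: measurable_minr. Qed.

(** The singular kernel of the fractional Laplacian. *)
Definition kern N (s : R) (y : 'rV[R]_N) : R := (enorm y `^ (N%:R + 2 * s))^-1.

Lemma kernE N s (y : 'rV[R]_N) : kern s y = edot y y `^ (- (N%:R / 2 + s)).
Proof.
rewrite /kern -powRN enorm_powR; congr (_ `^ _); lra.
Qed.

Lemma kern_ge0 N s (y : 'rV[R]_N) : 0 <= kern s y.
Proof. by rewrite kernE powR_ge0. Qed.

Lemma kernN N s (y : 'rV[R]_N) : kern s (- y) = kern s y.
Proof. by rewrite /kern enormN. Qed.

Lemma measurable_kern N s : measurable_fun setT (@kern N s).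
Proof.
rewrite (_ : @kern N s = (fun y => edot y y `^ (- (N%:R / 2 + s)))); first by meas.
by apply/funext => y; exact: kernE.
Qed.

(** The kernel times $\min(|y|^{1+s},1)$ is integrable: it is dominated by
    $|y|^{-(N-1+s)}(1+|y|^2)^{-(1+s)/2}$, which a Beta integral writes as a
    superposition of powers of $1+(1+e^w)|y|^2$. *)
Lemma kern_lty N (s : R) : (0 < N)%N -> 0 < s < 1 ->
  (\int[mu_ N]_y (Num.min (enorm y `^ (1 + s)) 1 * kern s y)%:E < +oo)%E.
Proof.
move=> N0 /andP[s0 s1]; pose q : R := (1 + s) / 2; pose a : R := (N%:R - 1 + s) / 2.
have N1 : 1 <= N%:R :> R by rewrite ler1n.
have q0 : 0 < q by rewrite divr_gt0// addr_gt0.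
have a0 : 0 < a by rewrite divr_gt0//; lra.
have aq : a + q = N%:R / 2 + s by rewrite /a /q; field.
pose C : R := 2 `^ q / (Gamma a * Gamma q / Gamma (a + q)).
have B0 : 0 < Gamma a * Gamma q / Gamma (a + q).
  have Ga := Gamma_gt0 a0; have Gq := Gamma_gt0 q0.
  have Gaq : 0 < Gamma (a + q) by apply: Gamma_gt0; rewrite addr_gt0.
  by rewrite divr_gt0// mulr_gt0.
have C0 : 0 <= C by rewrite divr_ge0 ?powR_ge0// ltW.
pose g (y : 'rV[R]_N) w := C * (expR (a * w) *
  ((1 + edot y y) + edot y y * expR w) `^ (- (a + q))).
have g0 y w : 0 <= g y w by rewrite mulr_ge0// mulr_ge0 ?expR_ge0 ?powR_ge0.
have mg : measurable_fun setT (fun z : 'rV[R]_N * R => g z.1 z.2) by rewrite /g; meas.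
apply: (@le_lt_trans _ _ (\int[mu_ N]_y \int[mu]_w (g y w)%:E)%E).
  apply: ge0_le_integral => //.
  - by move=> y _; rewrite lee_fin mulr_ge0 ?kern_ge0// le_min powR_ge0 ler01.
  - apply/measurable_EFinP; apply: measurable_funM; last exact: measurable_kern.
    by apply: measurable_minr1; meas.
  - have := measurable_fun_fubini_tonelli_F (m2 := mu) (fun z : 'rV[R]_N * R => (g z.1 z.2)%:E).
    apply; first exact/measurable_EFinP.
    by move=> z; rewrite lee_fin.
  move=> y _; have [z0|z0] := eqVneq (edot y y) 0.
    rewrite kernE z0 powR0 ?mulr0; first by apply: integral_ge0 => w _; rewrite lee_fin.
    by rewrite oppr_eq0 gt_eqF// ltr_wpDl// divr_ge0.
  have {}z0 : 0 < edot y y by rewrite lt_neqAle eq_sym z0 edot_ge0.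
  rewrite /g; set z := edot y y in z0 *.
  have z1 : 0 < 1 + z by rewrite addr_gt0.
  rewrite ge0_integralrZ; [|by meas|by move=> w; rewrite mulr_ge0 ?expR_ge0 ?powR_ge0|by []].
  rewrite Beta_log// -EFinM lee_fin /C [leRHS]mulrA divfK ?(gt_eqF B0)//.
  rewrite kernE enorm_powR -/z -/q -aq.
  have zq : Num.min (z `^ q) 1 <= 2 `^ q * ((1 + z) `^ (- q) * z `^ q).
    have -> : 2 `^ q * ((1 + z) `^ (- q) * z `^ q) = (2 * z) `^ q / (1 + z) `^ q.
      by rewrite powRN powRM ?(ltW z0)//; ring.
    rewrite ler_pdivlMr ?powR_gt0//.
    have [z1'|z1'] := leP z 1.
      apply: (@le_trans _ _ (z `^ q * (1 + z) `^ q)).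
        by rewrite ler_wpM2r ?powR_ge0// ge_min lexx.
      rewrite -powRM ?(ltW z0) ?(ltW z1)//.
      by apply: ge0_ler_powR; rewrite ?nnegrE ?mulr_ge0 ?(ltW z0) ?(ltW z1) ?(ltW q0)//; nra.
    apply: (@le_trans _ _ (1 * (1 + z) `^ q)).
      by rewrite ler_wpM2r ?powR_ge0// ge_min lexx orbT.
    rewrite mul1r.
    by apply: ge0_ler_powR; rewrite ?nnegrE ?mulr_ge0 ?(ltW z0) ?(ltW z1) ?(ltW q0)//; nra.
  apply: (@le_trans _ _ (2 `^ q * ((1 + z) `^ (- q) * z `^ q) * z `^ (- (a + q)))).
    by rewrite ler_wpM2r ?powR_ge0.
  rewrite le_eqVlt; apply/orP; left; apply/eqP.
  rewrite -!mulrA; congr (_ * (_ * _)); rewrite -powRD; last by rewrite (gt_eqF z0) implybT.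
  by congr (_ `^ _); lra.
rewrite tonelli//.
pose c : R := pi `^ (N%:R / 2) * Gamma s / Gamma (N%:R / 2 + s).
have c0 : 0 <= c.
  have Gs := Gamma_gt0 s0.
  have Gns : 0 < Gamma (N%:R / 2 + s) by apply: Gamma_gt0; rewrite ltr_wpDl// divr_ge0.
  by rewrite divr_ge0 ?(ltW Gns)// mulr_ge0 ?powR_ge0 ?(ltW Gs).
have E w : (\int[mu_ N]_y (g y w)%:E = ((C * c) *
    (expR (a * w) * (1 + 1 * expR w) `^ (- (a + (1 - s) / 2))))%:E)%E.
  have w1 : 0 < 1 + expR w by rewrite addr_gt0 ?expR_gt0.
  rewrite /g ge0_integralrZ; [|by meas|by move=> y; rewrite mulr_ge0 ?expR_ge0 ?powR_ge0|by []].
  rewrite ge0_integralrZ; [|by meas|by move=> y; rewrite powR_ge0|by rewrite expR_ge0].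
  have -> : (\int[mu_ N]_y ((1 + edot y y + edot y y * expR w) `^ (- (a + q)))%:E =
      \int[mu_ N]_y ((1 + (1 + expR w) * edot y y) `^ (- (N%:R / 2 + s)))%:E)%E.
    by apply: eq_integral => y _; rewrite aq; congr (_ `^ _)%:E; ring.
  rewrite Beta_rV// -!EFinM; congr EFin; rewrite -/c powR1 !mul1r.
  have -> : a + (1 - s) / 2 = N%:R / 2 by rewrite /a; lra.
  ring.
under eq_integral do rewrite E.
rewrite ge0_integralrZ; [|by meas|by move=> w; rewrite mulr_ge0 ?expR_ge0 ?powR_ge0|by rewrite mulr_ge0].
rewrite Beta_log//; first by rewrite -EFinM ltry.
by rewrite divr_gt0//; lra.
Qed.

End kernel.

(** * Quotients of Gamma functions *)

Section gamma_ratio.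
Context {R : realType}.
Notation mu := (@lebesgue_measure R).

Lemma ge0_integral_gt0 d (T : measurableType d) (m : {measure set T -> \bar R})
    (f : T -> R) (A : set T) :
  measurable A -> (0 < m A)%E -> measurable_fun setT f -> (forall x, 0 <= f x) ->
  (forall x, A x -> f x != 0) -> (0 < \int[m]_x (f x)%:E)%E.
Proof.
move=> mA A0 mf f0 fA; rewrite lt_neqAle; apply/andP; split; last first.
  by apply: integral_ge0 => x _; rewrite lee_fin.
apply/eqP => /esym E.
have : (\int[m]_x `|(f x)%:E| = 0)%E.
  by rewrite -[RHS]E; apply: eq_integral => x _; rewrite gee0_abs ?lee_fin.
move/ae_eq_integral_abs => /(_ measurableT) [].
  exact/measurable_EFinP.
move=> N [mN N0 sub].
have : (m A <= m N)%E.
  apply: le_measure; rewrite ?inE//; apply: subset_trans sub => x Ax /= /(_ Logic.I)[].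
  by apply/eqP; exact: fA.
by rewrite N0 leNgt A0.
Qed.

Definition Gammaratio (s z : R) : R := Gamma (z + s) / Gamma z.

Lemma Gammaratio_gt0 s z : 0 < s -> 0 < z -> 0 < Gammaratio s z.
Proof. by move=> s0 z0; rewrite divr_gt0// Gamma_gt0// addr_gt0. Qed.

Definition logistic (w : R) : R := expR w / (1 + expR w).

Lemma logistic_gt0 w : 0 < logistic w.
Proof. by rewrite divr_gt0 ?addr_gt0 ?expR_gt0. Qed.

Lemma measurable_logistic : measurable_fun setT logistic.
Proof.
apply: measurable_funM; first by meas.
rewrite (_ : (fun x => _) = (fun x : R => (1 + expR x) `^ (-1))); first by meas.
by apply/funext => x; rewrite powR_inv1// addr_ge0// expR_ge0.
Qed.

Lemma integral_logistic s z : 0 < s -> 0 < z ->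
  (\int[mu]_w (logistic w `^ z * (1 + expR w) `^ (- s))%:E =
   (Gamma s / Gammaratio s z)%:E)%E.
Proof.
move=> s0 z0; transitivity (\int[mu]_w
    (expR (z * w) * (1 + 1 * expR w) `^ (- (z + s)))%:E)%E.
  apply: eq_integral => w _; have w0 : 0 < 1 + expR w by rewrite addr_gt0 ?expR_gt0.
  rewrite mul1r !powR_log ?logistic_gt0// ln_div ?posrE ?expR_gt0// expRK -!expRD.
  by congr (expR _)%:E; ring.
rewrite Beta_log// !powR1 !mulr1 /Gammaratio; congr EFin.
by field; rewrite !gt_eqF ?Gamma_gt0// addr_gt0.
Qed.

(** Strict log-convexity of $z\mapsto\Gamma(z)/\Gamma(z+s)$.  With respect to
    the weight of the previous integral it says that two increasing powers of
    [logistic] have positive covariance; the reference value [A] is chosen so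
    that the mixed terms of the product cancel. *)
Lemma Gammaratio_lt s z h k : 0 < s -> 0 < z -> 0 < h -> 0 < k ->
  Gammaratio s (z + k + h) * Gammaratio s z <
  Gammaratio s (z + k) * Gammaratio s (z + h).
Proof.
move=> s0 z0 h0 k0.
pose om (w : R) := logistic w `^ z * (1 + expR w) `^ (- s).
pose M (z : R) := Gamma s / Gammaratio s z.
have M0 y : 0 < y -> 0 < M y by move=> y0; rewrite divr_gt0 ?Gammaratio_gt0 ?Gamma_gt0.
have L0 := logistic_gt0.
have om0 w : 0 < om w by rewrite mulr_gt0 ?powR_gt0// addr_gt0 ?expR_gt0.
have mom : measurable_fun setT om.
  by rewrite /om; have := measurable_logistic => ml; meas.
have mL t : measurable_fun setT (fun w => logistic w `^ t * om w).
  by have := measurable_logistic => ml; meas.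
have IM t : 0 <= t -> (\int[mu]_w (logistic w `^ t * om w)%:E = (M (z + t))%:E)%E.
  move=> t0; rewrite -integral_logistic// ?ltr_wpDr//.
  apply: eq_integral => w _; rewrite /om mulrA -powRD 1?addrC//.
  by rewrite (gt_eqF (L0 w)) implybT.
pose A := M (z + h) / M z; have A0 : 0 < A by rewrite divr_gt0 ?M0 ?addr_gt0.
pose B := A `^ (k / h); have B0 : 0 < B by rewrite powR_gt0.
pose f w := (logistic w `^ h - A) * (logistic w `^ k - B) * om w.
have LB w : logistic w `^ k = (logistic w `^ h) `^ (k / h).
  by rewrite -powRrM mulrCA mulfV ?mulr1// gt_eqF.
have kh : 0 < k / h by rewrite divr_gt0.
have f0 w : 0 <= f w.
  rewrite /f mulr_ge0 ?(ltW (om0 w))// LB.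
  have [le|le] := leP A (logistic w `^ h).
    rewrite mulr_ge0 ?subr_ge0// ge0_ler_powR ?nnegrE ?(ltW A0) ?powR_ge0 ?(ltW kh)//.
  rewrite nmulr_rge0 ?subr_lt0// subr_le0.
  by rewrite ge0_ler_powR ?nnegrE ?(ltW A0) ?powR_ge0 ?(ltW kh) ?(ltW le).
have mf : measurable_fun setT f.
  by rewrite /f; have := measurable_logistic => ml; meas.
have fpos : (0 < \int[mu]_w (f w)%:E)%E.
  have fN w : logistic w `^ h != A -> f w != 0.
    move=> wA; rewrite /f mulf_eq0 negb_or (gt_eqF (om0 w)) andbT mulf_eq0 negb_or.
    rewrite !subr_eq0 wA /=.
    rewrite LB; apply: contra wA => /eqP /(powR_injective kh) ->//.
      by rewrite nnegrE powR_ge0.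
    by rewrite nnegrE ltW.
  have inj v w : v < w -> logistic v `^ h != logistic w `^ h.
    move=> vw; rewrite lt_eqF// gt0_ltr_powR ?nnegrE ?(ltW (L0 _))//.
    have ev := expR_gt0 v; have ew := expR_gt0 w; have : expR v < expR w by rewrite ltr_expR.
    rewrite /logistic ltr_pdivrMr ?addr_gt0// mulrAC ltr_pdivlMr ?addr_gt0//; nra.
  have itv1 (a b : R) : a < b -> (0 < mu [set` `[a, b]])%E.
    by move=> ab; rewrite [ltRHS]lebesgue_measure_itv/= lte_fin ab -EFinB lte_fin subr_gt0.
  have [[v /andP[v0 v1] vA]|nv] := pselect (exists2 v, 0 <= v <= 1 & logistic v `^ h = A).
    apply: (@ge0_integral_gt0 _ _ mu f [set` `[2, 3]]) => //; first by apply: itv1; lra.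
    move=> w; rewrite /= in_itv/= => /andP[w2 w3]; apply: fN.
    by rewrite -vA eq_sym inj//; lra.
  apply: (@ge0_integral_gt0 _ _ mu f [set` `[0, 1]]) => //; first by apply: itv1; lra.
  move=> w; rewrite /= in_itv/= => w01; apply: fN; apply/eqP => wA.
  by apply: nv; exists w.
have pL t w : 0 <= logistic w `^ t * om w by rewrite mulr_ge0 ?powR_ge0 ?(ltW (om0 _)).
have mM c t : measurable_fun setT (fun w => c * (logistic w `^ t * om w)).
  by apply: measurable_funM.
have cM c t : 0 <= c -> 0 <= t ->
    (\int[mu]_w (c * (logistic w `^ t * om w))%:E = (c * M (z + t))%:E)%E.
  by move=> c0 t0; rewrite ge0_integralrZ; [rewrite IM|exact: mL|exact: pL|].
have E : (\int[mu]_w (f w)%:E + (B * M (z + h) + A * M (z + k))%:E =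
   (M (z + (k + h)) + A * B * M z)%:E)%E.
  have -> : (M (z + (k + h)) + A * B * M z)%:E = (\int[mu]_w
     (1 * (logistic w `^ (k + h) * om w) + A * B * (logistic w `^ 0 * om w))%:E)%E.
    rewrite ge0_integralrD; [|exact: mM|by move=> w; rewrite mul1r|exact: mM|
      by move=> w; apply: mulr_ge0 => //; rewrite mulr_ge0 ?ltW].
    have AB0 : 0 <= A * B by rewrite mulr_ge0 ?ltW.
    have kh0 : 0 <= k + h by rewrite addr_ge0 ?ltW.
    by rewrite (cM 1 (k + h))// (cM (A * B) 0)// addr0 mul1r EFinD.
  rewrite EFinD -(cM B h) ?(ltW B0) ?(ltW h0)// -(cM A k) ?(ltW A0) ?(ltW k0)//.
  have pB w : 0 <= B * (logistic w `^ h * om w) by rewrite mulr_ge0// ltW.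
  have pA w : 0 <= A * (logistic w `^ k * om w) by rewrite mulr_ge0// ltW.
  rewrite -ge0_integralrD; [|exact: mM|exact: pB|exact: mM|exact: pA].
  rewrite -ge0_integralrD; [|exact: mf|exact: f0|by apply: measurable_funD; exact: mM|
    by move=> w; rewrite addr_ge0].
  apply: eq_integral => w _; congr EFin; rewrite powRr0 powRD; last first.
    by rewrite (gt_eqF (L0 w)) implybT.
  by rewrite /f; ring.
have : A * M (z + k) < M (z + (k + h)).
  have AB : A * B * M z = B * M (z + h) by rewrite /A; field; rewrite gt_eqF// M0.
  move: E fpos; case: (\int[mu]_w (f w)%:E)%E => [r| |]//=.
  by rewrite -EFinD lte_fin => -[]; rewrite AB => ? ?; lra.
rewrite /A addrA /M; have G1 := Gammaratio_gt0 s0 z0.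
have G2 : 0 < Gammaratio s (z + h) by rewrite Gammaratio_gt0// addr_gt0.
have G3 : 0 < Gammaratio s (z + k) by rewrite Gammaratio_gt0// addr_gt0.
have G4 : 0 < Gammaratio s (z + k + h) by rewrite Gammaratio_gt0// !addr_gt0.
have Gs := Gamma_gt0 s0.
set g1 := Gammaratio s z in G1 *; set g2 := Gammaratio s (z + h) in G2 *.
set g3 := Gammaratio s (z + k) in G3 *; set g4 := Gammaratio s (z + k + h) in G4 *.
have -> : Gamma s / g2 / (Gamma s / g1) * (Gamma s / g3) = Gamma s * (g1 / (g2 * g3)).
  by field; rewrite !gt_eqF.
rewrite ltr_pM2l// (ltr_pdivrMr _ _ (mulr_gt0 G2 G3)) (mulrC g4^-1) ltr_pdivlMr// => H.
by rewrite mulrC (mulrC g3).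
Qed.

End gamma_ratio.

(** * A regularized Beta integral *)

Section jump_integral.
Context {R : realType}.
Notation mu := (@lebesgue_measure R).

Lemma measurable_ler_indicator d (T : measurableType d) (f g : T -> R) :
  measurable_fun setT f -> measurable_fun setT g ->
  measurable_fun setT (fun z => (f z <= g z)%R%:R : R).
Proof.
move=> mf mg.
rewrite (_ : (fun z => _) = (fun z => if f z <= g z then 1 else 0 : R)); last first.
  by apply/funext => z; case: ifP.
by apply: measurable_fun_ifT => //; exact: measurable_fun_ler.
Qed.

Lemma expRN_expR_le1 (u : R) : expR (- expR u) <= 1.
Proof. by rewrite expR_le1 oppr_le0 expR_ge0. Qed.

Lemma integral_Gumbel_moment (s : R) : 0 < s < 1 ->
  (\int[mu]_u (expR (- (s * u)) * (1 - expR (- expR u)))%:E =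
   (Gamma (1 - s) / s)%:E)%E.
Proof.
move=> /andP[s0 s1].
have m1 : measurable_fun setT (fun z : R * R => (z.2 <= z.1)%R%:R : R).
  by apply: measurable_ler_indicator; meas.
transitivity (\int[mu]_u \int[mu]_x (expR (- (s * u)) *
    ((x <= u)%R%:R * expR (x - expR x)))%:E)%E.
  apply: eq_integral => u _; have m2 : measurable_fun setT (fun x : R => (x <= u)%R%:R : R).
    by apply: measurable_ler_indicator; meas.
  rewrite ge0_integralrZ; [|by meas|by move=> x; rewrite mulr_ge0 ?expR_ge0|exact: expR_ge0].
  by rewrite integral_Gumbel EFinM.
rewrite tonelli; [|by meas|by move=> u x; rewrite !mulr_ge0 ?expR_ge0].
transitivity (\int[mu]_x (s^-1 * expR ((1 - s) * x - 1 * expR x))%:E)%E.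
  apply: eq_integral => x _; pose f (u : R) := (u <= - x)%R%:R * expR (s * u).
  have m3 : measurable_fun setT (fun u : R => (u <= - x)%R%:R : R).
    by apply: measurable_ler_indicator; meas.
  have mf : measurable_fun setT f by rewrite /f; meas.
  have f0 u : 0 <= f u by rewrite mulr_ge0 ?expR_ge0.
  transitivity (\int[mu]_u (expR (x - expR x) * f (- u))%:E)%E.
    apply: eq_integral => u _; rewrite /f lerN2 mulrN; congr EFin; ring.
  rewrite ge0_integralrZ; [|by apply: (measurableT_comp mf); meas|by []|exact: expR_ge0].
  rewrite ge0_integral_opp// /f integral_expR_Ny// -EFinM mulrA -expRD; congr EFin.
  by rewrite mulrC; congr (_ * expR _); ring.
rewrite ge0_integralrZ; [|by meas|by move=> x; exact: expR_ge0|by rewrite invr_ge0 ltW].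
by rewrite Gamma_dilation ?subr_gt0// powR1 mulr1 -EFinM mulrC.
Qed.

Lemma one_sub_powR (d u : R) : 0 < d ->
  (\int[mu]_w (expR (d * w - expR w) * (1 - expR (- expR (w - u))))%:E =
   (Gamma d * (1 - (1 + expR (- u)) `^ (- d)))%:E)%E.
Proof.
move=> d0; have P0 : 0 < 1 + expR (- u) by rewrite addr_gt0// expR_gt0.
have E : (\int[mu]_w (expR (d * w - (1 + expR (- u)) * expR w) +
    expR (d * w - expR w) * (1 - expR (- expR (w - u))))%:E = (Gamma d)%:E)%E.
  rewrite -Gamma_log//; apply: eq_integral => w _; congr EFin.
  rewrite [X in expR X + _](_ : _ = (d * w - expR w) - expR (w - u)); last first.
    by rewrite (expRD w); ring.
  by rewrite (expRD (d * w - expR w)); ring.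
rewrite ge0_integralrD in E; last first.
- by move=> w; rewrite mulr_ge0 ?expR_ge0// subr_ge0 expRN_expR_le1.
- by meas.
- by move=> w; exact: expR_ge0.
- by meas.
move: E; rewrite Gamma_dilation//; set I := (\int[_]_w _)%E.
case: I => [r| |]//; rewrite -EFinD => -[] E.
by congr EFin; rewrite mulrBr mulr1; lra.
Qed.

Lemma powRN_le1 (x a : R) : 1 <= x -> 0 <= a -> 0 <= x `^ (- a) <= 1.
Proof.
move=> x1 a0; rewrite powR_ge0/= powRN invf_le1 ?powR_gt0 ?(lt_le_trans ltr01)//.
by have := ler_powR x1 a0; rewrite powRr0.
Qed.

(** The constant is the value of $-B(b,-s)$ continued analytically, with
    $b=d+s$. *)
Lemma jump_integral0 (s d : R) : 0 < s < 1 -> 0 < d ->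
  (\int[mu]_u (expR (s * u) * (1 - (1 + expR (- u)) `^ (- d)))%:E =
   (Gamma (1 - s) / s * Gammaratio s d)%:E)%E.
Proof.
move=> /andP[s0 s1] d0; have G0 := Gamma_gt0 d0.
have P0 u : 0 < 1 + expR (- u) :> R by rewrite addr_gt0// expR_gt0.
have P1 u : 0 <= 1 - (1 + expR (- u)) `^ (- d) :> R.
  rewrite subr_ge0; have [] := andP (@powRN_le1 (1 + expR (- u)) d _ (ltW d0)) => //.
  by rewrite lerDl expR_ge0.
have c0 : 0 <= Gamma (1 - s) / s by rewrite divr_ge0 ?ltW// Gamma_gt0// subr_gt0.
transitivity (\int[mu]_u \int[mu]_w ((Gamma d)^-1 * expR (s * u) *
   (expR (d * w - expR w) * (1 - expR (- expR (w - u)))))%:E)%E.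
  apply: eq_integral => u _.
  rewrite ge0_integralrZ; first last.
  - by rewrite mulr_ge0 ?expR_ge0// invr_ge0 ltW.
  - by move=> w; rewrite mulr_ge0 ?expR_ge0// subr_ge0 expRN_expR_le1.
  - by meas.
  rewrite one_sub_powR// -EFinM; congr EFin; field; by rewrite gt_eqF.
rewrite tonelli; first last.
- move=> u w; apply: mulr_ge0; first by rewrite mulr_ge0 ?expR_ge0// invr_ge0 ltW.
  by rewrite mulr_ge0 ?expR_ge0// subr_ge0 expRN_expR_le1.
- by meas.
transitivity (\int[mu]_w ((Gamma (1 - s) / s / Gamma d) * expR ((d + s) * w - 1 * expR w))%:E)%E.
  apply: eq_integral => w _.
  pose F (u : R) := expR (s * u) * (1 - expR (- expR (- u))).
  have mF : measurable_fun setT F by rewrite /F; meas.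
  have F0 u : 0 <= F u by rewrite mulr_ge0 ?expR_ge0// subr_ge0 expRN_expR_le1.
  transitivity (\int[mu]_u ((Gamma d)^-1 * expR ((d + s) * w - expR w) * F (u + (- w)))%:E)%E.
    apply: eq_integral => u _; rewrite /F opprB; congr EFin.
    rewrite -!mulrA; congr (_ * _); rewrite !mulrA -!expRD; congr (expR _ * _); ring.
  rewrite ge0_integralrZ; first last.
  - by rewrite mulr_ge0 ?expR_ge0// invr_ge0 ltW.
  - by move=> u.
  - by apply: (measurableT_comp mF); meas.
  rewrite ge0_integral_shift// -ge0_integral_opp// /F.
  under eq_integral do rewrite opprK mulrN.
  rewrite integral_Gumbel_moment ?s0// -EFinM mul1r; congr EFin; ring.
rewrite ge0_integralrZ; first last.
- by rewrite divr_ge0// ltW.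
- by move=> w; exact: expR_ge0.
- by meas.
rewrite Gamma_dilation ?addr_gt0// powR1 mulr1 -EFinM /Gammaratio; congr EFin; ring.
Qed.

Lemma bernoulli_le (m y : R) : 0 < m -> 0 < y <= 1 -> 1 - y `^ m <= (1 + m) * (1 - y).
Proof.
move=> m0 /andP[y0 y1]; pose n := (Num.truncn m).+1.
have mn : m <= n%:R by apply/ltW/truncnS_gt.
have nm : n%:R <= 1 + m.
  by rewrite /n -natr1 addrC lerD2l truncn_le// ltW.
apply: (@le_trans _ _ (n%:R * (1 - y))); last by rewrite ler_wpM2r// subr_ge0.
have yn : y ^+ n <= y `^ m by rewrite -powR_mulrn ?(ltW y0)// ger_powR// y0.
suff : 1 - y ^+ n <= n%:R * (1 - y) by apply: le_trans; rewrite lerB.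
elim: n {mn nm yn} => [|n IH]; first by rewrite expr0 subrr mul0r.
have : 0 <= y ^+ n <= 1 by rewrite exprn_ge0 ?(ltW y0)// exprn_ile1// ltW.
rewrite exprS -natr1; move: IH; set a := y ^+ n; set b := n%:R; nra.
Qed.

Lemma one_sub_powR_le (m x th : R) : 0 < m -> 0 <= x -> 0 < th <= 1 ->
  1 - (1 + x) `^ (- m) <= (1 + m) * x `^ th.
Proof.
move=> m0 x0 /andP[th0 th1]; have x1 : 0 < 1 + x by lra.
rewrite powRN -powR_inv1 ?powR_ge0// -powRrM mulrC powRrM powR_inv1 ?(ltW x1)//.
apply: (le_trans (bernoulli_le m0 _)).
  by rewrite invr_gt0 x1 invf_le1// lerDl.
rewrite ler_wpM2l//; first lra.
have -> : 1 - (1 + x)^-1 = x / (1 + x) by field; rewrite gt_eqF.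
rewrite ler_pdivrMr//; have [xl|xl] := leP x 1.
  apply: (@le_trans _ _ (x `^ th * 1)); last by rewrite ler_wpM2l ?powR_ge0// lerDl.
  rewrite mulr1; have [->|xn] := eqVneq x 0; first by rewrite powR_ge0.
  by apply: ger1_powR => //; rewrite lt_neqAle eq_sym xn x0.
apply: (@le_trans _ _ (1 * (1 + x))); first lra.
rewrite ler_wpM2r ?(ltW x1)//; have := ler_powR (ltW xl) (ltW th0); by rewrite powRr0.
Qed.

(** The integral giving $(-\Delta)^s(|x|^2+\varepsilon^2)^{-\beta/2}$, with
    $e=\varepsilon^2/(|x|^2+\varepsilon^2)$ and $v=e^u$. *)
Definition jump (s d m e u : R) : R :=
  expR (s * u) * (1 - (1 + expR (- u)) `^ (- d) * (1 + e * expR (- u)) `^ (- m)).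

Lemma measurable_jump s d m e : measurable_fun setT (jump s d m e).
Proof. by rewrite /jump; meas. Qed.

Lemma jump_split s d m e u : jump s d m e u =
  expR (s * u) * (1 - (1 + expR (- u)) `^ (- d)) +
  expR (s * u) * ((1 + expR (- u)) `^ (- d) * (1 - (1 + e * expR (- u)) `^ (- m))).
Proof. by rewrite /jump; ring. Qed.

Lemma jump_ge0 s d m e u : 0 <= d -> 0 <= m -> 0 <= e -> 0 <= jump s d m e u.
Proof.
move=> d0 m0 e0; rewrite mulr_ge0 ?expR_ge0// subr_ge0.
have P1 : 1 <= 1 + expR (- u) :> R by rewrite lerDl expR_ge0.
have Q1 : 1 <= 1 + e * expR (- u) :> R by rewrite lerDl mulr_ge0 ?expR_ge0.
have /andP[p0 p1] := powRN_le1 P1 d0; have /andP[q0 q1] := powRN_le1 Q1 m0.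
by rewrite -[leRHS]mulr1 ler_pM.
Qed.

Lemma jump_bounds (s d m th : R) : 0 < s < 1 -> 0 < d -> 0 < m ->
  s < th <= 1 -> th < d + s ->
  exists2 C, 0 <= C & forall e, 0 <= e ->
   (((Gamma (1 - s) / s * Gammaratio s d)%:E <= \int[mu]_u (jump s d m e u)%:E) /\
    (\int[mu]_u (jump s d m e u)%:E <=
     (Gamma (1 - s) / s * Gammaratio s d + C * e `^ th)%:E))%E.
Proof.
move=> /andP[s0 s1] d0 m0 /andP[sth th1] thd.
have n0 : 0 < d + s - th by rewrite subr_gt0.
have t0 : 0 < th - s by rewrite subr_gt0.
have nt : d + s - th + (th - s) = d by ring.
pose C := (1 + m) * (Gamma (d + s - th) * Gamma (th - s) / Gamma d).
exists C.
  rewrite mulr_ge0//; first lra.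
  by rewrite ltW// divr_gt0 ?Gamma_gt0// mulr_gt0 ?Gamma_gt0.
move=> e e0.
have P1 u : 1 <= 1 + expR (- u) :> R by rewrite lerDl expR_ge0.
have Q1 u : 1 <= 1 + e * expR (- u) :> R by rewrite lerDl mulr_ge0 ?expR_ge0.
have PP u := powRN_le1 (P1 u) (ltW d0); have QQ u := powRN_le1 (Q1 u) (ltW m0).
pose f u := expR (s * u) * (1 - (1 + expR (- u)) `^ (- d)).
pose g u := expR (s * u) * ((1 + expR (- u)) `^ (- d) * (1 - (1 + e * expR (- u)) `^ (- m))).
have f0 u : 0 <= f u.
  by have /andP[_ ?] := PP u; rewrite mulr_ge0 ?expR_ge0// subr_ge0.
have g0 u : 0 <= g u.
  have /andP[? _] := PP u; have /andP[_ ?] := QQ u.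
  by rewrite mulr_ge0 ?expR_ge0// mulr_ge0// subr_ge0.
have mf : measurable_fun setT f by rewrite /f; meas.
have mg : measurable_fun setT g by rewrite /g; meas.
have E : (\int[mu]_u (jump s d m e u)%:E =
    (Gamma (1 - s) / s * Gammaratio s d)%:E + \int[mu]_u (g u)%:E)%E.
  rewrite -jump_integral0 ?s0// -ge0_integralrD//.
  by apply: eq_integral => u _; rewrite jump_split.
rewrite E; split; first by rewrite leeDl// integral_ge0// => u _; rewrite lee_fin.
rewrite EFinD leeD2l//.
pose h (u : R) := (1 + m) * e `^ th * (expR ((d + s - th) * u) * (1 + 1 * expR u) `^ (- (d + s - th + (th - s)))).
apply: (@le_trans _ _ (\int[mu]_u (h u)%:E)%E).
  apply: ge0_le_integralr => //; first by rewrite /h; meas.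
  move=> u; rewrite /g /h nt mul1r.
  have w0 : 0 < 1 + expR u by rewrite addr_gt0 ?expR_gt0.
  have := @one_sub_powR_le m (e * expR (- u)) th m0 _ _.
  rewrite mulr_ge0 ?expR_ge0// => /(_ isT); rewrite (lt_trans s0)//= => /(_ th1).
  move=> H; apply: (@le_trans _ _ (expR (s * u) * ((1 + expR (- u)) `^ (- d) *
      ((1 + m) * (e * expR (- u)) `^ th)))).
    by rewrite ler_wpM2l ?expR_ge0// ler_wpM2l ?powR_ge0.
  rewrite powRM ?expR_ge0// powR_expR.
  have -> : (1 + expR (- u)) `^ (- d) = expR (d * u) * (1 + expR u) `^ (- d).
    have -> : 1 + expR (- u) = (1 + expR u) / expR u.
      by rewrite mulrDl mul1r divff ?gt_eqF ?expR_gt0// expRN addrC.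
    rewrite powRM ?invr_ge0 ?expR_ge0 ?(ltW w0)// -expRN powR_expR mulrC.
    by congr (expR _ * _); ring.
  rewrite le_eqVlt; apply/orP; left; apply/eqP.
  have -> : expR ((d + s - th) * u) = expR (s * u) * expR (d * u) * expR (th * - u).
    by rewrite -!expRD; congr expR; ring.
  ring.
rewrite /h ge0_integralrZ; first last.
- by rewrite mulr_ge0 ?powR_ge0//; lra.
- by move=> u; rewrite mulr_ge0 ?expR_ge0 ?powR_ge0.
- by meas.
rewrite Beta_log// !powR1 !mulr1 nt -EFinM lee_fin /C.
by rewrite le_eqVlt; apply/orP; left; apply/eqP; ring.
Qed.

End jump_integral.

(** * The fractional Laplacian of powers of $|x|^2+c$ *)

Section power_calculus.
Context {R : realType}.
Implicit Types a b p q : R.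

Lemma is_derive_powR (x p : R) : 0 < x ->
  is_derive x (1 : R) (fun x => x `^ p) (p * x `^ (p - 1)).
Proof.
move=> x0; have xi : x \in `]0, +oo[ by rewrite in_itv/= x0.
apply: DeriveDef; first exact: derivable_powR.
by have := @powR_derive1 R p x xi; rewrite derive1E.
Qed.

(** The mean value theorem on the positive half line, with endpoints in any
    order. *)
Lemma MVT_pos (f df : R -> R) a b : 0 < a -> 0 < b ->
  (forall x : R, 0 < x -> is_derive x (1 : R) f (df x)) ->
  exists2 c, Num.min a b <= c <= Num.max a b & f a - f b = df c * (a - b).
Proof.
move=> a0 b0 dfx.
have h u v : 0 < u -> u < v -> exists2 c, u <= c <= v & f v - f u = df c * (v - u).
  move=> u0 uv; have [] := @MVT R f df u v uv.
  - by move=> x; rewrite in_itv/= => /andP[ux _]; apply: dfx; exact: lt_trans ux.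
  - apply: derivable_within_continuous => x; rewrite in_itv/= => /andP[ux _].
    by have := dfx x (lt_le_trans u0 ux) => ?; exact: ex_derive.
  - by move=> c; rewrite in_itv/= => /andP[/ltW uc /ltW cv] E; exists c => //; rewrite uc.
have [ab|ba|<-] := ltgtP a b.
- have [c cab E] := h a b a0 ab; exists c => //.
  by rewrite -opprB E -mulrN opprB.
- by have [c cab E] := h b a b0 ba; exists c.
- by exists a; rewrite ?lexx// !subrr mulr0.
Qed.

Lemma powR_lipschitz (B0 p a b : R) : 0 < B0 -> 0 < p -> B0 <= a -> B0 <= b ->
  `|a `^ (- p) - b `^ (- p)| <= p * B0 `^ (- p - 1) * `|a - b|.
Proof.
move=> B00 p0 Ba Bb; have a0 := lt_le_trans B00 Ba; have b0 := lt_le_trans B00 Bb.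
have [c /andP[c1 c2] ->] := MVT_pos a0 b0 (fun x => @is_derive_powR x (- p)).
have Bc : B0 <= c by rewrite (le_trans _ c1)// le_min Ba Bb.
rewrite normrM ler_wpM2r// normrM normrN (ger0_norm (ltW p0)) ger0_norm ?powR_ge0//.
rewrite ler_wpM2l ?(ltW p0)//.
have := @le_trans; rewrite -!opprD !powRN => _.
rewrite lef_pV2 ?posrE ?powR_gt0 ?(lt_le_trans B00 Bc)//.
by rewrite ge0_ler_powR ?nnegrE ?addr_ge0 ?(ltW p0) ?(ltW B00) ?(le_trans (ltW B00) Bc).
Qed.

Lemma powR_taylor (B0 q a b : R) : 0 < B0 -> 0 < q -> B0 <= a -> B0 <= b ->
  `|a `^ (- q) - b `^ (- q) + q * b `^ (- q - 1) * (a - b)| <=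
  q * (q + 1) * B0 `^ (- q - 2) * (a - b) ^+ 2.
Proof.
move=> B00 q0 Ba Bb; have a0 := lt_le_trans B00 Ba; have b0 := lt_le_trans B00 Bb.
have [c /andP[c1 c2] ->] := MVT_pos a0 b0 (fun x => @is_derive_powR x (- q)).
have Bc : B0 <= c by rewrite (le_trans _ c1)// le_min Ba Bb.
have -> : - q * c `^ (- q - 1) * (a - b) + q * b `^ (- q - 1) * (a - b) =
  q * (b `^ (- (q + 1)) - c `^ (- (q + 1))) * (a - b) by rewrite opprD; ring.
rewrite !normrM (ger0_norm (ltW q0)) -[X in _ <= _ * X]real_normK ?num_real// expr2 mulrA.
rewrite ler_wpM2r// -!mulrA ler_wpM2l ?(ltW q0)//.
apply: (le_trans (powR_lipschitz B00 _ Bb Bc)); first lra.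
have -> : - (q + 1) - 1 = - q - 2 by ring.
rewrite -!mulrA ler_wpM2l ?addr_ge0 ?(ltW q0)// ler_wpM2l ?powR_ge0//.
have h1 := ler_norm (a - b); have := ler_norm (- (a - b)); rewrite normrN => h2.
by move: c1 c2; rewrite minElt maxElt; case: ltP => h c1 c2;
  rewrite ler_norml; apply/andP; split; lra.
Qed.

End power_calculus.

Section bracket.
Context {R : realType}.
Notation mu := (@lebesgue_measure R).
Notation mu_ n := (lebesgue_rV R n).

Definition sdiff N (v : 'rV[R]_N -> R) (x y : 'rV[R]_N) : R :=
  2 * v x - v (x + y) - v (x - y).

Definition bracket N (c : R) (x : 'rV[R]_N) : R := edot x x + c.

Lemma bracket_ge N c (x : 'rV[R]_N) : c <= bracket c x.
Proof. by rewrite lerDr edot_ge0. Qed.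

Lemma bracket_gt0 N c (x : 'rV[R]_N) : 0 < c -> 0 < bracket c x.
Proof. by move=> c0; apply: lt_le_trans (bracket_ge _ _). Qed.

Lemma integral_comb3 d (T : measurableType d) (m : {measure set T -> \bar R})
    (f1 f2 f3 : T -> R) (a1 a2 a3 : R) :
  measurable_fun setT f1 -> measurable_fun setT f2 -> measurable_fun setT f3 ->
  (forall x, 0 <= f1 x) -> (forall x, 0 <= f2 x) -> (forall x, 0 <= f3 x) ->
  (\int[m]_x (f1 x)%:E = a1%:E)%E -> (\int[m]_x (f2 x)%:E = a2%:E)%E ->
  (\int[m]_x (f3 x)%:E = a3%:E)%E ->
  (\int[m]_x (2 * f1 x - f2 x - f3 x)%:E = (2 * a1 - a2 - a3)%:E)%E.
Proof.
move=> m1 m2 m3 p1 p2 p3 E1 E2 E3.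
have int (f : T -> R) (a : R) : measurable_fun setT f -> (forall x, 0 <= f x) ->
    (\int[m]_x (f x)%:E = a%:E)%E -> m.-integrable setT (fun x => (f x)%:E).
  by move=> mf f0 E; apply: ge0_integrabler => //; rewrite E ltry.
have i1 := int _ _ m1 p1 E1; have i2 := int _ _ m2 p2 E2; have i3 := int _ _ m3 p3 E3.
under eq_integral do rewrite EFinB EFinB EFinM.
have i12 : m.-integrable setT (fun x => 2%:E * (f1 x)%:E - (f2 x)%:E)%E.
  by apply: integrableB => //; apply: integrableZl.
rewrite integralB// integralB//; last by apply: integrableZl.
by rewrite integralZl// E1 E2 E3 -EFinM -!EFinB.
Qed.

Lemma edot_sqD N (x y : 'rV[R]_N) :
  edot (x + y) (x + y) = edot x x + 2 * edot x y + edot y y.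
Proof. by rewrite !edotDl !edotDr (edotC y x); ring. Qed.

Lemma edot_sqB N (x y : 'rV[R]_N) :
  edot (x - y) (x - y) = edot x x - 2 * edot x y + edot y y.
Proof. by rewrite edot_sqD edotNr edotNl edotNr opprK; ring. Qed.

Lemma enorm_small_min N (s : R) (y : 'rV[R]_N) : 0 < s < 1 ->
  Num.min (edot y y) 1 <= Num.min (enorm y `^ (1 + s)) 1.
Proof.
move=> /andP[s0 s1]; rewrite le_min !ge_min lexx orbT andbT.
have [y1|y1] := leP (enorm y) 1; last first.
  apply/orP; right; have := ler_powR (ltW y1) (_ : 0 <= 1 + s); rewrite powRr0; apply; lra.
apply/orP; left; rewrite -sqr_enorm -powR_mulrn ?enorm_ge0//.
have [->|y0] := eqVneq (enorm y) 0; first by rewrite !powR0// gt_eqF//; lra.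
by rewrite ger_powR ?lt_neqAle ?(eq_sym 0) ?y0 ?enorm_ge0//=; lra.
Qed.

Section identity.
Variables (N : nat) (s m c : R) (x : 'rV[R]_N).
Hypotheses (N0 : (0 < N)%N) (s01 : 0 < s < 1) (m0 : 0 < m) (c0 : 0 < c)
  (d0 : 0 < N%:R / 2 - (s + m)).
Let s0 : 0 < s. Proof. by case/andP: s01. Qed.
Let n : R := N%:R / 2 + s.
Let q : R := n + m.
Let n0 : 0 < n. Proof. by rewrite ltr_wpDl// divr_ge0. Qed.
Let q0 : 0 < q. Proof. by rewrite addr_gt0. Qed.

Let g (y : 'rV[R]_N) (u : R) (z : 'rV[R]_N) : R :=
  (bracket c z + edot y y * expR u) `^ (- q).
Let Phi (y : 'rV[R]_N) (u : R) : R := expR (n * u) *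
  (2 * g y u x - g y u (x + y) - g y u (x - y)).

Let mg d (T : measurableType d) (f z : T -> 'rV[R]_N) (u : T -> R) :
  measurable_fun setT f -> measurable_fun setT z -> measurable_fun setT u ->
  measurable_fun setT (fun t => g (f t) (u t) (z t)).
Proof. by move=> mf mz mu'; rewrite /g /bracket; meas. Qed.

Let mPhi : measurable_fun setT (fun z : 'rV[R]_N * R => Phi z.1 z.2).
Proof. by rewrite /Phi; apply: measurable_funM; [meas|apply: measurable_funB;
  [apply: measurable_funB; [apply: measurable_funM; [meas|]|]|]; apply: mg; meas]. Qed.

(** The first bound is used for small $y$, where the two first order terms
    cancel. *)
Let Phi_bound : exists2 C, 0 <= C & forall y u,
  `|Phi y u| <= C * Num.min (edot y y) 1 *
    (expR (n * u) * (c + edot y y * expR u) `^ (- q)).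
Proof.
pose C := 2 * q / c + q * (q + 1) * (8 * edot x x + 2) / c ^+ 2 + 4.
have xx := edot_ge0 x.
have C1 : 0 <= 2 * q / c by rewrite divr_ge0 ?mulr_ge0 ?ltW.
have C2 : 0 <= q * (q + 1) * (8 * edot x x + 2) / c ^+ 2.
  have h1 : 0 <= 8 * edot x x + 2 by lra.
  apply: divr_ge0; last by rewrite exprn_ge0 ?ltW.
  have q1 := q0; by apply: mulr_ge0 => //; apply: mulr_ge0; lra.
exists C; first by rewrite /C !addr_ge0.
move=> y u; rewrite /Phi normrM ger0_norm ?expR_ge0// mulrCA ler_wpM2l ?expR_ge0//.
set B0 := c + edot y y * expR u.
have yy := edot_ge0 y.
have yu : 0 <= edot y y * expR u by rewrite mulr_ge0 ?expR_ge0.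
have B00 : 0 < B0 by rewrite ltr_wpDr.
have ge (z : 'rV[R]_N) : B0 <= bracket c z + edot y y * expR u.
  by rewrite lerD2r bracket_ge.
have gB z : 0 <= g y u z <= B0 `^ (- q).
  rewrite powR_ge0/= /g !powRN lef_pV2 ?posrE ?powR_gt0// ?(lt_le_trans B00)//.
  by rewrite ge0_ler_powR ?nnegrE ?(ltW q0) ?(ltW B00)// (le_trans (ltW B00)).
have [y1|y1] := leP (edot y y) 1; last first.
  rewrite mulr1; apply: (@le_trans _ _ (4 * B0 `^ (- q))); last first.
    by rewrite ler_wpM2r ?powR_ge0// /C; lra.
  have /andP[? ?] := gB x; have /andP[? ?] := gB (x + y); have /andP[? ?] := gB (x - y).
  by rewrite ler_norml; lra.
have T1 := powR_taylor B00 q0 (ge (x + y)) (ge x).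
have T2 := powR_taylor B00 q0 (ge (x - y)) (ge x).
rewrite -/(g y u x) -/(g y u (x + y)) in T1.
rewrite -/(g y u x) -/(g y u (x - y)) in T2.
set b := bracket c x + _ in T1 T2.
have D1 : bracket c (x + y) + edot y y * expR u - b = 2 * edot x y + edot y y.
  by rewrite /b /bracket edot_sqD; ring.
have D2 : bracket c (x - y) + edot y y * expR u - b = - 2 * edot x y + edot y y.
  by rewrite /b /bracket edot_sqB; ring.
rewrite D1 in T1; rewrite D2 in T2.
have cs : edot x y ^+ 2 <= edot x x * edot y y.
  rewrite -!sqr_enorm -exprMn -[leLHS]real_normK ?num_real//.
  by rewrite ler_pXn2r ?nnegrE ?mulr_ge0 ?enorm_ge0// edot_le.
set E0 := B0 `^ (- q).
have e1 : 0 <= b `^ (- q - 1) <= E0 / c.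
  rewrite powR_ge0/= powRB; last by rewrite (gt_eqF (lt_le_trans B00 (ge x))) implybT.
  have bc : c <= b by rewrite (le_trans _ (ge x))// lerDl.
  rewrite powRr1 ?(le_trans (ltW c0) bc)//.
  apply: ler_pM; rewrite ?powR_ge0 ?invr_ge0 ?(le_trans (ltW c0) bc)//.
    by have /andP[] := gB x.
  by rewrite lef_pV2 ?posrE// (lt_le_trans c0).
have e2 : 0 <= B0 `^ (- q - 2) <= E0 / c ^+ 2.
  rewrite powR_ge0/= powRB; last by rewrite (gt_eqF B00) implybT.
  rewrite ler_wpM2l ?powR_ge0// powR_mulrn ?(ltW B00)// lef_pV2 ?posrE ?exprn_gt0//.
  by rewrite ler_pXn2r ?nnegrE ?(ltW c0) ?(ltW B00)// lerDl.
move/andP: e1 => [e10 e11]; move/andP: e2 => [e20 e22].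
set b1 := b `^ (- q - 1) in T1 T2 e10 e11; set b2 := B0 `^ (- q - 2) in T1 T2 e20 e22.
have E00 : 0 <= E0 by exact: powR_ge0.
have K1 : q * b1 * (2 * edot y y) <= 2 * q / c * edot y y * E0.
  have -> : 2 * q / c * edot y y * E0 = q * (E0 / c) * (2 * edot y y) by ring.
  by rewrite ler_wpM2r ?mulr_ge0// ler_wpM2l// ltW.
have K2 : q * (q + 1) * b2 * (8 * edot x y ^+ 2 + 2 * edot y y ^+ 2) <=
    q * (q + 1) * (8 * edot x x + 2) / c ^+ 2 * edot y y * E0.
  have -> : q * (q + 1) * (8 * edot x x + 2) / c ^+ 2 * edot y y * E0 =
    q * (q + 1) * (E0 / c ^+ 2) * ((8 * edot x x + 2) * edot y y) by ring.
  have qq : 0 <= q * (q + 1) by have q1 := q0; apply: mulr_ge0; lra.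
  have qb : 0 <= q * (q + 1) * b2 by exact: mulr_ge0.
  have pos : 0 <= 8 * edot x y ^+ 2 + 2 * edot y y ^+ 2.
    by have := sqr_ge0 (edot x y); have := sqr_ge0 (edot y y); lra.
  apply: ler_pM => //; first exact: ler_wpM2l.
  have : edot y y ^+ 2 <= edot y y by rewrite expr2 ler_piMr.
  by lra.
have E4 : 0 <= 4 * edot y y * E0 by rewrite !mulr_ge0.
have T3 : `|2 * g y u x - g y u (x + y) - g y u (x - y)| <=
   q * b1 * (2 * edot y y) + q * (q + 1) * b2 * (8 * edot x y ^+ 2 + 2 * edot y y ^+ 2).
  have K0 : 0 <= q * b1 * (2 * edot y y).
    by apply: mulr_ge0; [exact: mulr_ge0 (ltW q0) e10|exact: mulr_ge0].
  move: T1 T2; rewrite !ler_norml => /andP[? ?] /andP[? ?].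
  by apply/andP; split; lra.
apply: (le_trans T3); have -> : C * edot y y * E0 = 2 * q / c * edot y y * E0 +
  q * (q + 1) * (8 * edot x x + 2) / c ^+ 2 * edot y y * E0 + 4 * edot y y * E0.
  by rewrite /C; ring.
by lra.
Qed.

Let w (z : 'rV[R]_N) : R := bracket c z `^ (- m).
Let Bt : R := Gamma n * Gamma m / Gamma q.
Let kap : R := pi `^ (N%:R / 2) * Gamma (s + m) / Gamma q.
Let Bt0 : 0 < Bt. Proof. by rewrite divr_gt0 ?Gamma_gt0// mulr_gt0 ?Gamma_gt0. Qed.

Let mg1 y z : measurable_fun setT (fun u : R => expR (n * u) * g y u z).
Proof. by apply: measurable_funM; [meas|apply: mg; meas]. Qed.

Let mg2 (u : R) (f : 'rV[R]_N -> 'rV[R]_N) : measurable_fun setT f ->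
  measurable_fun setT (fun y => expR (n * u) * g y u (f y)).
Proof. by move=> mf; apply: measurable_funM; [meas|apply: mg; meas]. Qed.

Let g1_ge0 y u z : 0 <= expR (n * u) * g y u z.
Proof. by rewrite mulr_ge0 ?expR_ge0 ?powR_ge0. Qed.

Let integral_g_u y z : y != 0 ->
  (\int[mu]_u (expR (n * u) * g y u z)%:E = (Bt * (w z * kern s y))%:E)%E.
Proof.
move=> y0; rewrite /g Beta_log ?bracket_gt0//.
  by rewrite kernE.
by rewrite lt_neqAle edot_ge0 andbT eq_sym; apply: contra y0 => /eqP/edot_eq0->.
Qed.

Let Phi_u y :
  (\int[mu]_u (Phi y u)%:E = (Bt * (sdiff w x y * kern s y))%:E)%E.
Proof.
have [->|y0] := eqVneq y 0.
  rewrite /sdiff subr0 addr0 integral0_eq; last first.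
    by move=> u _; rewrite /Phi subr0 addr0 [X in _ * X](_ : _ = 0) ?mulr0//; ring.
  by rewrite [X in _ * (X * _)](_ : _ = 0) ?mul0r ?mulr0//; ring.
transitivity (\int[mu]_u (2 * (expR (n * u) * g y u x) - expR (n * u) * g y u (x + y)
    - expR (n * u) * g y u (x - y))%:E)%E.
  by apply: eq_integral => u _; rewrite /Phi; congr EFin; ring.
rewrite (@integral_comb3 _ _ _ _ _ _ (Bt * (w x * kern s y)) (Bt * (w (x + y) * kern s y))
  (Bt * (w (x - y) * kern s y))) => [||||u|u|u|||]; first (by rewrite /sdiff; congr EFin; ring);
  by [exact: mg1|exact: g1_ge0|exact: integral_g_u].
Qed.

Let Y := bracket c x.
Let Y0 : 0 < Y. Proof. exact: bracket_gt0. Qed.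

Let sm0 : 0 < s + m. Proof. by rewrite addr_gt0. Qed.

Let kap0 : 0 <= kap.
Proof.
apply: divr_ge0; last by apply/ltW/Gamma_gt0.
by apply: mulr_ge0; [exact: powR_ge0|exact/ltW/Gamma_gt0].
Qed.

Let qE : q = N%:R / 2 + (s + m). Proof. by rewrite /q /n addrA. Qed.

Let integral_g_y0 u : (\int[mu_ N]_y (expR (n * u) * g y u x)%:E =
  (kap * (Y `^ (- (s + m)) * expR (s * u)))%:E)%E.
Proof.
rewrite ge0_integralrZ; [|by apply: mg; meas|by move=> y; exact: powR_ge0|exact: expR_ge0].
have -> : (\int[mu_ N]_y (g y u x)%:E =
    \int[mu_ N]_y ((Y + expR u * edot y y) `^ (- (N%:R / 2 + (s + m))))%:E)%E.
  by apply: eq_integral => y _; rewrite /g qE (mulrC (edot _ _)).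
rewrite (Beta_rV N sm0 Y0 (expR_gt0 u)) -EFinM powR_expR -qE -/kap; congr EFin.
have -> : s * u = n * u + - (N%:R / 2) * u by rewrite /n; ring.
by rewrite (expRD (n * u)); ring.
Qed.

(* Completing the square; the minimum over [y] is reached at [- x / (1 + e^u)]. *)
Let integral_g_y1 (b : bool) u : (\int[mu_ N]_y (expR (n * u) * g y u (x + (-1) ^+ b *: y))%:E =
  (kap * (Y `^ (- (s + m)) * (expR (s * u) * ((1 + expR (- u)) `^ (- (N%:R / 2 - (s + m))) *
     (1 + c / Y * expR (- u)) `^ (- (s + m))))))%:E)%E.
Proof.
rewrite ge0_integralrZ; [| |by move=> y; exact: powR_ge0|exact: expR_ge0]; last first.
  apply: mg; [exact: measurable_id| |exact: measurable_cst].
  apply: measurable_rVD; first exact: measurable_cst.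
  by have := @measurable_affine_rV R N b 0; under eq_fun do rewrite addr0.
have u0 := expR_gt0 u; set v := expR u in u0 *.
have v1 : 0 < 1 + v by rewrite addr_gt0.
have vY : 0 < c + v * Y by rewrite addr_gt0 ?mulr_gt0.
pose A := (c + v * Y) / (1 + v); have A0 : 0 < A by rewrite divr_gt0.
pose h (y : 'rV[R]_N) := ((A + (1 + v) * edot y y) `^ (- (N%:R / 2 + (s + m))))%:E.
have -> : (\int[mu_ N]_y (g y u (x + (-1) ^+ b *: y))%:E =
    \int[mu_ N]_y h ((-1) ^+ b *: y + (1 + v)^-1 *: x)%R)%E.
  apply: eq_integral => y _; rewrite /g /h qE; congr (_ `^ _)%:E.
  rewrite edot_sqD /bracket edot_sqD.
  rewrite !(edotZl, edotZr) [edot y x]edotC /A /Y /bracket -/v.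
  have -> : (-1) ^+ b * ((-1) ^+ b * edot y y) = edot y y.
    by rewrite mulrA -expr2 sqrr_sign mul1r.
  by field; rewrite gt_eqF.
rewrite ge0_integral_affine_rV; last 2 first.
- by apply/measurable_EFinP; meas.
- by move=> y; rewrite lee_fin powR_ge0.
rewrite /h (Beta_rV N sm0 A0 v1) -EFinM -qE -/kap; congr EFin.
rewrite mulrCA; congr (_ * _).
have e1 : 1 + expR (- u) = (1 + v) / v.
  by rewrite expRN -/v; field; rewrite gt_eqF.
have e2 : 1 + c / Y * expR (- u) = (c + v * Y) / (Y * v).
  by rewrite expRN -/v; field; rewrite !gt_eqF.
rewrite e1 e2 /A !powR_log ?divr_gt0 ?mulr_gt0// !ln_div ?posrE ?mulr_gt0// lnM ?posrE//.
rewrite /v expRK -!expRD; congr expR; rewrite /n; ring.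
Qed.

Let jumpE u : (\int[mu_ N]_y (Phi y u)%:E = (2 * kap * Y `^ (- (s + m)) *
   jump s (N%:R / 2 - (s + m)) (s + m) (c / Y) u)%:E)%E.
Proof.
transitivity (\int[mu_ N]_y (2 * (expR (n * u) * g y u x) - expR (n * u) * g y u (x + y)
    - expR (n * u) * g y u (x - y))%:E)%E.
  by apply: eq_integral => y _; rewrite /Phi; congr EFin; ring.
have := integral_g_y1 false u; have := integral_g_y1 true u.
rewrite expr0 expr1; under eq_integral do rewrite scaleN1r.
move=> E1; under eq_integral do rewrite scale1r.
move=> E2; have E0 := integral_g_y0 u.
rewrite (integral_comb3 _ _ _ _ _ _ E0 E2 E1) => [|||||y|y]; first (by rewrite /jump; congr EFin; ring);
  by [apply: mg2; meas|move=> *; exact: g1_ge0].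
Qed.

Let integrable_Phi :
  (mu_ N \x mu)%E.-integrable setT (fun z : 'rV[R]_N * R => (Phi z.1 z.2)%:E).
Proof.
apply/integrable12ltyP; first exact/measurable_EFinP.
have [C C0 PhiC] := Phi_bound.
have mn : measurable_fun setT (fun y : 'rV[R]_N => Num.min (enorm y `^ (1 + s)) 1 * kern s y).
  by apply: measurable_funM; [apply: measurable_minr1; meas|exact: measurable_kern].
have mn0 y : 0 <= Num.min (enorm y `^ (1 + s)) 1 * kern s (y : 'rV[R]_N).
  by rewrite mulr_ge0 ?kern_ge0// le_min powR_ge0 ler01.
have K0 : 0 <= C * (Bt * c `^ (- m)) by rewrite mulr_ge0// mulr_ge0 ?powR_ge0// ltW.
apply: (@le_lt_trans _ _ (\int[mu_ N]_y (C * (Bt * c `^ (- m)) *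
    (Num.min (enorm y `^ (1 + s)) 1 * kern s y))%:E)%E); last first.
  by rewrite ge0_integralrZ// lte_mul_pinfty ?lee_fin//; exact: kern_lty.
apply: ge0_le_integral => //.
- by move=> y _; exact: integral_ge0.
- apply: (measurable_fun_fubini_tonelli_F (m2 := mu) (fun z : 'rV[R]_N * R => `|(Phi z.1 z.2)%:E|%E)).
    by apply/measurable_EFinP; apply: measurable_normr_comp.
  by move=> z; exact: abse_ge0.
- by apply/measurable_EFinP; apply: measurable_funM.
move=> y _; have [->|y0] := eqVneq y 0.
  rewrite integral0_eq; first by rewrite lee_fin mulr_ge0.
  move=> u _ /=; rewrite /Phi subr0 addr0 [X in _ * X](_ : _ = 0) ?mulr0 ?normr0//; ring.
have yy : 0 < edot y y.
  by rewrite lt_neqAle edot_ge0 andbT eq_sym; apply: contra y0 => /eqP/edot_eq0->.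
have D0 : 0 <= C * Num.min (edot y y) 1 by rewrite mulr_ge0// le_min edot_ge0 ler01.
apply: (@le_trans _ _ (\int[mu]_u (C * Num.min (edot y y) 1 *
    (expR (n * u) * (c + edot y y * expR u) `^ (- q)))%:E)%E).
  apply: ge0_le_integralr => [|u||u].
  - apply: measurable_normr_comp; rewrite /Phi; apply: measurable_funM; first by meas.
    by apply: measurable_funB; [apply: measurable_funB; [apply: measurable_funM; [meas|]|]|];
      apply: mg; meas.
  - exact: normr_ge0.
  - by meas.
  - exact: PhiC.
rewrite ge0_integralrZ; [|by meas|by move=> u; rewrite mulr_ge0 ?expR_ge0 ?powR_ge0|by []].
rewrite Beta_log// -EFinM lee_fin -/q -/Bt -kernE.
have := enorm_small_min y s01; set M1 := Num.min (edot y y) 1; set M2 := Num.min _ 1 => M12.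
have -> : C * (Bt * c `^ (- m)) * (M2 * kern s y) = (C * (Bt * (c `^ (- m) * kern s y))) * M2 by ring.
rewrite mulrAC ler_wpM2l// mulr_ge0// mulr_ge0 ?(ltW Bt0)// mulr_ge0 ?powR_ge0 ?kern_ge0//.
Qed.

(** The fractional Laplacian of $(|x|^2+c)^{-m}$, up to normalization.  By the
    Beta integral, $(|x|^2+c)^{-m}|y|^{-N-2s}$ is a superposition over $v=e^u$
    of powers of the quadratic function $|x|^2+c+v|y|^2$ of $(x,y)$, whose
    second differences in $x$ can be integrated in $y$ in closed form. *)
Lemma integral_sdiff_bracket :
  (\int[mu_ N]_y (sdiff (fun z => bracket c z `^ (- m)) x y * kern s y)%:E =
   (2 * pi `^ (N%:R / 2) * Gammaratio s m / Gamma (N%:R / 2 + s) *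
      bracket c x `^ (- (s + m)))%:E *
   \int[mu]_u (jump s (N%:R / 2 - (s + m)) (s + m) (c / bracket c x) u)%:E)%E.
Proof.
pose S y := sdiff w x y * kern s y.
have iS : (mu_ N).-integrable setT (fun y => (S y)%:E).
  have := integrable_fubini_F integrable_Phi.
  rewrite (_ : fubini_F _ _ = (fun y => (Bt * S y)%:E)); last first.
    by apply/funext => y; rewrite /fubini_F/= Phi_u.
  move/(integrableZl measurableT Bt^-1).
  apply: eq_integrable => // y _.
  by rewrite -EFinM mulrA mulVf ?mul1r// gt_eqF.
have := Fubini integrable_Phi => /=.
under eq_integral do rewrite Phi_u EFinM.
under [in RHS]eq_integral do rewrite jumpE.
rewrite integralZl// => E.
have -> : (\int[mu_ N]_y (S y)%:E = (Bt^-1)%:E * (Bt%:E * \int[mu_ N]_y (S y)%:E))%E.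
  by rewrite muleA -EFinM mulVf ?mul1e// gt_eqF.
rewrite E ge0_integralrZ; first last.
- by apply: mulr_ge0; [exact: mulr_ge0 kap0|exact: powR_ge0].
- by move=> u; rewrite jump_ge0 ?(ltW d0) ?addr_ge0 ?divr_ge0 ?(ltW m0) ?(ltW s0) ?(ltW c0) ?(ltW Y0).
- exact: measurable_jump.
rewrite muleA -EFinM; congr ((_)%:E * _)%E.
rewrite /Bt /kap /Gammaratio -/Y (addrC m) -/n.
by field; rewrite !gt_eqF// ?Gamma_gt0.
Qed.

End identity.
End bracket.

(** * The fractional Laplacian of functions with bounded second differences *)

Section fractional_laplacian_regular.
Context {R : realType}.
Notation mu_ n := (lebesgue_rV R n).

Lemma integral_affine_rV n (b : bool) (c : 'rV[R]_n) (f : 'rV[R]_n -> \bar R) :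
  measurable_fun setT f ->
  (\int[mu_ n]_x f ((-1) ^+ b *: x + c)%R = \int[mu_ n]_x f x)%E.
Proof.
move=> mf; rewrite integralE [RHS]integralE.
have P := ge0_integral_affine_rV b c (measurable_funepos mf) (fun x => funepos_ge0 f x).
have M := ge0_integral_affine_rV b c (measurable_funeneg mf) (fun x => funeneg_ge0 f x).
rewrite -P -M; congr (_ - _)%E; apply: eq_integral => x _; by rewrite ?funeposE ?funenegE.
Qed.

Lemma integral_shift_rV n (c : 'rV[R]_n) (f : 'rV[R]_n -> \bar R) :
  measurable_fun setT f ->
  (\int[mu_ n]_x f (x + c)%R = \int[mu_ n]_x f x)%E.
Proof.
move=> mf; rewrite -[RHS](integral_affine_rV false c)//.
by apply: eq_integral => x _; rewrite expr0 scale1r.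
Qed.

Lemma integral_reflect_rV n (c : 'rV[R]_n) (f : 'rV[R]_n -> \bar R) :
  measurable_fun setT f ->
  (\int[mu_ n]_x f (c - x)%R = \int[mu_ n]_x f x)%E.
Proof.
move=> mf; rewrite -[RHS](integral_affine_rV true c)//.
by apply: eq_integral => x _; rewrite expr1 scaleN1r addrC.
Qed.

Lemma measurable_integral_snd d1 d2 (T1 : measurableType d1)
    (T2 : measurableType d2) (m2 : {sigma_finite_measure set T2 -> \bar R})
    (f : T1 * T2 -> \bar R) : measurable_fun setT f ->
  measurable_fun setT (fun x => \int[m2]_y f (x, y))%E.
Proof.
move=> mf; have P := measurable_fun_fubini_tonelli_F (m2 := m2) f^\+%E
  (measurable_funepos mf) (fun z => funepos_ge0 f z).
have M := measurable_fun_fubini_tonelli_F (m2 := m2) f^\-%E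
  (measurable_funeneg mf) (fun z => funeneg_ge0 f z).
have := emeasurable_funB P M; congr measurable_fun; apply/funext => x.
rewrite [RHS]integralE /fubini_F; congr (_ - _)%E; apply: eq_integral => y _.
  by rewrite !funeposE.
by rewrite !funenegE.
Qed.

Variables (N : nat) (s : R).
Hypotheses (N0 : (0 < N)%N) (s01 : 0 < s < 1).
Let s0 : 0 < s. Proof. by case/andP: s01. Qed.
Let s1 : s < 1. Proof. by case/andP: s01. Qed.

Definition kmass (y : 'rV[R]_N) : R := Num.min (enorm y `^ (1 + s)) 1 * kern s y.

Lemma kmass_ge0 y : 0 <= kmass y.
Proof. by rewrite mulr_ge0 ?kern_ge0// le_min powR_ge0 ler01. Qed.

Lemma measurable_kmass : measurable_fun setT kmass.
Proof.
by apply: measurable_funM; [apply: measurable_minr1; meas|exact: measurable_kern].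
Qed.

Lemma integrable_kmass : (mu_ N).-integrable setT (fun y => (kmass y)%:E).
Proof.
by apply: ge0_integrabler; [exact: measurable_kmass|exact: kmass_ge0|exact: kern_lty].
Qed.

Definition ktotal : R := \int[mu_ N]_y kmass y.

Lemma ktotal_ge0 : 0 <= ktotal.
Proof. by apply: Rintegral_ge0 => y _; exact: kmass_ge0. Qed.

Lemma integral_kmass : (\int[mu_ N]_y (kmass y)%:E = ktotal%:E)%E.
Proof. by rewrite /ktotal /Rintegral fineK//; exact: integrable_fin_num integrable_kmass. Qed.

(** Functions with bounded second differences, on which the fractional
    Laplacian is an absolutely convergent integral. *)
Definition regular (v : 'rV[R]_N -> R) (C : R) : Prop :=
  [/\ measurable_fun setT v, 0 <= C, forall x, `|v x| <= C,
      forall x y, `|v x - v y| <= C * enorm (x - y) &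
      forall x y, `|sdiff v x y| <= C * edot y y].

Lemma measurable_comp_rV d (T : measurableType d) (v : 'rV[R]_N -> R) (f : T -> 'rV[R]_N) :
  measurable_fun setT v -> measurable_fun setT f -> measurable_fun setT (fun x => v (f x)).
Proof. by move=> mv mf; exact: (measurableT_comp mv mf). Qed.

Lemma measurable_sdiff d (T : measurableType d) (v : 'rV[R]_N -> R) (f g : T -> 'rV[R]_N) :
  measurable_fun setT v -> measurable_fun setT f -> measurable_fun setT g ->
  measurable_fun setT (fun z => sdiff v (f z) (g z)).
Proof.
move=> mv mf mg; apply: measurable_funB; [apply: measurable_funB; [apply: measurable_funM|]|].
- exact: measurable_cst.
- exact: measurable_comp_rV.
- by apply: measurable_comp_rV; [|apply: measurable_rVD].
- by apply: measurable_comp_rV; [|apply: measurable_rVB].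
Qed.

Lemma enorm_powR_le1 (y : 'rV[R]_N) : enorm y <= 1 ->
  Num.min (enorm y `^ (1 + s)) 1 = enorm y `^ (1 + s).
Proof.
move=> y1; apply/min_idPl; rewrite -[leRHS](_ : 1 `^ (1 + s) = 1); last by rewrite powR1.
by rewrite ge0_ler_powR ?nnegrE ?enorm_ge0//; have := s0; lra.
Qed.

Lemma enorm_powR_gt1 (y : 'rV[R]_N) : 1 < enorm y ->
  Num.min (enorm y `^ (1 + s)) 1 = 1.
Proof.
move=> y1; apply/min_idPr; rewrite -[leLHS](powRr0 (enorm y)).
by rewrite ler_powR ?(ltW y1)//; have := s0; lra.
Qed.

Section one_function.
Variables (v : 'rV[R]_N -> R) (C : R).
Hypothesis rv : regular v C.
Let mv : measurable_fun setT v. Proof. by case: rv. Qed.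
Let C0 : 0 <= C. Proof. by case: rv. Qed.

Lemma sdiff_bound x y : `|sdiff v x y| <= 4 * C * Num.min (edot y y) 1.
Proof.
case: rv => _ _ b _ sd; have [y1|y1] := leP (edot y y) 1.
  by rewrite (le_trans (sd _ _))// ler_wpM2r ?edot_ge0//; have := C0; lra.
rewrite mulr1 /sdiff; have := b x; have := b (x + y); have := b (x - y).
by rewrite !ler_norml => /andP[? ?] /andP[? ?] /andP[? ?]; apply/andP; split; lra.
Qed.

Lemma sdiff_kern_bound x y : `|sdiff v x y * kern s y| <= 4 * C * kmass y.
Proof.
rewrite normrM (ger0_norm (kern_ge0 _ _)) /kmass mulrA ler_wpM2r ?kern_ge0//.
rewrite (le_trans (sdiff_bound _ _))// ler_wpM2l//; first by have := C0; lra.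
exact: enorm_small_min.
Qed.

Lemma measurable_sdiff_kern x : measurable_fun setT (fun y => sdiff v x y * kern s y).
Proof.
apply: measurable_funM; last exact: measurable_kern.
by apply: measurable_sdiff => //; meas.
Qed.

Lemma integrable_sdiff_kern x :
  (mu_ N).-integrable setT (fun y => (sdiff v x y * kern s y)%:E).
Proof.
apply: (le_integrable measurableT _ _ (integrableZl measurableT (4 * C) integrable_kmass)).
  by apply/measurable_EFinP; exact: measurable_sdiff_kern.
move=> y _; rewrite -EFinM ?abse_EFin lee_fin (le_trans (sdiff_kern_bound _ _))//.
exact: ler_norm.
Qed.

Definition symLap (x : 'rV[R]_N) : R := \int[mu_ N]_y (sdiff v x y * kern s y).

Lemma EFin_symLap x : (\int[mu_ N]_y (sdiff v x y * kern s y)%:E = (symLap x)%:E)%E.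
Proof.
by rewrite /symLap /Rintegral fineK//; exact: integrable_fin_num (integrable_sdiff_kern x).
Qed.

Lemma measurable_symLap : measurable_fun setT symLap.
Proof.
apply: (measurableT_comp (fine_measurable measurableT)).
apply: (measurable_integral_snd (mu_ N)
  (f := fun z : 'rV[R]_N * 'rV[R]_N => (sdiff v z.1 z.2 * kern s z.2)%:E)).
apply/measurable_EFinP; apply: measurable_funM.
  by apply: measurable_sdiff => //; meas.
exact: (measurableT_comp (@measurable_kern R N s)).
Qed.

Lemma Rintegral_kmass_bound (f : 'rV[R]_N -> R) (K : R) : measurable_fun setT f ->
  (forall y, `|f y| <= K * kmass y) -> `|\int[mu_ N]_y f y| <= K * ktotal.
Proof.
move=> mf fK; have iK := integrableZl measurableT K integrable_kmass.
have iF : (mu_ N).-integrable setT (EFin \o f).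
  apply: (le_integrable measurableT _ _ iK); first exact/measurable_EFinP.
  move=> y _; rewrite /= -?EFinM ?abse_EFin lee_fin (le_trans (fK _))//.
  exact: ler_norm.
apply: (le_trans (le_normr_Rintegral measurableT iF)).
rewrite /ktotal -RintegralZl//; last exact: integrable_kmass.
apply: le_Rintegral => //.
by have := integrable_norm iF.
Qed.

Lemma symLap_bound x : `|symLap x| <= 4 * C * ktotal.
Proof.
by apply: Rintegral_kmass_bound; [exact: measurable_sdiff_kern|exact: sdiff_kern_bound].
Qed.

Lemma min_interpolation (z p q a : R) : 0 < a < 1 -> 0 <= z -> z <= p -> z <= q ->
  z <= p `^ (1 - a) * q `^ a.
Proof.
move=> /andP[a0 a1] z0 zp zq.
have -> : z = z `^ (1 - a) * z `^ a.
  have [->|zn] := eqVneq z 0; first by rewrite !powR0 ?mul0r// gt_eqF// subr_gt0.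
  by rewrite -powRD ?zn ?implybT// subrK powRr1.
have p0 := le_trans z0 zp; have q0 := le_trans z0 zq.
apply: ler_pM; rewrite ?powR_ge0//; apply: ge0_ler_powR; rewrite ?nnegrE//; last exact: ltW.
by rewrite subr_ge0 ltW.
Qed.

Lemma symLap_hoelder x x' :
  `|symLap x - symLap x'| <= 8 * C * enorm (x - x') `^ ((1 - s) / 2) * ktotal.
Proof.
have [_ _ bd lip sd] := rv; set a := (1 - s) / 2; set de := enorm (x - x').
have de0 : 0 <= de by exact: enorm_ge0.
have a01 : 0 < a < 1 by rewrite /a; have := s0; have := s1; move=> *; apply/andP; split; lra.
rewrite /symLap -RintegralB//; try exact: integrable_sdiff_kern.
apply: Rintegral_kmass_bound => [|y].
  by apply: measurable_funB; exact: measurable_sdiff_kern.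
rewrite -mulrBl normrM (ger0_norm (kern_ge0 _ _)) /kmass mulrA ler_wpM2r ?kern_ge0//.
set z := `|_|; have z0 : 0 <= z by exact: normr_ge0.
have Q : z <= 8 * C * de.
  have -> : 8 * C * de = 2 * (C * de) + (C * de + C * de) + 4 * (C * de) by ring.
  have l1 := lip x x'; have l2 := lip (x + y) (x' + y); have l3 := lip (x - y) (x' - y).
  rewrite opprD addrACA subrr addr0 in l2; rewrite opprD addrACA subrr addr0 in l3.
  rewrite -/de in l1 l2 l3; move: l1 l2 l3; rewrite /z /sdiff !ler_norml.
  have : 0 <= C * de by exact: mulr_ge0.
  by move=> ? /andP[? ?] /andP[? ?] /andP[? ?]; apply/andP; split; lra.
have b2 x0 : `|sdiff v x0 y| <= 4 * C.
  rewrite (le_trans (sdiff_bound _ _))// -[leRHS]mulr1 ler_wpM2l//; first by have := C0; lra.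
  by rewrite ge_min lexx orbT.
have [y1|y1] := leP (enorm y) 1.
  rewrite enorm_powR_le1//.
  have P : z <= 8 * C * enorm y ^+ 2.
    rewrite sqr_enorm /z (le_trans (ler_normB _ _))//.
    have := sd x y; have := sd x' y; have : 0 <= C * edot y y by rewrite mulr_ge0 ?edot_ge0.
    lra.
  have C8 : 0 <= 8 * C by rewrite mulr_ge0.
  apply: (le_trans (min_interpolation a01 z0 P Q)).
  rewrite (powRM _ C8 (exprn_ge0 2 (enorm_ge0 y))) (powRM _ C8 de0).
  rewrite -powR_mulrn ?enorm_ge0// -powRrM.
  have -> : 2%:R * (1 - a) = 1 + s by rewrite /a; field.
  have -> : (8 * C) `^ (1 - a) * enorm y `^ (1 + s) * ((8 * C) `^ a * de `^ a) =
    ((8 * C) `^ (1 - a) * (8 * C) `^ a) * de `^ a * enorm y `^ (1 + s) by ring.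
  rewrite -powRD; first by rewrite subrK powRr1.
  by rewrite subrK oner_eq0.
rewrite enorm_powR_gt1// mulr1.
have P : z <= 8 * C.
  by rewrite /z (le_trans (ler_normB _ _))//; have := b2 x; have := b2 x'; lra.
have C8 : 0 <= 8 * C by rewrite mulr_ge0.
apply: (le_trans (min_interpolation a01 z0 P Q)); rewrite (powRM _ C8 de0) mulrA -powRD.
  by rewrite subrK powRr1.
by rewrite subrK oner_eq0.
Qed.

Let Te (e : R) (z : 'rV[R]_N) : R := if e < enorm z then kern s z else 0.

Let mTe e : measurable_fun setT (Te e).
Proof.
apply: measurable_fun_ifT; [|exact: measurable_kern|exact: measurable_cst].
by apply: measurable_fun_ltr; meas.
Qed.

Let Te_bound e z : 0 < e <= 1 -> 0 <= Te e z <= (e `^ (1 + s))^-1 * kmass z.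
Proof.
move=> /andP[e0 e1]; rewrite /Te; case: ifPn => [ez|_]; last first.
  by rewrite lexx mulr_ge0 ?kmass_ge0// invr_ge0 powR_ge0.
rewrite kern_ge0/= /kmass mulrA ler_peMl ?kern_ge0//.
rewrite mulrC ler_pdivlMr ?powR_gt0// mul1r le_min.
rewrite ge0_ler_powR ?nnegrE ?(ltW e0) ?enorm_ge0 ?(ltW ez)//=; last by have := s0; lra.
rewrite -[leRHS](_ : 1 `^ (1 + s) = 1); last by rewrite powR1.
by rewrite ge0_ler_powR ?nnegrE ?(ltW e0)//; have := s0; lra.
Qed.

(* Half the sum of the integrals obtained by the substitutions [y = x + z] and
   [y = x - z]. *)
Let trunc_sym x e : 0 < e <= 1 -> fracLap_trunc s v x e =
  fracLap_const N s / 2 * \int[mu_ N]_z (sdiff v x z * Te e z).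
Proof.
move=> e01; rewrite /fracLap_trunc -mulrA; congr (_ * _).
pose h z := (v x - v (x + z)) * Te e z; pose h' z := (v x - v (x - z)) * Te e z.
have mh : measurable_fun setT h.
  apply: measurable_funM => //; apply: measurable_funB; first exact: measurable_cst.
  by apply: measurable_comp_rV => //; meas.
have mh' : measurable_fun setT h'.
  apply: measurable_funM => //; apply: measurable_funB; first exact: measurable_cst.
  by apply: measurable_comp_rV => //; meas.
have int1 (k : 'rV[R]_N -> R) : measurable_fun setT k ->
    (forall z, `|k z| <= 2 * C * Te e z) -> (mu_ N).-integrable setT (EFin \o k).
  move=> mk kb; apply: (le_integrable measurableT _ _
     (integrableZl measurableT (2 * C * (e `^ (1 + s))^-1) integrable_kmass)).
    exact/measurable_EFinP.
  move=> z _; rewrite /= -?EFinM ?abse_EFin lee_fin (le_trans (kb _))//.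
  rewrite (le_trans _ (ler_norm _))// -!mulrA; do 2 (rewrite ler_wpM2l//).
  by have /andP[] := Te_bound z e01.
have bd a b : `|v a - v b| <= 2 * C.
  by case: rv => _ _ b' _ _; rewrite (le_trans (ler_normB _ _))//; have := b' a; have := b' b; lra.
have Te0 z : 0 <= Te e z by have /andP[] := Te_bound z e01.
have ih : (mu_ N).-integrable setT (EFin \o h).
  by apply: int1 => // z; rewrite normrM (ger0_norm (Te0 _)) ler_wpM2r.
have ih' : (mu_ N).-integrable setT (EFin \o h').
  by apply: int1 => // z; rewrite normrM (ger0_norm (Te0 _)) ler_wpM2r.
pose D := [set y | e < enorm (x - y)].
have E0 : (\int[mu_ N]_(y in D)
    ((v x - v y) / enorm (x - y) `^ (N%:R + 2 * s))%:E = \int[mu_ N]_z (h' z)%:E)%E.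
  rewrite -(integral_reflect_rV x (f := EFin \o h')); last exact/measurable_EFinP.
  rewrite integral_mkcond; apply: eq_integral => y _.
  rewrite patchE /h' /= (_ : x - (x - y) = y) /Te; last by rewrite opprB addrCA subrr addr0.
  have -> : (y \in D) = (e < enorm (x - y)) by apply/idP/idP => [/set_mem|/mem_set].
  by case: ifP; rewrite ?mulr0.
have E1 : (\int[mu_ N]_z (h z)%:E = \int[mu_ N]_z (h' z)%:E)%E.
  rewrite -(integral_reflect_rV 0 (f := EFin \o h')); last exact/measurable_EFinP.
  by apply: eq_integral => z _; rewrite /h /h' /= sub0r opprK /Te enormN kernN.
have -> : \int[mu_ N]_z (sdiff v x z * Te e z) = \int[mu_ N]_z (h z + h' z).
  by apply: eq_Rintegral => z _; rewrite /sdiff /h /h'; ring.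
rewrite RintegralD// /Rintegral E0 E1 -/(Rintegral _ _ h').
by field.
Qed.

Let trunc_close x e : 0 < e <= 1 ->
  `|fracLap_trunc s v x e - fracLap_const N s / 2 * symLap x| <=
  `|fracLap_const N s / 2| * (C * e `^ (1 - s) * ktotal).
Proof.
move=> e01; have /andP[e0 e1] := e01; rewrite trunc_sym// -mulrBr normrM ler_wpM2l//.
have mST : measurable_fun setT (fun z => sdiff v x z * Te e z).
  by apply: measurable_funM => //; apply: measurable_sdiff => //; meas.
have Tk z : 0 <= Te e z <= kern s z by rewrite /Te; case: ifP; rewrite ?lexx kern_ge0.
rewrite /symLap -RintegralB//; last exact: integrable_sdiff_kern.
  apply: Rintegral_kmass_bound => [|z].
    by apply: measurable_funB => //; exact: measurable_sdiff_kern.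
  rewrite -mulrBr normrM /Te; case: ifPn => [_|].
    by rewrite subrr normr0 mulr0 mulr_ge0 ?kmass_ge0// mulr_ge0 ?powR_ge0.
  rewrite -leNgt sub0r normrN (ger0_norm (kern_ge0 _ _)) => ze.
  rewrite /kmass enorm_powR_le1 ?(le_trans ze)// mulrA ler_wpM2r ?kern_ge0//.
  have [_ _ _ _ sd] := rv; rewrite (le_trans (sd _ _))// -mulrA ler_wpM2l//.
  rewrite -sqr_enorm -powR_mulrn ?enorm_ge0//.
  have [->|z0] := eqVneq (enorm z) 0; first by rewrite powR0 ?mulr_ge0 ?powR_ge0.
  have -> : 2%:R = (1 - s) + (1 + s) :> R by ring.
  rewrite powRD ?z0 ?implybT// ler_wpM2r ?powR_ge0//.
  by rewrite ge0_ler_powR ?nnegrE ?enorm_ge0 ?(ltW e0)// subr_ge0 ltW.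
apply: (le_integrable measurableT _ _ (integrable_sdiff_kern x)).
  exact/measurable_EFinP.
move=> z _; rewrite /= ?abse_EFin lee_fin !normrM ler_wpM2l//.
by have /andP[t0 t1] := Tk z; rewrite !ger0_norm ?kern_ge0.
Qed.

Lemma cvg_fracLap_trunc x :
  fracLap_trunc s v x e @[e --> 0^'+] --> fracLap_const N s / 2 * symLap x.
Proof.
pose K := `|fracLap_const N s / 2| * (C * ktotal).
apply/cvgrPdist_le => d d0; near=> e.
rewrite distrC (le_trans (trunc_close x _))//.
  by apply/andP; split; near: e; [exact: nbhs_right_gt|exact: nbhs_right_le].
have -> : `|fracLap_const N s / 2| * (C * e `^ (1 - s) * ktotal) = K * e `^ (1 - s).
  by rewrite /K; ring.
rewrite (le_trans (ler_norm _))//; near: e.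
have h := @powR_cvg0 R (1 - s) (_ : 0 < 1 - s).
have K1 : 0 < `|K| + 1 by rewrite ltr_wpDl.
have {}h : e `^ (1 - s) @[e --> 0^'+] --> (0 : R) by apply: h; rewrite subr_gt0.
move/cvgrPdist_le : h => /(_ _ (divr_gt0 d0 K1)); apply: filterS => e.
rewrite sub0r normrN => He; rewrite normrM.
apply: (@le_trans _ _ (`|K| * (d / (`|K| + 1)))); first by rewrite ler_wpM2l.
by rewrite mulrCA ler_piMr ?(ltW d0)// ler_pdivrMr// mul1r lerDl.
Unshelve. all: by end_near. Qed.

Lemma fracLap_regular x : fracLap s v x = fracLap_const N s / 2 * symLap x.
Proof. by apply/cvg_lim => //; exact: cvg_fracLap_trunc. Qed.

End one_function.
End fractional_laplacian_regular.

(** * The energy form *)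

Section energy.
Context {R : realType}.
Notation mu_ n := (lebesgue_rV R n).
Variables (N : nat) (s : R) (Om : set 'rV[R]_N).
Hypotheses (N0 : (0 < N)%N) (s01 : 0 < s < 1) (oOm : open Om) (bOm : bounded_set Om).
Let mOm : measurable Om. Proof. exact: open_measurable_rV. Qed.

Lemma bounded_set_cube : exists2 M, 0 <= M & forall x, Om x -> forall i, `|x ord0 i| <= M.
Proof.
have [M [_ HM]] := bOm; exists (`|M| + 1) => [|x Ox i]; first by rewrite addr_ge0.
have := HM (`|M| + 1) _ x Ox; rewrite (le_lt_trans (ler_norm M)) ?ltrDl// => /(_ isT).
apply: le_trans; rewrite /Num.norm/= mx_normrE.
exact: (le_bigmax _ (fun ij => `|x ij.1 ij.2|) (ord0, i)).
Qed.

Lemma bounded_set_finite : (mu_ N Om < +oo)%E.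
Proof.
have [M M0 HM] := bounded_set_cube.
have mC : measurable [set x : 'rV[R]_N | forall i, `|x ord0 i| <= M].
  rewrite [X in measurable X](_ : _ = [set x : 'rV[R]_N |
    forall i, `|x ord0 i - (0 : 'rV[R]_N) ord0 i| <= M]); first exact: measurable_cube.
  by apply/seteqP; split => x /= H i; have := H i; rewrite mxE subr0.
apply: (@le_lt_trans _ _ (mu_ N [set x : 'rV[R]_N | forall i, `|x ord0 i| <= M])).
  by apply: le_measure; rewrite ?inE.
by rewrite lebesgue_rV_cube// ltry.
Qed.

Let mu1 (x : 'rV[R]_N) : R := \1_Om x.
Let mmu1 : measurable_fun setT mu1. Proof. exact: measurable_indic. Qed.
Let mu1_ge0 x : 0 <= mu1 x. Proof. by rewrite /mu1 indicE ler0n. Qed.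

Let integral_mu1 : (\int[mu_ N]_x (mu1 x)%:E = (fine (mu_ N Om))%:E)%E.
Proof.
rewrite integral_indic// setIT fineK// ge0_fin_numE//; exact: bounded_set_finite.
Qed.

Section regular_function.
Variables (v : 'rV[R]_N -> R) (C : R).
Hypotheses (rv : regular v C) (v_ext : forall x, ~ Om x -> v x = 0).
Let mv : measurable_fun setT v. Proof. by case: rv. Qed.
Let C0 : 0 <= C. Proof. by case: rv. Qed.

Let mgag (w : 'rV[R]_N -> R) : measurable_fun setT w ->
  measurable_fun setT (fun z : 'rV[R]_N * 'rV[R]_N => (w z.1 - w z.2) ^+ 2 * kern s (z.1 - z.2)).
Proof.
move=> mw; apply: measurable_funM.
  by apply: measurable_funX; apply: measurable_funB; apply: measurable_comp_rV => //; meas.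
by apply: measurable_comp_rV; [exact: measurable_kern|meas].
Qed.

Lemma gagliardo2_lty : (gagliardo2 s v < +oo)%E.
Proof.
rewrite /gagliardo2 /lebesgue_xy.
pose G x y := (v x - v y) ^+ 2 * kern s (x - y).
have G0 x y : 0 <= G x y by rewrite mulr_ge0 ?sqr_ge0 ?kern_ge0.
have mG : measurable_fun setT (fun z : 'rV[R]_N * 'rV[R]_N => G z.1 z.2) by exact: mgag.
rewrite (@fubini_tonelli1 _ _ _ _ _ (mu_ N) (mu_ N) (fun z => (G z.1 z.2)%:E)); last 2 first.
- exact/measurable_EFinP.
- by move=> z; rewrite lee_fin.
pose F (x z : 'rV[R]_N) := 4 * C ^+ 2 * kmass s z * (mu1 x + mu1 (z + x)).
have F0 x z : 0 <= F x z.
  rewrite mulr_ge0 ?addr_ge0// mulr_ge0 ?kmass_ge0// mulr_ge0 ?sqr_ge0//.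
have mF : measurable_fun setT (fun z : 'rV[R]_N * 'rV[R]_N => F z.1 z.2).
  apply: measurable_funM.
    by apply: measurable_funM => //; apply: measurable_comp_rV; [exact: measurable_kmass|meas].
  by apply: measurable_funD; apply: measurable_comp_rV => //; meas.
apply: (@le_lt_trans _ _ (\int[mu_ N]_x \int[mu_ N]_z (F x z)%:E)%E).
  apply: ge0_le_integral => //.
  - by move=> x _; apply: integral_ge0 => y _; rewrite lee_fin.
  - apply: (measurable_integral_snd (mu_ N) (f := fun z => (G z.1 z.2)%:E)).
    exact/measurable_EFinP.
  - apply: (measurable_integral_snd (mu_ N) (f := fun z => (F z.1 z.2)%:E)).
    exact/measurable_EFinP.
  move=> x _; rewrite /fubini_F /=.
  have mGx : measurable_fun setT (fun y => (G x y)%:E).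
    apply/measurable_EFinP; apply: measurable_funM.
      by apply: measurable_funX; apply: measurable_funB => //; exact: measurable_cst.
    by apply: measurable_comp_rV; [exact: measurable_kern|meas].
  rewrite -(integral_shift_rV x mGx); apply: ge0_le_integralr => //.
  - by have /measurable_EFinP := mGx => h; apply: (measurable_comp_rV h); meas.
  - apply: measurable_funM.
      by apply: measurable_funM => //; exact: measurable_kmass.
    by apply: measurable_funD => //; apply: measurable_comp_rV => //; meas.
  move=> z; rewrite /G /F opprD addrCA subrr addr0 kernN.
  have [_ _ bd lip _] := rv.
  have b : (v x - v (z + x)) ^+ 2 <= 4 * C ^+ 2 * Num.min (enorm z `^ (1 + s)) 1 * (mu1 x + mu1 (z + x)).
    have [nx|nx] := pselect (~ Om x /\ ~ Om (z + x)).
      by rewrite !v_ext ?subrr ?expr0n/=; tauto || rewrite mulr_ge0 ?addr_ge0// mulr_ge0 ?mulr_ge0 ?sqr_ge0// le_min powR_ge0 ler01.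
    have m1 : 1 <= mu1 x + mu1 (z + x).
      have [Ox|nOx] := pselect (Om x).
        by rewrite {1}/mu1 indicE mem_set// lerDl.
      have Oz : Om (z + x) by apply: contrapT => ?; apply: nx.
      by rewrite {2}/mu1 indicE (mem_set Oz) lerDr.
    have CM : 0 <= 4 * C ^+ 2 * Num.min (enorm z `^ (1 + s)) 1.
      by rewrite mulr_ge0 ?mulr_ge0 ?sqr_ge0// le_min powR_ge0 ler01.
    apply: (@le_trans _ _ (4 * C ^+ 2 * Num.min (enorm z `^ (1 + s)) 1)); last by rewrite ler_peMr.
    apply: (@le_trans _ _ (4 * C ^+ 2 * Num.min (edot z z) 1)); last first.
      by rewrite ler_wpM2l ?mulr_ge0 ?sqr_ge0//; exact: enorm_small_min.
    rewrite -[leLHS]real_normK ?num_real//.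
    have [z1|z1] := leP (edot z z) 1.
      have := lip x (z + x); rewrite opprD addrCA subrr addr0 enormN => l.
      apply: (@le_trans _ _ ((C * enorm z) ^+ 2)).
        by rewrite ler_pXn2r ?nnegrE ?mulr_ge0 ?enorm_ge0.
      rewrite exprMn sqr_enorm -mulrA ler_peMl// ?mulr_ge0 ?sqr_ge0 ?edot_ge0//; lra.
    have : `|v x - v (z + x)| <= 2 * C.
      by rewrite (le_trans (ler_normB _ _))//; have := bd x; have := bd (z + x); lra.
    move=> l; apply: (@le_trans _ _ ((2 * C) ^+ 2)).
      by rewrite ler_pXn2r ?nnegrE ?mulr_ge0.
    by rewrite mulr1 exprMn le_eqVlt; apply/orP; left; apply/eqP; ring.
  have := ler_wpM2r (kern_ge0 s z) b; rewrite /kmass => h; apply: (le_trans h).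
  by rewrite le_eqVlt; apply/orP; left; apply/eqP; ring.
rewrite tonelli//.
have E z : (\int[mu_ N]_x (F x z)%:E = (4 * C ^+ 2 * (2 * fine (mu_ N Om)) * kmass s z)%:E)%E.
  have k0 : 0 <= 4 * C ^+ 2 * kmass s z by rewrite mulr_ge0 ?kmass_ge0// mulr_ge0 ?sqr_ge0.
  have m2 : measurable_fun setT (fun x => mu1 (z + x)) by apply: measurable_comp_rV => //; meas.
  rewrite /F ge0_integralrZ//; last 2 first.
  - exact: measurable_funD.
  - by move=> x; rewrite addr_ge0.
  rewrite ge0_integralrD// integral_mu1.
  have -> : (\int[mu_ N]_x (mu1 (z + x)%R)%:E = \int[mu_ N]_x (mu1 x)%:E)%E.
    rewrite -[RHS](integral_shift_rV z); last exact/measurable_EFinP.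
    by apply: eq_integral => x _; rewrite addrC.
  by rewrite integral_mu1 -EFinD -EFinM; congr EFin; ring.
under eq_integral do rewrite E.
rewrite ge0_integralrZ; [|exact: measurable_kmass|exact: kmass_ge0|]; last first.
  by rewrite mulr_ge0 ?mulr_ge0 ?sqr_ge0 ?fine_ge0.
by rewrite (integral_kmass N0 s01) -EFinM ltry.
Qed.

Section against_H0s.
Variable w : 'rV[R]_N -> R.
Hypothesis Hw : H0s s Om w.
Let mw : measurable_fun setT w. Proof. by case: Hw. Qed.

Lemma H0s_integrable : (mu_ N).-integrable setT (fun x => (w x)%:E).
Proof.
have [_ ext L2 _] := Hw.
have i1 : (mu_ N).-integrable setT (fun x => (mu1 x)%:E).
  by apply: ge0_integrabler => //; rewrite integral_mu1 ltry.
have i2 : (mu_ N).-integrable setT (fun x => (w x ^+ 2)%:E).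
  by apply: ge0_integrabler => [|x|//]; [exact: measurable_funX|exact: sqr_ge0].
apply: (le_integrable measurableT _ _ (integrableD measurableT i1 i2)).
  exact/measurable_EFinP.
move=> x _; suff h : `|w x| <= mu1 x + w x ^+ 2.
  by rewrite /= lee_fin (le_trans h)// ler_norm.
have [Ox|/ext wx0] := pselect (Om x); last by rewrite wx0 normr0 expr0n addr_ge0 ?sqr_ge0.
rewrite /mu1 indicE mem_set//= -[w x ^+ 2]real_normK ?num_real//.
by have := sqr_ge0 (`|w x| - 1 / 2); rewrite sqrrB; set t := `|w x|; nra.
Qed.

Let G (x y : 'rV[R]_N) := (v x - v y) * (w x - w y) * kern s (x - y).

Let mG : measurable_fun setT (fun z : 'rV[R]_N * 'rV[R]_N => G z.1 z.2).
Proof.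
apply: measurable_funM; last by apply: measurable_comp_rV; [exact: measurable_kern|meas].
by apply: measurable_funM; apply: measurable_funB; apply: measurable_comp_rV => //; meas.
Qed.

Lemma integrable_energy : (mu_ N \x mu_ N)%E.-integrable setT
  (fun z : 'rV[R]_N * 'rV[R]_N => ((v z.1 - v z.2) * (w z.1 - w z.2) * kern s (z.1 - z.2))%:E).
Proof.
have g2 (u : 'rV[R]_N -> R) : measurable_fun setT u -> (gagliardo2 s u < +oo)%E ->
    (mu_ N \x mu_ N)%E.-integrable setT
    (fun z : 'rV[R]_N * 'rV[R]_N => ((u z.1 - u z.2) ^+ 2 * kern s (z.1 - z.2))%:E).
  move=> mu' gu; apply: ge0_integrabler => [|z|]; [exact: mgag| |exact: gu].
  by rewrite mulr_ge0 ?sqr_ge0 ?kern_ge0.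
have [_ _ _ gw] := Hw.
have iD := integrableD measurableT (g2 _ mv gagliardo2_lty) (g2 _ mw gw).
apply: (le_integrable measurableT _ _ iD).
  exact/measurable_EFinP.
move=> z _; rewrite /= lee_fin; set a := v _ - v _; set b := w _ - w _; set k := kern _ _.
have k0 : 0 <= k by exact: kern_ge0.
rewrite [leRHS]ger0_norm; last by apply: addr_ge0; apply: mulr_ge0 => //; exact: sqr_ge0.
rewrite !normrM (ger0_norm k0) -mulrDl ler_wpM2r//.
rewrite -[a ^+ 2]real_normK ?num_real// -[b ^+ 2]real_normK ?num_real//.
have := sqr_ge0 (`|a| - `|b|); have := sqr_ge0 (`|a| + `|b|); rewrite sqrrB sqrrD; lra.
Qed.

(** The substitution $y=x+z$ followed, for each fixed $z$, by a translation of
    the terms containing $w(x+z)$ collects the second difference of $v$. *)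
Lemma energy_formE : energy_form s v w = \int[mu_ N]_x (fracLap s v x * w x).
Proof.
pose H (x z : 'rV[R]_N) := G x (z + x).
have mH : measurable_fun setT (fun z : 'rV[R]_N * 'rV[R]_N => H z.1 z.2).
  apply: (@measurableT_comp _ _ _ _ _ _ (fun z : 'rV[R]_N * 'rV[R]_N => G z.1 z.2) _
     (fun z : 'rV[R]_N * 'rV[R]_N => (z.1, z.2 + z.1)) mG).
  by apply: measurable_fun_pair => /=; meas.
have mGx x : measurable_fun setT (G x).
  apply: measurable_funM; last by apply: measurable_comp_rV; [exact: measurable_kern|meas].
  by apply: measurable_funM; apply: measurable_funB => //; exact: measurable_cst.
have E1 : (\int[mu_ N \x mu_ N]_z (G z.1 z.2)%:E = \int[mu_ N]_x \int[mu_ N]_z (H x z)%:E)%E.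
  rewrite -(integral12_prod_meas1 integrable_energy); apply: eq_integral => x _.
  have mGE : measurable_fun setT (fun y => (G x y)%:E) by apply/measurable_EFinP; exact: mGx.
  symmetry; exact: (integral_shift_rV x mGE).
have iH : (mu_ N \x mu_ N)%E.-integrable setT (fun z : 'rV[R]_N * 'rV[R]_N => (H z.1 z.2)%:E).
  apply/integrable12ltyP; first by apply/measurable_EFinP; exact: mH.
  have /integrable12ltyP := integrable_energy; move=> /(_ _).
  have h : measurable_fun setT (fun z : 'rV[R]_N * 'rV[R]_N => (G z.1 z.2)%:E).
    by apply/measurable_EFinP; exact: mG.
  move/(_ h); apply: le_lt_trans; apply: ge0_le_integral.
  - exact: measurableT.
  - by move=> x _; exact: integral_ge0.
  - apply: (measurable_integral_snd (mu_ N) (f := fun z => `|(H z.1 z.2)%:E|%E)).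
    by apply/measurable_EFinP; apply: measurable_normr_comp; exact: mH.
  - apply: (measurable_integral_snd (mu_ N) (f := fun z => `|(G z.1 z.2)%:E|%E)).
    by apply/measurable_EFinP; apply: measurable_normr_comp; exact: mG.
  move=> x _.
  have mGE : measurable_fun setT (fun y => `|(G x y)%:E|%E).
    by apply/measurable_EFinP; apply: measurable_normr_comp; exact: mGx.
  by rewrite le_eqVlt; apply/orP; left; apply/eqP; exact: (integral_shift_rV x mGE).
have iw := H0s_integrable.
pose P (x z : 'rV[R]_N) := w x * (sdiff v x z * kern s z).
have mP : measurable_fun setT (fun z : 'rV[R]_N * 'rV[R]_N => P z.1 z.2).
  apply: measurable_funM; first by apply: measurable_comp_rV => //; meas.
  apply: measurable_funM; first by apply: measurable_sdiff => //; meas.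
  by apply: measurable_comp_rV; [exact: measurable_kern|meas].
have bdint (k : 'rV[R]_N -> R) K : measurable_fun setT k -> (forall x, `|k x| <= K) ->
    (mu_ N).-integrable setT (fun x => (w x * k x)%:E).
  move=> mk kK; have K0 : 0 <= K by exact: le_trans (normr_ge0 _) (kK 0).
  apply: (le_integrable measurableT _ _ (integrableZl measurableT K iw)).
    by apply/measurable_EFinP; exact: measurable_funM.
  by move=> x _; rewrite /= lee_fin !normrM mulrC (ger0_norm K0) ler_wpM2r.
have [_ _ bd _ _] := rv.
have E2 (z : 'rV[R]_N) : (\int[mu_ N]_x (H x z)%:E = \int[mu_ N]_x (P x z)%:E)%E.
  pose A (x : 'rV[R]_N) := w x * ((v x - v (z + x)) * kern s z).
  pose B (x : 'rV[R]_N) := w x * ((v (x - z) - v x) * kern s z).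
  have bdd a b : `|(v a - v b) * kern s z| <= 2 * C * kern s z.
    rewrite normrM (ger0_norm (kern_ge0 _ _)) ler_wpM2r ?kern_ge0//.
    by rewrite (le_trans (ler_normB _ _))//; have := bd a; have := bd b; lra.
  have mvz : measurable_fun setT (fun x => v (z + x)) by apply: measurable_comp_rV => //; meas.
  have mvz' : measurable_fun setT (fun x : 'rV[R]_N => v (x - z)) by apply: measurable_comp_rV => //; meas.
  have iA : (mu_ N).-integrable setT (fun x => (A x)%:E).
    apply: (bdint (fun x : 'rV[R]_N => (v x - v (z + x)) * kern s z) (2 * C * kern s z)) => //.
    by apply: measurable_funM => //; exact: measurable_funB.
  have iB : (mu_ N).-integrable setT (fun x => (B x)%:E).
    apply: (bdint (fun x : 'rV[R]_N => (v (x - z) - v x) * kern s z) (2 * C * kern s z)) => //.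
    by apply: measurable_funM => //; exact: measurable_funB.
  have mB : measurable_fun setT (fun x => (B x)%:E) by case/integrableP: iB.
  have EB : (\int[mu_ N]_x (B (x + z)%R)%:E = \int[mu_ N]_x (B x)%:E)%E.
    exact: (integral_shift_rV z mB).
  have iB' : (mu_ N).-integrable setT (fun x : 'rV[R]_N => (B (x + z)%R)%:E).
    have mB' : measurable_fun setT (fun x : 'rV[R]_N => (B (x + z)%R)%:E).
      by apply: (measurableT_comp mB); meas.
    apply/integrableP; split => //.
    rewrite (integral_shift_rV z (f := fun x : 'rV[R]_N => `|(B x)%:E|%E)); last exact: measurableT_comp.
    by case/integrableP: iB.
  transitivity (\int[mu_ N]_x ((A x)%:E - (B (x + z)%R)%:E))%E.
    apply: eq_integral => x _; rewrite -EFinB; congr EFin.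
    by rewrite /H /G /A /B addrK (addrC x z) opprD addrCA subrr addr0 kernN; ring.
  rewrite integralB// EB -integralB//; apply: eq_integral => x _.
  by rewrite -EFinB /A /B /P /sdiff (addrC x z); congr EFin; ring.
have iP : (mu_ N \x mu_ N)%E.-integrable setT (fun z : 'rV[R]_N * 'rV[R]_N => (P z.1 z.2)%:E).
  apply/integrable12ltyP; first by apply/measurable_EFinP; exact: mP.
  have mnw : measurable_fun setT (fun x => `|w x|) by exact: measurable_normr_comp.
  apply: (@le_lt_trans _ _ (\int[mu_ N]_x (4 * C * ktotal N s * `|w x|)%:E)%E).
    apply: ge0_le_integral.
    - exact: measurableT.
    - by move=> x _; exact: integral_ge0.
    - apply: (measurable_integral_snd (mu_ N) (f := fun z => `|(P z.1 z.2)%:E|%E)).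
      by apply/measurable_EFinP; apply: measurable_normr_comp; exact: mP.
    - by apply/measurable_EFinP; apply: measurable_funM => //; exact: measurable_cst.
    move=> x _ /=; apply: (@le_trans _ _ (\int[mu_ N]_z (`|w x| * (4 * C) * kmass s z)%:E)%E).
      apply: ge0_le_integralr => [|z||z].
      - have m := @measurable_sdiff_kern _ _ s _ _ rv x.
        apply: measurable_normr_comp; exact: (measurable_funM (measurable_cst (w x)) m).
      - exact: normr_ge0.
      - by apply: measurable_funM => //; exact: measurable_kmass.
      - by rewrite normrM -mulrA ler_wpM2l//; exact: (sdiff_kern_bound s01 rv).
    rewrite ge0_integralrZ; [|exact: measurable_kmass|exact: kmass_ge0|]; last first.
      by rewrite mulr_ge0// mulr_ge0.
    by rewrite (integral_kmass N0 s01) -EFinM lee_fin le_eqVlt; apply/orP; left; apply/eqP; ring.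
  have K0 : 0 <= 4 * C * ktotal N s by rewrite mulr_ge0 ?ktotal_ge0// mulr_ge0.
  rewrite ge0_integralrZ// lte_mul_pinfty ?lee_fin//.
  by case/integrableP: iw.
have E3 : (\int[mu_ N \x mu_ N]_z (G z.1 z.2)%:E = \int[mu_ N]_x (w x * symLap s v x)%:E)%E.
  rewrite E1 (Fubini iH); under eq_integral do rewrite E2.
  rewrite -(Fubini iP); apply: eq_integral => x _ /=.
  under eq_integral do rewrite EFinM.
  rewrite integralZl; [|exact: measurableT|exact: (integrable_sdiff_kern N0 s01 rv)].
  by rewrite (EFin_symLap N0 s01 rv) EFinM.
rewrite /energy_form [X in _ * X](_ : _ = \int[mu_ N]_x (w x * symLap s v x)); last first.
  by congr fine; exact: E3.
rewrite -RintegralZl//; last first.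
  apply: (bdint (symLap s v) (4 * C * ktotal N s)); [exact: (measurable_symLap s rv)|exact: (symLap_bound N0 s01 rv)].
by apply: eq_Rintegral => x _; rewrite (fracLap_regular N0 s01 rv); ring.
Qed.

End against_H0s.
End regular_function.
End energy.

(** * Integrals and functions with separated variables *)

Section separated.
Context {d1 d2 : measure_display} {T1 : measurableType d1} {T2 : measurableType d2} {R : realType}.
Variables (m1 : {sigma_finite_measure set T1 -> \bar R}) (m2 : {sigma_finite_measure set T2 -> \bar R}).
Variables (D1 : set T1) (D2 : set T2) (a : T1 -> R) (b : T2 -> R).
Hypotheses (mD1 : measurable D1) (mD2 : measurable D2).
Hypotheses (ia : m1.-integrable D1 (EFin \o a)) (ib : m2.-integrable D2 (EFin \o b)).

Let a' := a \_ D1.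
Let b' := b \_ D2.
Let ia' : m1.-integrable setT (EFin \o a').
Proof. by rewrite /a' -restrict_EFin -integrable_mkcond. Qed.
Let ib' : m2.-integrable setT (EFin \o b').
Proof. by rewrite /b' -restrict_EFin -integrable_mkcond. Qed.
Let ma' : measurable_fun setT a'. Proof. by apply/measurable_EFinP; case/integrableP: ia'. Qed.
Let mb' : measurable_fun setT b'. Proof. by apply/measurable_EFinP; case/integrableP: ib'. Qed.
Let g (z : T1 * T2) := a' z.1 * b' z.2.
Let mg : measurable_fun setT g.
Proof.
apply: measurable_funM.
- exact: (measurableT_comp ma' measurable_fst).
- exact: (measurableT_comp mb' measurable_snd).
Qed.

Let restrictE : (fun z : T1 * T2 => a z.1 * b z.2) \_ (D1 `*` D2) = g.
Proof.
apply/funext => -[x t]; rewrite /g /a' /b' /patch /=.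
have [xD|xD] := boolP (x \in D1); last first.
  by rewrite mul0r ifF//; apply/negP; rewrite inE => -[/= h _]; move: xD; rewrite (mem_set h).
have [tD|tD] := boolP (t \in D2); last first.
  by rewrite mulr0 ifF//; apply/negP; rewrite inE => -[/= _ h]; move: tD; rewrite (mem_set h).
by rewrite ifT// inE; split => /=; rewrite -inE.
Qed.

Let ig : (m1 \x m2)%E.-integrable setT (EFin \o g).
Proof.
apply/integrable12ltyP; first by apply/measurable_EFinP.
have [_ fa] := integrableP _ _ _ ia'; have [_ fb] := integrableP _ _ _ ib'.
have nm (d : measure_display) (X : measurableType d) (f : X -> R) :
    measurable_fun setT f -> measurable_fun setT (fun x => `|f x|).
  by move=> mf; apply: (measurableT_comp (@normr_measurable R setT)).
pose B := fine (\int[m2]_t (`|b' t|)%:E)%E.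
have BE : (\int[m2]_t (`|b' t|)%:E = B%:E)%E.
  by rewrite fineK// ge0_fin_numE//; exact: integral_ge0.
have B0 : 0 <= B by apply: fine_ge0; exact: integral_ge0.
rewrite (_ : (\int[m1]_x _)%E = (\int[m1]_x (B * `|a' x|)%:E)%E); last first.
  apply: eq_integral => x _.
  transitivity (\int[m2]_t (`|a' x| * `|b' t|)%:E)%E.
    by apply: eq_integral => t _; rewrite /= normrM.
  by rewrite ge0_integralrZ ?BE -?EFinM 1?mulrC//; exact: nm.
rewrite ge0_integralrZ//; last exact: nm.
by rewrite lte_mul_pinfty ?lee_fin.
Qed.

Lemma integrable_separated : (m1 \x m2)%E.-integrable (D1 `*` D2)
  (fun z : T1 * T2 => (a z.1 * b z.2)%:E).
Proof.
have mD : measurable (D1 `*` D2) by exact: measurableX.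
have := ig; rewrite -restrictE -restrict_EFin -integrable_mkcond//.
Qed.

Lemma Rintegral_separated :
  \int[(m1 \x m2)%E]_(z in D1 `*` D2) (a z.1 * b z.2)
    = (\int[m1]_(x in D1) a x) * (\int[m2]_(t in D2) b t).
Proof.
rewrite Rintegral_mkcond restrictE [in RHS]Rintegral_mkcond [X in _ * X]Rintegral_mkcond.
rewrite -/a' -/b' /Rintegral -(integral12_prod_meas1 ig).
have fb := integrable_fin_num measurableT ib'.
have fa := integrable_fin_num measurableT ia'.
rewrite -fineM//; congr fine.
rewrite -[X in (_ * X)%E]fineK// -integralZr//.
apply: eq_integral => x _; rewrite /fubini_F /= fineK//.
transitivity (\int[m2]_t ((a' x)%:E * (b' t)%:E))%E; first by apply: eq_integral.
by rewrite integralZl.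
Qed.

End separated.

Section time_factor.
Context {R : realType}.
Variables (T : R).

Lemma is_derive_time (n : nat) (t : R) :
  is_derive t 1 (fun t : R => (T - t) ^+ n.+1) (- (n.+1%:R * (T - t) ^+ n)).
Proof.
have d1 : is_derive t 1 (fun t : R => T - t) (- 1).
  have := @is_deriveB _ _ _ (cst T) id t 1 0 1 _ _; rewrite sub0r; exact.
have d := @is_deriveX _ _ (fun t : R => T - t) n t 1 (-1) d1.
rewrite (_ : (fun t : R => _) = (fun t : R => T - t) ^+ n.+1); last first.
  by apply/funext => x; rewrite exprfctE.
by apply: is_derive_eq; rewrite /GRing.scale/= mulrN1.
Qed.

Lemma continuous_time (n : nat) : continuous (fun t : R => (T - t) ^+ n).
Proof.
case: n => [|n] t; first exact: cvg_cst.
have d := is_derive_time n t.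
by apply/differentiable_continuous/derivable1_diffP; apply: ex_derive.
Qed.

Lemma integral_time (n : nat) (t1 t2 : R) : t1 <= t2 ->
  \int[@lebesgue_measure R]_(t in `]t1, t2[) (n.+1%:R * (T - t) ^+ n)
    = (T - t1) ^+ n.+1 - (T - t2) ^+ n.+1.
Proof.
rewrite le_eqVlt => /predU1P[->|t12].
  by rewrite set_itvoo0 Rintegral_set0 subrr.
have cf : continuous (fun t : R => n.+1%:R * (T - t) ^+ n).
  by move=> t; apply: cvgM; [exact: cvg_cst|exact: continuous_time].
have cF : continuous (fun t : R => - (T - t) ^+ n.+1).
  by move=> t; apply: cvgN; exact: continuous_time.
have dF (t : R) : is_derive t 1 (fun t : R => - (T - t) ^+ n.+1) (n.+1%:R * (T - t) ^+ n).
  by have := @is_deriveN _ _ _ _ t 1 _ (is_derive_time n t); rewrite opprK.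
have E := @continuous_FTC2 R (fun t : R => n.+1%:R * (T - t) ^+ n)
  (fun t : R => - (T - t) ^+ n.+1) t1 t2 t12.
transitivity (fine ((- (T - t2) ^+ n.+1)%:E - (- (T - t1) ^+ n.+1)%:E)%E); last first.
  by rewrite -EFinB /= opprK addrC.
congr fine.
rewrite -(@integral_itv_bndoo R t1 t2 (fun t : R => (n.+1%:R * (T - t) ^+ n)%:E) true false); last first.
  by apply: measurable_funTS; apply/measurable_EFinP; exact: continuous_measurable_fun.
apply: E.
- by apply: continuous_subspaceT => t; exact: cf.
- split.
  + by move=> t _; apply: ex_derive; exact: dF.
  + exact/cvg_at_right_filter/cF.
  + exact/cvg_at_left_filter/cF.
- by move=> t _; rewrite derive1E; apply: derive_val; exact: dF.
Qed.

Lemma time_le (n : nat) (t : R) : 0 <= t <= T -> 0 <= (T - t) ^+ n <= T ^+ n.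
Proof.
by move=> /andP[t0 tT]; rewrite exprn_ge0 ?subr_ge0//= lerXn2r ?nnegrE ?subr_ge0//; lra.
Qed.

Lemma time_lipschitz (n : nat) : exists2 K, 0 <= K &
  forall t r : R, 0 <= t <= T -> 0 <= r <= T -> `|(T - t) ^+ n - (T - r) ^+ n| <= K * `|t - r|.
Proof.
elim: n => [|n [K K0 HK]].
  by exists 0 => // t r _ _; rewrite !expr0 subrr normr0 mul0r.
have [T0|T0] := ltP T 0.
  by exists 0 => // t r /andP[t0 tT]; move: (le_trans t0 tT); rewrite leNgt T0.
exists (T * K + T ^+ n); first by rewrite addr_ge0 ?mulr_ge0 ?exprn_ge0.
move=> t r t0T r0T; have h := HK _ _ t0T r0T.
rewrite !exprS (_ : _ - _ = (T - t) * ((T - t) ^+ n - (T - r) ^+ n) + (r - t) * (T - r) ^+ n);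
  last by ring.
rewrite (le_trans (ler_normD _ _))// !normrM mulrDl lerD//.
  rewrite -mulrA ler_pM// ger0_norm; move: t0T => /andP[? ?]; lra.
rewrite distrC mulrC ler_wpM2r// ger0_norm; by have /andP[] := time_le n r0T.
Qed.

End time_factor.

Section hoelder_product.
Context {R : realType}.

Lemma ler_powR_small (z b M : R) : 0 <= z <= M -> 0 < b <= 1 -> z <= (1 + M) * z `^ b.
Proof.
move=> /andP[z0 zM] /andP[b0 b1]; have M0 := le_trans z0 zM.
have [->|zn0] := eqVneq z 0; first by rewrite powR0 ?mulr0// gt_eqF.
have zp : 0 < z by rewrite lt_neqAle eq_sym zn0.
have e : z = z `^ (1 - b) * z `^ b.
  by rewrite -powRD ?subrK ?powRr1// zn0 implybT.
rewrite {1}e ler_wpM2r ?powR_ge0//.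
have [z1|z1] := leP z 1.
  by rewrite (@le_trans _ _ 1)//; [rewrite -[leRHS](powRr0 z) ger_powR ?zp ?subr_ge0|rewrite lerDl].
rewrite (@le_trans _ _ z)//; last lra.
rewrite -{2}(powRr1 z0) ler_powR//; [exact: ltW|lra].
Qed.

Lemma hoelder_product (p q v w P K V H X Y : R) :
  `|q| <= P -> `|v| <= V -> `|p - q| <= K * Y -> `|v - w| <= H * X ->
  0 <= X -> 0 <= Y -> 0 <= K -> 0 <= H -> `|p * v - q * w| <= (V * K + P * H) * (X + Y).
Proof.
move=> qP vV pq vw X0 Y0 K0 H0.
have P0 := le_trans (normr_ge0 _) qP; have V0 := le_trans (normr_ge0 _) vV.
rewrite (_ : _ - _ = v * (p - q) + q * (v - w)); last by ring.
rewrite (le_trans (ler_normD _ _))// !normrM mulrDl; apply: lerD.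
  apply: le_trans (ler_pM _ _ vV pq) _ => //.
  by rewrite mulrA ler_wpM2l ?mulr_ge0 ?lerDr.
apply: le_trans (ler_pM _ _ qP vw) _ => //.
by rewrite mulrA ler_wpM2l ?mulr_ge0 ?lerDl.
Qed.

End hoelder_product.

Section scaling.
Context {R : realType}.
Notation mu_ n := (lebesgue_rV R n).
Variables (N : nat) (s : R).
Hypotheses (N0 : (0 < N)%N) (s01 : 0 < s < 1).
Variables (v : 'rV[R]_N -> R) (C : R).
Hypothesis rv : regular v C.

Lemma regularZ c : regular (fun x => c * v x) (`|c| * C).
Proof.
have [mv C0 bd lip sd] := rv; split.
- by apply: measurable_funM => //; exact: measurable_cst.
- by rewrite mulr_ge0.
- by move=> x; rewrite normrM ler_wpM2l.
- by move=> x y; rewrite -mulrBr normrM -mulrA ler_wpM2l.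
- move=> x y; rewrite (_ : sdiff _ x y = c * sdiff v x y); last by rewrite /sdiff; ring.
  by rewrite normrM -mulrA ler_wpM2l.
Qed.

Lemma fracLapZ c x : fracLap s (fun x => c * v x) x = c * fracLap s v x.
Proof.
rewrite (fracLap_regular N0 s01 (regularZ c)) (fracLap_regular N0 s01 rv) mulrCA; congr (_ * _).
rewrite /symLap -RintegralZl//; last exact: (integrable_sdiff_kern N0 s01 rv).
by apply: eq_Rintegral => y _; rewrite /sdiff; ring.
Qed.

Lemma gagliardo2Z c : gagliardo2 s (fun x => c * v x) = ((c ^+ 2)%:E * gagliardo2 s v)%E.
Proof.
have [mv _ _ _ _] := rv.
rewrite /gagliardo2 -ge0_integralZl//.
- by apply: eq_integral => z _; rewrite -EFinM -mulrBr exprMn -!mulrA.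
- apply/measurable_EFinP; apply: measurable_funM.
    by apply: measurable_funX; apply: measurable_funB; apply: measurable_comp_rV => //; meas.
  change (measurable_fun setT (fun z : 'rV[R]_N * 'rV[R]_N => kern s (z.1 - z.2))).
  by apply: measurable_comp_rV; [exact: measurable_kern|meas].
- by move=> z _; rewrite lee_fin mulr_ge0 ?sqr_ge0 ?invr_ge0 ?powR_ge0.
- by rewrite lee_fin sqr_ge0.
Qed.

End scaling.

(** * Separated test functions *)

Section separated_test_function.
Context {R : realType}.
Notation mu_ n := (lebesgue_rV R n).
Variables (N : nat) (s : R) (Om : set 'rV[R]_N) (T : R) (n : nat).
Hypotheses (N0 : (0 < N)%N) (s01 : 0 < s < 1) (oOm : open Om) (bOm : bounded_set Om).
Hypothesis T0 : 0 < T.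
Variables (v : 'rV[R]_N -> R) (C : R).
Hypotheses (rv : regular v C) (v_ext : forall x, ~ Om x -> v x = 0).

Let mOm : measurable Om. Proof. exact: open_measurable_rV. Qed.
Let mv : measurable_fun setT v. Proof. by case: rv. Qed.
Let C0 : 0 <= C. Proof. by case: rv. Qed.
Let bv x : `|v x| <= C. Proof. by case: rv. Qed.

Definition test_fun (x : 'rV[R]_N) (t : R) : R := (T - t) ^+ n.+1 * v x.

Definition test_source (x : 'rV[R]_N) (t : R) : R :=
  n.+1%:R * (T - t) ^+ n * v x + (T - t) ^+ n.+1 * fracLap s v x.

Lemma derive_test_fun (x : 'rV[R]_N) (t : R) :
  is_derive t 1 (test_fun x) (- (n.+1%:R * (T - t) ^+ n) * v x).
Proof.
have d := is_derive_time T n t.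
have h := @is_deriveZ _ _ _ _ (v x) t 1 _ d.
rewrite (_ : test_fun x = v x *: (fun t : R => (T - t) ^+ n.+1)); last first.
  by apply/funext => r; rewrite /test_fun mulrC.
by apply: is_derive_eq; rewrite /GRing.scale/= mulrC.
Qed.

Lemma fracLap_test_fun x t : fracLap s (test_fun ^~ t) x = (T - t) ^+ n.+1 * fracLap s v x.
Proof. exact: (fracLapZ N0 s01 rv). Qed.

Let time_norm_le m (t : R) : 0 <= t <= T -> `|(T - t) ^+ m| <= T ^+ m.
Proof. by move=> /(time_le m)/andP[a b]; rewrite ger0_norm. Qed.

Let M := `|fracLap_const N s / 2 : R| * (4 * C * ktotal N s).
Let H := `|fracLap_const N s / 2 : R| * (8 * C * ktotal N s).

Lemma fracLap_bound x : `|fracLap s v x| <= M.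
Proof.
by rewrite (fracLap_regular N0 s01 rv) normrM ler_wpM2l// (symLap_bound N0 s01 rv).
Qed.

Let fracLap_hoelder x y : `|fracLap s v x - fracLap s v y| <= H * enorm (x - y) `^ ((1 - s) / 2).
Proof.
rewrite !(fracLap_regular N0 s01 rv) -mulrBr normrM /H -mulrA ler_wpM2l//.
by rewrite (le_trans (symLap_hoelder N0 s01 rv x y))// le_eqVlt; apply/orP; left; apply/eqP; ring.
Qed.

Let v_hoelder x y : `|v x - v y| <= 2 * C * enorm (x - y) `^ ((1 - s) / 2).
Proof.
have [_ _ _ lip _] := rv; have z0 := enorm_ge0 (x - y); set z := enorm _ in z0 *.
have [z1|z1] := leP z 1.
  apply: (le_trans (lip x y)); rewrite -/z (mulrC 2) -mulrA ler_wpM2l//.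
  have [->|zn] := eqVneq z 0; first by rewrite mulr_ge0 ?powR_ge0.
  have zp : 0 < z by rewrite lt_neqAle eq_sym zn.
  apply: (@le_trans _ _ (z `^ ((1 - s) / 2))); last by have := powR_ge0 z ((1 - s) / 2); lra.
  rewrite -{1}(powRr1 z0) ger_powR ?zp//; move: s01; lra.
apply: (@le_trans _ _ (2 * C)).
  by rewrite (le_trans (ler_normB _ _))//; have := bv x; have := bv y; lra.
rewrite ler_peMr ?mulr_ge0// -[leLHS](powRr0 z) ler_powR ?(ltW z1)//; move: s01; lra.
Qed.

Lemma test_source_hoelder : bounded_hoelder Om T test_source.
Proof.
have ktot0 := @ktotal_ge0 R N s.
have M0 : 0 <= M by rewrite mulr_ge0 ?mulr_ge0.
have H0 : 0 <= H by rewrite mulr_ge0 ?mulr_ge0.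
split.
  exists (n.+1%:R * T ^+ n * C + T ^+ n.+1 * M) => x t _ /andP[/ltW t0 /ltW tT].
  have t0T : 0 <= t <= T by rewrite t0.
  rewrite (le_trans (ler_normD _ _))// !normrM lerD//.
    apply: ler_pM (bv x); [exact: mulr_ge0|exact: normr_ge0|].
    by rewrite (ger0_norm (ler0n _ _)) ler_wpM2l// time_norm_le.
  by apply: ler_pM (fracLap_bound x); [exact: normr_ge0|exact: normr_ge0|exact: time_norm_le].
have [K1 K10 HK1] := time_lipschitz T n.
have [K2 K20 HK2] := time_lipschitz T n.+1.
pose B := n.+1%:R * (C * (K1 * (1 + T)) + T ^+ n * (2 * C)).
pose B' := M * (K2 * (1 + T)) + T ^+ n.+1 * H.
exists ((1 - s) / 2), (1 / 2), (B + B'); split; [move: s01; lra|lra|].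
move=> x y t r _ _ /andP[/ltW t0 /ltW tT] /andP[/ltW r0 /ltW rT].
have t0T : 0 <= t <= T by rewrite t0.
have r0T : 0 <= r <= T by rewrite r0.
set X := enorm _ `^ _; set Y := `|t - r| `^ _.
have X0 : 0 <= X by exact: powR_ge0.
have Y0 : 0 <= Y by exact: powR_ge0.
have tr : `|t - r| <= (1 + T) * Y.
  apply: ler_powR_small; last lra.
  by rewrite normr_ge0 ler_norml; apply/andP; split; lra.
have P1 : `|(T - r) ^+ n| <= T ^+ n by exact: time_norm_le.
have P2 : `|(T - r) ^+ n.+1| <= T ^+ n.+1 by exact: time_norm_le.
have D1 : `|(T - t) ^+ n - (T - r) ^+ n| <= K1 * (1 + T) * Y.
  by rewrite (le_trans (HK1 _ _ t0T r0T))// -mulrA ler_wpM2l.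
have D2 : `|(T - t) ^+ n.+1 - (T - r) ^+ n.+1| <= K2 * (1 + T) * Y.
  by rewrite (le_trans (HK2 _ _ t0T r0T))// -mulrA ler_wpM2l.
have T10 : 0 <= 1 + T by lra.
have E1 := hoelder_product P1 (bv x) D1 (v_hoelder x y) X0 Y0
  (mulr_ge0 K10 T10) (mulr_ge0 (ler0n _ 2) C0).
have E2 := hoelder_product P2 (fracLap_bound x) D2 (fracLap_hoelder x y) X0 Y0
  (mulr_ge0 K20 T10) H0.
rewrite (_ : test_source x t - test_source y r =
  n.+1%:R * ((T - t) ^+ n * v x - (T - r) ^+ n * v y) +
  ((T - t) ^+ n.+1 * fracLap s v x - (T - r) ^+ n.+1 * fracLap s v y));
  last first.
  rewrite /test_source; move: (fracLap s v x) (fracLap s v y) ((T - t) ^+ n.+1) ((T - r) ^+ n.+1).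
  by move: ((T - t) ^+ n) ((T - r) ^+ n) (v x) (v y) => *; ring.
rewrite (le_trans (ler_normD _ _))// mulrDl lerD// normrM ger0_norm ?ler0n//.
by rewrite /B -mulrA ler_wpM2l.
Qed.

Section against_H0s.
Variables (w : 'rV[R]_N -> R) (Hw : H0s s Om w).
Let w_ext x : ~ Om x -> w x = 0. Proof. by case: Hw => _ h _ _; exact: h. Qed.

Let iw (k : 'rV[R]_N -> R) K : measurable_fun setT k -> (forall x, `|k x| <= K) ->
  (mu_ N).-integrable setT (fun x => (k x * w x)%:E).
Proof.
move=> mk kK; have K0 : 0 <= K by exact: le_trans (normr_ge0 _) (kK 0).
have i1 := H0s_integrable oOm bOm Hw.
have mw : measurable_fun setT w by case: Hw.
apply: (le_integrable measurableT _ _ (integrableZl measurableT K i1)).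
  by apply/measurable_EFinP; exact: measurable_funM.
by move=> x _; rewrite /= lee_fin !normrM (ger0_norm K0) ler_wpM2r.
Qed.

Let mfL : measurable_fun setT (fracLap s v).
Proof.
rewrite (_ : fracLap s v = fun x => fracLap_const N s / 2 * symLap s v x).
  by apply: measurable_funM; [exact: measurable_cst|exact: (measurable_symLap s rv)].
by apply/funext => x; rewrite (fracLap_regular N0 s01 rv).
Qed.

Let ivw : (mu_ N).-integrable Om (fun x => (v x * w x)%:E).
Proof. by apply: (@integrableS _ _ _ _ setT) => //; exact: (iw mv bv). Qed.
Let iLw : (mu_ N).-integrable Om (fun x => (fracLap s v x * w x)%:E).
Proof. by apply: (@integrableS _ _ _ _ setT) => //; exact: (iw mfL fracLap_bound). Qed.

Let energy_test_fun t : energy_form s (test_fun ^~ t) w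
  = (T - t) ^+ n.+1 * \int[mu_ N]_(x in Om) (fracLap s v x * w x).
Proof.
have rt := regularZ rv ((T - t) ^+ n.+1).
have et x : ~ Om x -> (T - t) ^+ n.+1 * v x = 0 by move=> /v_ext ->; rewrite mulr0.
rewrite (energy_formE N0 s01 oOm bOm rt et Hw) -RintegralZl//.
rewrite [RHS]Rintegral_mkcond; apply: eq_Rintegral => x _.
rewrite (fracLapZ N0 s01 rv) patchE; case: ifPn => [_|]; first by rewrite mulrA.
by rewrite notin_setE => /w_ext ->; rewrite mulr0.
Qed.

Let itime (m : nat) (c t1 t2 : R) : (@lebesgue_measure R).-integrable `]t1, t2[
  (fun t => (c * (T - t) ^+ m)%:E).
Proof.
have i : (@lebesgue_measure R).-integrable `[t1, t2] (EFin \o (fun t : R => c * (T - t) ^+ m)).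
  apply: continuous_compact_integrable; first exact: segment_compact.
  apply: continuous_subspaceT => t; apply: cvgM; [exact: cvg_cst|exact: continuous_time].
apply: (integrableS _ _ _ i); [exact: measurable_itv|exact: measurable_itv|].
exact: subset_itv_oo_cc.
Qed.

Lemma test_fun_energy_identity (t1 t2 : R) : t1 <= t2 ->
  \int[mu_ N]_(x in Om) (test_fun x t1 * w x) - \int[mu_ N]_(x in Om) (test_fun x t2 * w x)
  + \int[@lebesgue_measure R]_(t in `]t1, t2[) energy_form s (test_fun ^~ t) w
  = \int[lebesgue_xt R N]_(z in Om `*` `]t1, t2[) (test_source z.1 z.2 * w z.1).
Proof.
move=> t12.
have A t : \int[mu_ N]_(x in Om) (test_fun x t * w x)
    = (T - t) ^+ n.+1 * \int[mu_ N]_(x in Om) (v x * w x).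
  by rewrite -RintegralZl//; apply: eq_Rintegral => x _; rewrite mulrA.
rewrite !A.
have i1 : (@lebesgue_measure R).-integrable `]t1, t2[ (EFin \o (fun t : R => n.+1%:R * (T - t) ^+ n)).
  exact: itime.
have i2 : (@lebesgue_measure R).-integrable `]t1, t2[ (EFin \o (fun t : R => (T - t) ^+ n.+1)).
  have := itime n.+1 1 t1 t2; congr (_.-integrable _ _).
  by apply/funext => t /=; rewrite mul1r.
have mI : measurable (`]t1, t2[%classic : set (measurableTypeR R)) by exact: measurable_itv.
have j1 := @integrable_separated _ _ _ (measurableTypeR R) R (mu_ N) (@lebesgue_measure R)
  Om _ _ _ mOm mI ivw i1.
have j2 := @integrable_separated _ _ _ (measurableTypeR R) R (mu_ N) (@lebesgue_measure R)
  Om _ _ _ mOm mI iLw i2.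
transitivity (\int[lebesgue_xt R N]_(z in Om `*` `]t1, t2[)
   ((v z.1 * w z.1) * (n.+1%:R * (T - z.2) ^+ n)
    + (fracLap s v z.1 * w z.1) * (T - z.2) ^+ n.+1)); last first.
  apply: eq_Rintegral => z _; rewrite /test_source.
  move: (fracLap s v z.1) (v z.1) (w z.1) ((T - z.2) ^+ n) ((T - z.2) ^+ n.+1) => *; ring.
rewrite (RintegralD (measurableX mOm mI) j1 j2).
rewrite (@Rintegral_separated _ _ _ (measurableTypeR R) R (mu_ N) (@lebesgue_measure R)
  Om _ _ _ mOm mI ivw i1).
rewrite (@Rintegral_separated _ _ _ (measurableTypeR R) R (mu_ N) (@lebesgue_measure R)
  Om _ _ _ mOm mI iLw i2).
rewrite (integral_time T n t12) -mulrBl (mulrC (_ - _)); congr (_ + _).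
rewrite mulrC -RintegralZr//; apply: eq_Rintegral => t _; exact: energy_test_fun.
Qed.

End against_H0s.

Lemma test_fun_solution : test_solution s Om T test_source test_fun.
Proof.
have mphi : measurable_fun setT (fun z : 'rV[R]_N * R => test_fun z.1 z.2).
  apply: measurable_funM; last by apply: measurable_comp_rV => //; meas.
  apply: (measurableT_comp (continuous_measurable_fun (@continuous_time R T n.+1))).
  exact: measurable_snd.
split.
- exact: measurable_funTS.
- exists (T ^+ n.+1 * C) => x t t0T; rewrite normrM ler_pM//.
  by exact: time_norm_le.
- by move=> x t /v_ext vx _; rewrite /test_fun vx mulr0.
- by move=> x _; rewrite /test_fun subrr expr0n mul0r.
- have g := gagliardo2_lty N0 s01 oOm bOm rv v_ext.
  have g0 : (0 <= gagliardo2 s v)%E.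
    by apply: integral_ge0 => z _; rewrite lee_fin mulr_ge0 ?sqr_ge0 ?invr_ge0 ?powR_ge0.
  have gE : gagliardo2 s v = (fine (gagliardo2 s v))%:E by rewrite fineK// ge0_fin_numE.
  have fg0 := fine_ge0 g0; set G := fine _ in gE fg0.
  apply: (@le_lt_trans _ _ (\int[@lebesgue_measure R]_(t in `]0%R, T[) ((T ^+ n.+1) ^+ 2 * G)%:E)%E).
    apply: ge0_le_integral.
    + exact: measurable_itv.
    + move=> t _; apply: integral_ge0 => z _.
      by rewrite lee_fin mulr_ge0 ?sqr_ge0 ?invr_ge0 ?powR_ge0.
    + apply: measurable_funTS.
      rewrite (_ : (fun t => _) = fun t : R => (((T - t) ^+ n.+1) ^+ 2 * G)%:E).
        apply/measurable_EFinP; apply: measurable_funM; last exact: measurable_cst.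
        by apply: measurable_funX; exact: (continuous_measurable_fun (@continuous_time R T n.+1)).
      by apply/funext => t; rewrite (gagliardo2Z s rv) gE -EFinM.
    + exact: measurable_cst.
    + move=> t; rewrite /= in_itv/= => /andP[/ltW t0 /ltW tT].
      rewrite (gagliardo2Z s rv) gE -EFinM lee_fin ler_wpM2r//.
      have t0T : 0 <= t <= T by rewrite t0.
      by have /andP[a0 aT] := time_le n.+1 t0T; rewrite lerXn2r ?nnegrE// exprn_ge0// ltW.
  have E := lebesgue_measure_itv `]0%R, T[; rewrite /= lte_fin T0 -EFinB in E.
  rewrite integral_cst; last exact: measurable_itv.
  by rewrite [X in (_ * X)%E]E -EFinM ltry.
- move=> t t0T.
  pose K := fine (\int[mu_ N]_(x in Om) (v x ^+ 2)%:E)%E.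
  have i2 : (mu_ N).-integrable Om (fun x => (v x ^+ 2)%:E).
    apply: (@le_integrable _ _ _ (mu_ N) _ mOm _ (cst (C ^+ 2)%:E)).
    + apply: measurable_funTS; apply/measurable_EFinP; exact: measurable_funX.
    + move=> x _; rewrite /= lee_fin !ger0_norm ?sqr_ge0//.
      by rewrite -[v x ^+ 2]real_normK ?num_real// ler_pXn2r ?nnegrE.
    + apply/integrableP; split; first exact: measurable_cst.
      rewrite /= integral_cst// lte_mul_pinfty// ?lee_fin//; exact: (bounded_set_finite oOm bOm).
  have KE : (\int[mu_ N]_(x in Om) (v x ^+ 2)%:E = K%:E)%E.
    by rewrite fineK//; exact: integrable_fin_num.
  have E r : (\int[mu_ N]_(x in Om) ((test_fun x r - test_fun x t) ^+ 2)%:E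
      = (((T - r) ^+ n.+1 - (T - t) ^+ n.+1) ^+ 2 * K)%:E)%E.
    rewrite EFinM -KE -integralZl//; apply: eq_integral => x _.
    by rewrite -EFinM /test_fun -mulrBl exprMn.
  under eq_cvg do rewrite E.
  apply: cvg_within_filter; apply: cvg_EFin; first exact: nearW.
  rewrite [X in _ --> X](_ : _ = ((T - t) ^+ n.+1 - (T - t) ^+ n.+1) ^+ 2 * K); last first.
    by rewrite subrr expr0n mul0r.
  apply: cvgM; last exact: cvg_cst.
  apply: (@cvg_comp _ _ _ (fun r : R => (T - r) ^+ n.+1 - (T - t) ^+ n.+1) (fun y => y ^+ 2)).
    by apply: cvgB; [exact: continuous_time|exact: cvg_cst].
  exact: exprn_continuous.
- by move=> w Hw t1 t2 _ t12 _; exact: test_fun_energy_identity.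
- move=> x t _ _; have d := derive_test_fun x t; split.
  + exact: ex_derive.
  + apply/cvg_ex; eexists; exact: (cvg_fracLap_trunc N0 s01 (regularZ rv ((T - t) ^+ n.+1)) (x := x)).
  + by rewrite derive1E (derive_val (is_derive := d)) fracLap_test_fun /test_source mulNr opprK.
Qed.

Lemma test_fun_class : test_class s Om T test_fun.
Proof. by exists test_source; [exact: test_source_hoelder|exact: test_fun_solution]. Qed.

End separated_test_function.

(** * A convex smoothing of the positive part *)

Section ramp.
Context {R : realType}.
Variable kap : R.
Hypothesis kap0 : 0 < kap.

(** The function $z_+^2/(z_++\kappa)$: unlike the positive part it has a
    Lipschitz derivative, and it differs from it by at most $\kappa$. *)
Definition ramp (z : R) : R := Num.max z 0 ^+ 2 / (Num.max z 0 + kap).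
Definition dramp (z : R) : R := 1 - kap ^+ 2 / (Num.max z 0 + kap) ^+ 2.

Lemma rampN z : z <= 0 -> ramp z = 0.
Proof. by move=> z0; rewrite /ramp max_r// expr0n mul0r. Qed.

Lemma drampN z : z <= 0 -> dramp z = 0.
Proof. by move=> z0; rewrite /dramp max_r// add0r divff ?subrr// expf_neq0// gt_eqF. Qed.

Lemma rampP z : 0 <= z -> ramp z = z ^+ 2 / (z + kap).
Proof. by move=> z0; rewrite /ramp max_l. Qed.

Lemma drampP z : 0 <= z -> dramp z = z * (z + 2 * kap) / (z + kap) ^+ 2.
Proof.
move=> z0; rewrite /dramp max_l//; have zk : z + kap != 0 by rewrite gt_eqF// ltr_wpDl.
by field.
Qed.

Lemma ramp_ge0 z : 0 <= ramp z.
Proof. by rewrite divr_ge0 ?sqr_ge0// addr_ge0 ?(ltW kap0)// le_max lexx orbT. Qed.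

Lemma dramp_ge0 z : 0 <= dramp z.
Proof.
have [z0|/ltW z0] := leP z 0; first by rewrite drampN.
by rewrite drampP// divr_ge0 ?sqr_ge0// mulr_ge0// addr_ge0// mulr_ge0// ltW.
Qed.

Lemma dramp_le1 z : dramp z <= 1.
Proof. by rewrite gerBl divr_ge0 ?sqr_ge0. Qed.

Lemma ramp_le_dramp z : ramp z <= dramp z * z.
Proof.
have [z0|/ltW z0] := leP z 0; first by rewrite rampN// drampN// mul0r.
rewrite rampP// drampP// -subr_ge0; have zk : 0 < z + kap by rewrite ltr_wpDl.
rewrite (_ : _ - _ = kap * z ^+ 2 / (z + kap) ^+ 2); last by have := lt0r_neq0 zk => ?; field.
by rewrite divr_ge0 ?sqr_ge0// mulr_ge0 ?sqr_ge0// ltW.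
Qed.

Lemma dramp_le_ramp z : dramp z * (z - kap) <= ramp z.
Proof.
have [z0|/ltW z0] := leP z 0; first by rewrite rampN// drampN// mul0r.
rewrite rampP// drampP// -subr_ge0; have zk : 0 < z + kap by rewrite ltr_wpDl.
rewrite (_ : _ - _ = 2 * kap ^+ 2 * z / (z + kap) ^+ 2); last by have := lt0r_neq0 zk => ?; field.
by rewrite divr_ge0 ?sqr_ge0// mulr_ge0// mulr_ge0 ?sqr_ge0.
Qed.

Lemma ramp_le z : 0 <= z -> ramp z <= z.
Proof.
by move=> z0; rewrite (le_trans (ramp_le_dramp z))// ler_piMl// dramp_le1.
Qed.

Lemma ramp_ge z w : 0 <= w <= z -> z * (w / (w + kap)) <= ramp z.
Proof.
move=> /andP[w0 wz]; have z0 := le_trans w0 wz; rewrite rampP// -subr_ge0.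
have zk : 0 < z + kap by rewrite ltr_wpDl.
have wk : 0 < w + kap by rewrite ltr_wpDl.
rewrite (_ : _ - _ = z * kap * (z - w) / ((z + kap) * (w + kap))); last first.
  by have := lt0r_neq0 zk; have := lt0r_neq0 wk => ? ?; field; apply/andP.
rewrite divr_ge0// ?mulr_ge0// ?subr_ge0// ltW//.
Qed.

(** The two-sided bound expresses at once that [ramp] is convex and that its
    derivative is Lipschitz. *)
Lemma ramp_taylor a b : 0 <= ramp b - ramp a - dramp a * (b - a) <= (b - a) ^+ 2 / kap.
Proof.
have kne := lt0r_neq0 kap0.
have [a0|/ltW a0] := leP a 0.
  rewrite (rampN a0) (drampN a0) mul0r !subr0 ramp_ge0/=.
  have [b0|/ltW b0] := leP b 0; first by rewrite rampN// divr_ge0 ?sqr_ge0// ltW.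
  rewrite rampP//; apply: ler_pM; rewrite ?sqr_ge0 ?invr_ge0 ?addr_ge0 ?(ltW kap0)//.
    by rewrite lerXn2r ?nnegrE// ?subr_ge0 ?(le_trans a0)//; lra.
  by rewrite lef_pV2 ?posrE// ?ltr_wpDl// lerDr.
have ak : 0 < a + kap by rewrite ltr_wpDl.
have akn := lt0r_neq0 ak.
have [b0|/ltW b0] := leP b 0.
  have h1 := ramp_le_dramp a; have h2 := dramp_ge0 a.
  rewrite (rampN b0) sub0r; apply/andP; split; first by nra.
  have D0 : 0 < (a + kap) ^+ 2 by rewrite exprn_gt0.
  have i1 : kap / (a + kap) ^+ 2 <= kap^-1.
    rewrite ler_pdivrMr// mulrC ler_pdivlMr// -expr2.
    by rewrite lerXn2r ?nnegrE ?(ltW kap0) ?(ltW ak) ?lerDr.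
  have i2 : (a + 2 * kap) / (a + kap) ^+ 2 <= 2 * kap^-1.
    have ak2 := mulr_ge0 a0 (ltW kap0); have a2 := sqr_ge0 a.
    by rewrite ler_pdivrMr// mulrAC ler_pdivlMr// sqrrD; lra.
  rewrite rampP// drampP// (_ : _ - _ = a ^+ 2 * (kap / (a + kap) ^+ 2)
    + a * - b * ((a + 2 * kap) / (a + kap) ^+ 2)); last by field.
  rewrite (_ : (b - a) ^+ 2 / kap = a ^+ 2 * kap^-1 + a * - b * (2 * kap^-1) + b ^+ 2 * kap^-1);
    last by ring.
  rewrite -[leLHS]addr0; apply: lerD; first apply: lerD.
  - by rewrite ler_wpM2l ?sqr_ge0.
  - by rewrite ler_wpM2l// mulr_ge0// oppr_ge0.
  - by rewrite mulr_ge0 ?sqr_ge0 ?invr_ge0 ?(ltW kap0).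
have bk : 0 < b + kap by rewrite ltr_wpDl.
have bkn := lt0r_neq0 bk.
rewrite !rampP// drampP//.
rewrite (_ : _ - _ - _ = (b - a) ^+ 2 * (kap ^+ 2 / ((b + kap) * (a + kap) ^+ 2))); last first.
  by field; apply/andP.
apply/andP; split.
  apply: mulr_ge0; first exact: sqr_ge0.
  by apply: divr_ge0; [exact: sqr_ge0|apply: mulr_ge0; [exact: ltW|exact: sqr_ge0]].
rewrite ler_wpM2l ?sqr_ge0// ler_pdivrMr ?mulr_gt0 ?exprn_gt0//.
have h : kap * kap ^+ 2 <= (b + kap) * (a + kap) ^+ 2.
  apply: ler_pM; [exact: ltW|exact: sqr_ge0|by rewrite lerDr|].
  by rewrite lerXn2r ?nnegrE ?(ltW kap0) ?(ltW ak) ?lerDr.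
by rewrite mulrC ler_pdivlMr// mulrC.
Qed.

Lemma ramp_lipschitz a b : `|ramp a - ramp b| <= `|a - b|.
Proof.
have /andP[h1 _] := ramp_taylor a b; have /andP[h2 _] := ramp_taylor b a.
have a0 := dramp_ge0 a; have a1 := dramp_le1 a; have b0 := dramp_ge0 b; have b1 := dramp_le1 b.
rewrite ler_norml; have [ab|ba] := leP b a.
  by rewrite ger0_norm ?subr_ge0//; apply/andP; split; nra.
by rewrite ltr0_norm ?subr_lt0//; apply/andP; split; nra.
Qed.

Lemma measurable_ramp : measurable_fun setT ramp.
Proof.
have mm : measurable_fun setT (fun z : R => Num.max z 0).
  by apply: measurable_maxr => //; exact: measurable_cst.
apply: measurable_funM; first exact: measurable_funX.
rewrite (_ : (fun z => _) = fun z : R => (Num.max z 0 + kap) `^ (-1)).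
  by apply: measurable_powR_comp; apply: measurable_funD => //; exact: measurable_cst.
by apply/funext => z; rewrite powR_inv1// addr_ge0 ?(ltW kap0)// le_max lexx orbT.
Qed.

End ramp.

(** * Regularity of the regularized powers *)

Section composition.
Context {R : realType}.
Variable N : nat.
Implicit Types v : 'rV[R]_N -> R.

(** A second difference of a composite is a second-order Taylor remainder of
    the outer function plus its derivative times a second difference. *)
Lemma regular_comp v L (D : set R) (G G' : R -> R) K :
  measurable_fun setT v -> 0 <= L -> (forall x, D (v x)) ->
  (forall x y, `|v x - v y| <= L * enorm (x - y)) ->
  (forall x y, `|sdiff v x y| <= L * edot y y) ->
  measurable_fun setT G -> 0 <= K -> (forall a, D a -> `|G a| <= K) ->
  (forall a, D a -> `|G' a| <= K) ->
  (forall a b, D a -> D b -> `|G a - G b| <= K * `|a - b|) ->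
  (forall a b, D a -> D b -> `|G b - G a - G' a * (b - a)| <= K * (b - a) ^+ 2) ->
  regular (fun x => G (v x)) (K * (1 + L + 2 * L ^+ 2)).
Proof.
move=> mv L0 Dv lip sd mG K0 bG bG' lG tG.
have L20 := sqr_ge0 L; have f1 : 1 <= 1 + L + 2 * L ^+ 2 by lra.
have KM z : z <= 1 + L + 2 * L ^+ 2 -> K * z <= K * (1 + L + 2 * L ^+ 2).
  by move=> h; rewrite ler_wpM2l.
split.
- exact: measurableT_comp.
- by rewrite mulr_ge0// (le_trans ler01).
- by move=> x; rewrite (le_trans (bG _ (Dv x)))// -{1}(mulr1 K) KM.
- move=> x y; rewrite (le_trans (lG _ _ (Dv x) (Dv y)))//.
  rewrite (@le_trans _ _ (K * (L * enorm (x - y))))// ?ler_wpM2l//.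
  by rewrite mulrA ler_wpM2r ?enorm_ge0// KM//; lra.
move=> x y; have e0 := edot_ge0 y.
have sq (z : 'rV[R]_N) : edot (z - x) (z - x) = edot y y ->
    `|G (v z) - G (v x) - G' (v x) * (v z - v x)| <= K * (L ^+ 2 * edot y y).
  move=> zy; rewrite (le_trans (tG _ _ (Dv x) (Dv z)))// ler_wpM2l// -zy -sqr_enorm -exprMn.
  by rewrite -[X in X <= _]real_normK ?num_real// lerXn2r ?nnegrE// mulr_ge0 ?enorm_ge0.
have h1 := sq (x + y); rewrite addrC addKr in h1.
have h2 := sq (x - y); rewrite addrAC subrr add0r edotNl edotNr opprK in h2.
rewrite /sdiff (_ : _ - _ - _ =
  - (G (v (x + y)) - G (v x) - G' (v x) * (v (x + y) - v x))
  - (G (v (x - y)) - G (v x) - G' (v x) * (v (x - y) - v x))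
  + G' (v x) * sdiff v x y); last by rewrite /sdiff; ring.
have h3 : `|G' (v x) * sdiff v x y| <= K * (L * edot y y).
  by rewrite normrM ler_pM// bG'.
have {}h1 := h1 erefl; have {}h2 := h2 erefl.
rewrite (le_trans (ler_normD _ _))// (le_trans (lerD (ler_normB _ _) h3))//.
rewrite normrN (le_trans (lerD (lerD h1 h2) (lexx _)))//; nra.
Qed.

Lemma regularD v1 v2 C1 C2 : regular v1 C1 -> regular v2 C2 ->
  regular (fun x => v1 x + v2 x) (C1 + C2).
Proof.
move=> [m1 C10 b1 l1 s1] [m2 C20 b2 l2 s2]; split.
- exact: measurable_funD.
- exact: addr_ge0.
- by move=> x; rewrite (le_trans (ler_normD _ _))// lerD.
- move=> x y; rewrite opprD addrACA (le_trans (ler_normD _ _))// mulrDl lerD//.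
- move=> x y; rewrite (_ : sdiff _ x y = sdiff v1 x y + sdiff v2 x y); last by rewrite /sdiff; ring.
  by rewrite (le_trans (ler_normD _ _))// mulrDl lerD.
Qed.

End composition.

Section radius.
Context {R : realType}.
Variables (N : nat) (c : R).
Hypothesis c0 : 0 < c.
Implicit Types x y : 'rV[R]_N.

(** The norm of $(x,\sqrt c)\in\mathbb R^{N+1}$. *)
Definition radius x : R := Num.sqrt (bracket c x).

Lemma sqr_radius x : radius x ^+ 2 = bracket c x.
Proof. by rewrite sqr_sqrtr// ltW// bracket_gt0. Qed.

Lemma radius_ge x : Num.sqrt c <= radius x.
Proof. by apply: ler_wsqrtr; exact: bracket_ge. Qed.

Lemma radius_gt0 x : 0 < radius x.
Proof. by rewrite sqrtr_gt0 bracket_gt0. Qed.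

Lemma radius_ge_enorm x : enorm x <= radius x.
Proof. by apply: ler_wsqrtr; rewrite lerDl ltW. Qed.

Lemma radius_powR x m : bracket c x `^ (- m) = radius x `^ (- (2 * m)).
Proof.
rewrite -sqr_radius -powR_mulrn ?(ltW (radius_gt0 _))// -powRrM; congr (_ `^ _); ring.
Qed.

Lemma measurable_bracket : measurable_fun setT (@bracket R N c).
Proof. by apply: measurable_funD; [exact: measurable_edot|exact: measurable_cst]. Qed.

Lemma measurable_radius : measurable_fun setT radius.
Proof.
rewrite (_ : radius = fun x => bracket c x `^ 2^-1); last first.
  by apply/funext => x; rewrite powR12_sqrt// ltW// bracket_gt0.
by apply: measurable_powR_comp; exact: measurable_bracket.
Qed.

Lemma radius_lipschitz x y : `|radius x - radius y| <= enorm (x - y).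
Proof.
have [rx ry] := (radius_gt0 x, radius_gt0 y).
have S : 0 < radius x + radius y by rewrite addr_gt0.
have E : (radius x - radius y) * (radius x + radius y) = (enorm x - enorm y) * (enorm x + enorm y).
  by rewrite -!subr_sqr !sqr_radius !sqr_enorm /bracket opprD addrACA subrr addr0.
have n1 : `|enorm x - enorm y| <= enorm (x - y).
  have t1 := ler_enormD (x - y) y; have t2 := ler_enormD (y - x) x; rewrite !subrK in t1 t2.
  rewrite -opprB enormN in t2; rewrite ler_norml; apply/andP; split; lra.
have := congr1 (fun z => `|z|) E; rewrite !normrM (gtr0_norm S).
rewrite (ger0_norm (addr_ge0 (enorm_ge0 x) (enorm_ge0 y))) => E'.
rewrite -(ler_pM2r S) E'; apply: ler_pM => //; first by rewrite addr_ge0 ?enorm_ge0.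
by rewrite lerD ?radius_ge_enorm.
Qed.

Lemma radius_sdiff x y : `|sdiff radius x y| <= edot y y / Num.sqrt c.
Proof.
have sc : 0 < Num.sqrt c by rewrite sqrtr_gt0.
have [r0 [rp rm]] := (radius_gt0 x, (radius_gt0 (x + y), radius_gt0 (x - y))).
have [q0 [qp qm]] := (sqr_radius x, (sqr_radius (x + y), sqr_radius (x - y))).
rewrite /sdiff; move: (radius_ge x).
rewrite {}/bracket edot_sqD edot_sqB in q0 qp qm *.
set a := radius x in r0 q0 *; set b := radius (x + y) in rp qp *; set d := radius (x - y) in rm qm *.
move=> ca.
have [e0 cs] := (edot_ge0 y, edot_le x y).
have exy : edot x y ^+ 2 <= edot x x * edot y y.
  rewrite -!sqr_enorm -exprMn -[leLHS]real_normK ?num_real//.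
  by rewrite lerXn2r ?nnegrE ?mulr_ge0 ?enorm_ge0// ler_norml; have := edot_le (- x) y; rewrite edotNl enormN; lra.
set Y := edot y y in e0 exy qp qm *; set X := edot x x in q0 exy qp qm *; set P := edot x y in exy qp qm cs *.
have bd0 : 0 < b * d by rewrite mulr_gt0.
have a2 : 0 < a ^+ 2 by rewrite exprn_gt0.
have up : 2 * a <= b + d.
  have h : (a ^+ 2 - Y) ^+ 2 <= (b * d) ^+ 2.
    rewrite exprMn qp qm q0; have : 0 <= c * Y by rewrite mulr_ge0// ltW.
    move: exy; clear; nra.
  have h' : a ^+ 2 - Y <= b * d.
    rewrite (le_trans (ler_norm _))// -(ger0_norm (ltW bd0)) -ler_sqr ?nnegrE//.
    by rewrite !real_normK ?num_real.
  rewrite -ler_sqr ?nnegrE ?addr_ge0 ?mulr_ge0 ?(ltW r0) ?(ltW rp) ?(ltW rm)//.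
  rewrite (_ : (2 * a) ^+ 2 = 4 * a ^+ 2); last by ring.
  rewrite (_ : (b + d) ^+ 2 = b ^+ 2 + d ^+ 2 + 2 * (b * d)); last by ring.
  by rewrite qp qm; move: h'; rewrite q0; lra.
have lo : b + d - 2 * a <= Y / Num.sqrt c.
  apply: (@le_trans _ _ (Y / a)); last by rewrite ler_wpM2l// lef_pV2 ?posrE.
  rewrite ler_pdivlMr//.
  have h : (b + d) ^+ 2 <= 4 * (a ^+ 2 + Y).
    by have := sqr_ge0 (b - d); rewrite sqrrB sqrrD qp qm q0; lra.
  have h5 : (b + d) * a <= 2 * a ^+ 2 + Y.
    have p1 : 0 <= (b + d) * a by rewrite mulr_ge0// ?addr_ge0// ltW.
    have p2 : 0 <= 2 * a ^+ 2 + Y by lra.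
    suff: ((b + d) * a) ^+ 2 <= (2 * a ^+ 2 + Y) ^+ 2 by rewrite ler_pXn2r ?nnegrE.
    rewrite exprMn; have h6 := ler_wpM2r (ltW a2) h; have h7 := sqr_ge0 Y.
    by apply: (le_trans h6); move: h7; set t := a ^+ 2; clear; nra.
  suff -> : (b + d - 2 * a) * a = (b + d) * a - 2 * a ^+ 2 by lra.
  by ring.
rewrite ler_norml; apply/andP; split; lra.
Qed.

(** The power is a smooth function of [radius] on $[\sqrt c,\infty)$, and
    [radius] is $1$-Lipschitz with bounded second differences. *)
Lemma regular_bracket m : 0 < m -> exists C, regular (fun x => bracket c x `^ (- m)) C.
Proof.
move=> m0; have sc : 0 < Num.sqrt c by rewrite sqrtr_gt0.
set B := Num.sqrt c in sc *; pose q := 2 * m; have q0 : 0 < q by rewrite mulr_gt0.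
pose K1 := B `^ (- q); pose K2 := q * B `^ (- q - 1); pose K3 := q * (q + 1) * B `^ (- q - 2).
have K10 : 0 <= K1 by exact: powR_ge0.
have K20 : 0 <= K2 by rewrite mulr_ge0 ?powR_ge0// ltW.
have K30 : 0 <= K3 by rewrite mulr_ge0 ?powR_ge0// mulr_ge0 ?addr_ge0// ltW.
have mono p a : 0 <= p -> B <= a -> a `^ (- p) <= B `^ (- p).
  move=> p0 Ba; rewrite !powRN lef_pV2 ?posrE ?powR_gt0// ?(lt_le_trans sc)//.
  by rewrite ge0_ler_powR ?nnegrE ?(ltW sc)// (le_trans (ltW sc)).
have K0 : 0 <= K1 + K2 + K3 by rewrite !addr_ge0.
eexists; rewrite (_ : (fun x => _) = fun x => radius x `^ (- q)); last first.
  by apply/funext => x; exact: radius_powR.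
apply: (@regular_comp R N radius (1 + B^-1) [set a | B <= a] (fun a => a `^ (- q))
  (fun a => - (q * a `^ (- q - 1))) (K1 + K2 + K3)) => //.
- exact: measurable_radius.
- by rewrite addr_ge0 ?invr_ge0 ?ltW.
- exact: radius_ge.
- move=> x y; rewrite (le_trans (radius_lipschitz x y))// ler_peMl ?enorm_ge0// lerDl invr_ge0 ltW//.
- move=> x y; rewrite (le_trans (radius_sdiff x y))// mulrC ler_wpM2r ?edot_ge0// lerDr//.
- move=> a Ba; rewrite ger0_norm ?powR_ge0// (le_trans (mono _ _ (ltW q0) Ba))//.
  by rewrite -addrA lerDl addr_ge0.
- move=> a Ba; rewrite normrN normrM (gtr0_norm q0) ger0_norm ?powR_ge0//.
  apply: (@le_trans _ _ K2); last by rewrite addrAC lerDr addr_ge0.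
  by rewrite ler_wpM2l ?(ltW q0)// -opprD mono// addr_ge0// ltW.
- move=> a b Ba Bb; rewrite (le_trans (powR_lipschitz sc q0 Ba Bb))// ler_wpM2r//.
  by rewrite addrAC lerDr addr_ge0.
- move=> a b Ba Bb; rewrite mulNr opprK (le_trans (powR_taylor sc q0 Bb Ba))//.
  by rewrite ler_wpM2r ?sqr_ge0// lerDr addr_ge0.
Qed.

End radius.

(** * The Hardy symbol *)

Section hardy_symbol.
Context {R : realType}.
Notation mu_ n := (lebesgue_rV R n).
Variables (N : nat) (s : R).
Hypotheses (N0 : (0 < N)%N) (s01 : 0 < s < 1).
Let s0 : 0 < s. Proof. by case/andP: s01. Qed.
Let s1 : s < 1. Proof. by case/andP: s01. Qed.

Lemma symLapD v1 v2 C1 C2 (x : 'rV[R]_N) : regular v1 C1 -> regular v2 C2 ->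
  symLap s (fun z => v1 z + v2 z) x = symLap s v1 x + symLap s v2 x.
Proof.
move=> r1 r2; rewrite /symLap -RintegralD//.
- by apply: eq_Rintegral => y _; rewrite /sdiff; ring.
- exact: (integrable_sdiff_kern N0 s01 r1).
- exact: (integrable_sdiff_kern N0 s01 r2).
Qed.

Lemma symLapZ v C k (x : 'rV[R]_N) : regular v C ->
  symLap s (fun z => k * v z) x = k * symLap s v x.
Proof.
move=> r; rewrite /symLap -RintegralZl//; last exact: (integrable_sdiff_kern N0 s01 r).
by apply: eq_Rintegral => y _; rewrite /sdiff; ring.
Qed.

Lemma normr_Gamma_opp : `|Gamma (- s)| = Gamma (1 - s) / s.
Proof.
have s1' : 0 < 1 - s by rewrite subr_gt0.
have t0 : Num.truncn s = 0%N by apply: truncn_def; rewrite ltW.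
rewrite (Gamma_gt0E s1') /Gamma ifF; last by apply/negbTE; rewrite -leNgt oppr_le0 ltW.
rewrite opprK t0 big_ord_recl big_ord0 mulr1 addr0 (addrC (- s)).
have g := Gamma_gt0 s1'; rewrite (Gamma_gt0E s1') in g.
by rewrite invrN mulrN normrN gtr0_norm// divr_gt0.
Qed.

(** $(-\Delta)^s|x|^{-2m}$ is this constant times $|x|^{-2m-2s}$. *)
Definition hardy_symbol (m : R) : R :=
  2 `^ (2 * s) * Gammaratio s m * Gammaratio s (N%:R / 2 - (s + m)).

Lemma hardy_paramE alpha :
  hardy_param N s alpha = hardy_symbol (((N%:R - 2 * s) / 2 + alpha) / 2).
Proof.
rewrite /hardy_param /hardy_symbol /Gammaratio.
rewrite (_ : ((N%:R - 2 * s) / 2 + alpha) / 2 + s = (N%:R + 2 * s + 2 * alpha) / 4); last by field.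
rewrite (_ : ((N%:R - 2 * s) / 2 + alpha) / 2 = (N%:R - 2 * s + 2 * alpha) / 4); last by field.
rewrite (_ : N%:R / 2 - (s + (N%:R - 2 * s + 2 * alpha) / 4) + s
   = (N%:R + 2 * s - 2 * alpha) / 4); last by field.
rewrite (_ : N%:R / 2 - (s + (N%:R - 2 * s + 2 * alpha) / 4)
   = (N%:R - 2 * s - 2 * alpha) / 4); last by field.
by rewrite invfM; set a := Gamma _; set b := Gamma _; set c := _^-1; set d := _^-1; ring.
Qed.

(** Both arguments have the same sum, so that strict log-convexity of the
    quotient compares the more balanced pair with the less balanced one. *)
Lemma hardy_symbol_lt m m' : (N%:R - 2 * s) / 4 <= m -> m < m' -> m' < N%:R / 2 - s ->
  hardy_symbol m' < hardy_symbol m.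
Proof.
move=> m4 mm' m'N.
have z0 : 0 < N%:R / 2 - (s + m') by lra.
have h0 : 0 < m' - m by lra.
have k0 : 0 < m - (N%:R / 2 - (s + m')) by lra.
have := Gammaratio_lt s0 z0 h0 k0.
rewrite (_ : N%:R / 2 - (s + m') + (m - (N%:R / 2 - (s + m'))) = m); last by ring.
rewrite (_ : m + (m' - m) = m'); last by ring.
rewrite (_ : N%:R / 2 - (s + m') + (m' - m) = N%:R / 2 - (s + m)); last by ring.
move=> h; have p2 : 0 < 2 `^ (2 * s) :> R by exact: powR_gt0.
by rewrite /hardy_symbol -[ltLHS]mulrA -[ltRHS]mulrA (ltr_pM2l p2).
Qed.

Lemma fracLap_const_gt0 : 0 < fracLap_const N s :> R.
Proof.
have p0 : 0 < pi :> R by exact: pi_gt0.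
have g : 0 < Gamma ((N%:R + 2 * s) / 2) :> R.
  by apply: Gamma_gt0; rewrite divr_gt0// ltr_wpDl// mulr_gt0.
have g' : 0 < Gamma (1 - s) :> R by apply: Gamma_gt0; rewrite subr_gt0.
rewrite /fracLap_const normr_Gamma_opp; apply: divr_gt0; last exact: divr_gt0.
by apply: mulr_gt0 => //; apply: mulr_gt0; exact: powR_gt0.
Qed.

(** The constants are uniform in the regularization parameter [c]. *)
Lemma fracLap_bracket m : 0 < m -> 0 < N%:R / 2 - (s + m) ->
  exists C th, [/\ 0 <= C, 0 < th & forall c (x : 'rV[R]_N), 0 < c ->
   let L := fracLap_const N s / 2 * symLap s (fun z => bracket c z `^ (- m)) x in
   hardy_symbol m * bracket c x `^ (- (s + m)) <= L <=
   (hardy_symbol m + C * (c / bracket c x) `^ th) * bracket c x `^ (- (s + m))].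
Proof.
move=> m0 d0; set d := N%:R / 2 - (s + m) in d0 *.
pose th := s + Num.min (1 - s) (d / 2).
have th1 : s < th <= 1.
  rewrite ltrDl lt_min subr_gt0 s1 divr_gt0//=.
  have : Num.min (1 - s) (d / 2) <= 1 - s by rewrite ge_min lexx.
  by rewrite /th; lra.
have thd : th < d + s.
  have : Num.min (1 - s) (d / 2) <= d / 2 by rewrite ge_min lexx orbT.
  by rewrite /th; lra.
have sm0 : 0 < s + m by rewrite addr_gt0.
have [C C0 HC] := jump_bounds s01 d0 sm0 th1 thd.
have g1 : 0 < Gamma (1 - s) / s by rewrite divr_gt0// Gamma_gt0 ?subr_gt0.
have gm : 0 < Gammaratio s m by exact: Gammaratio_gt0.
pose Q : R := 2 `^ (2 * s) * Gammaratio s m.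
have Q0 : 0 < Q by rewrite mulr_gt0// powR_gt0.
exists (Q / (Gamma (1 - s) / s) * C), th; split.
- by rewrite mulr_ge0// divr_ge0// ltW.
- by case/andP: th1 => + _; exact: lt_trans.
move=> c x c0 /=; set b := bracket c x.
have b0 : 0 < b by exact: bracket_gt0.
have e0 : 0 <= c / b by rewrite divr_ge0// ltW.
have [lo up] := HC _ e0.
have [C' rC'] := @regular_bracket R N c c0 m m0.
have := integral_sdiff_bracket x N0 s01 m0 c0 d0.
rewrite (EFin_symLap N0 s01 rC') -/b; set J := (\int[_]_u _)%E in lo up * => E.
have Jfin : J \is a fin_num.
  by rewrite fin_numElt (lt_le_trans _ lo) ?ltNyr// (le_lt_trans up) ?ltry.
rewrite -(fineK Jfin) !lee_fin in lo up; set j := fine J in lo up.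
rewrite -(fineK Jfin) -EFinM in E; case: E => ->; rewrite -/j.
set P := b `^ (- (s + m)); have P0 : 0 <= P by exact: powR_ge0.
have K : fracLap_const N s / 2 * (2 * pi `^ (N%:R / 2) * Gammaratio s m / Gamma (N%:R / 2 + s) * P * j)
    = Q / (Gamma (1 - s) / s) * j * P.
  rewrite /fracLap_const normr_Gamma_opp (_ : (N%:R + 2 * s) / 2 = N%:R / 2 + s); last by field.
  have g : 0 < Gamma (N%:R / 2 + s) :> R by apply: Gamma_gt0; rewrite ltr_wpDl// divr_ge0.
  have p0 : 0 < pi `^ (N%:R / 2) :> R by apply: powR_gt0; exact: pi_gt0.
  have g' : 0 < Gamma (1 - s) :> R by apply: Gamma_gt0; rewrite subr_gt0.
  rewrite powRN /Q; move: g g' p0 s0 => /lt0r_neq0 + /lt0r_neq0 + /lt0r_neq0 + /lt0r_neq0.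
  move: (Gamma _) (Gamma _) (pi `^ _) (Gammaratio _ _) (2 `^ _) => G G' p g t Gn G'n pn sn.
  by field; rewrite sn G'n pn Gn.
rewrite K; apply/andP; split; rewrite ler_wpM2r//.
  rewrite /hardy_symbol -/Q -/d -mulrA; rewrite ler_wpM2l ?(ltW Q0)//.
  by rewrite mulrC ler_pdivlMr// mulrC.
apply: (@le_trans _ _ (Q / (Gamma (1 - s) / s)
    * (Gamma (1 - s) / s * Gammaratio s d + C * (c / b) `^ th))).
  by rewrite ler_wpM2l// divr_ge0// ltW.
rewrite /hardy_symbol -/Q -/d le_eqVlt; apply/orP; left; apply/eqP.
by move: (lt0r_neq0 g1); move: (Gamma (1 - s) / s) ((c / b) `^ th) (Gammaratio s d) => G e gd Gn; field.
Qed.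

End hardy_symbol.

(** * The barrier *)

Section barrier.
Context {R : realType}.
Notation mu_ n := (lebesgue_rV R n).
Variables (N : nat) (s m1 m2 lam del : R).
Hypotheses (N0 : (0 < N)%N) (s01 : 0 < s < 1) (m10 : 0 < m1) (m12 : m1 < m2)
  (m2N : 0 < N%:R / 2 - (s + m2)) (lam0 : 0 < lam) (del0 : 0 < del)
  (lamE : hardy_symbol N s m1 = lam) (lam2 : hardy_symbol N s m2 = lam - del).
Let s0 : 0 < s. Proof. by case/andP: s01. Qed.
Let m20 : 0 < m2. Proof. exact: lt_trans m12. Qed.
Let m1N : 0 < N%:R / 2 - (s + m1). Proof. by move: m12 m2N; lra. Qed.

Section fixed_parameters.
Variables (c rho : R).
Hypotheses (c0 : 0 < c) (rho0 : 0 < rho).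
Implicit Types x y : 'rV[R]_N.

(** Small enough for the gap [del] between the Hardy constants to dominate the
    loss caused by smoothing the positive part where the profile is positive. *)
Definition ramp_width : R := del / (4 * lam) * rho `^ (- m2).

Definition profile x : R :=
  bracket c x `^ (- m2) + (- rho `^ (m1 - m2)) * bracket c x `^ (- m1).

Definition barrier x : R := ramp ramp_width (profile x).

Lemma ramp_width_gt0 : 0 < ramp_width.
Proof. by rewrite mulr_gt0 ?powR_gt0// divr_gt0// mulr_gt0. Qed.

Let bgt0 x : 0 < bracket c x. Proof. exact: bracket_gt0. Qed.

Lemma profileE x : profile x = bracket c x `^ (- m2) * (1 - (bracket c x / rho) `^ (m2 - m1)).
Proof.
rewrite /profile mulrBr mulr1 mulNr; congr (_ - _).
have e1 : rho `^ (m1 - m2) = rho^-1 `^ (m2 - m1).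
  by rewrite -(powR_inv1 (ltW rho0)) -powRrM; congr (_ `^ _); ring.
have e2 : bracket c x `^ (- m1) = bracket c x `^ (- m2) * bracket c x `^ (m2 - m1).
  rewrite -powRD; last by rewrite (gt_eqF (bgt0 x)) implybT.
  by congr (_ `^ _); ring.
by rewrite e1 e2 powRM ?(ltW (bgt0 x)) ?invr_ge0 ?(ltW rho0)//; ring.
Qed.

Lemma profile_le x : profile x <= bracket c x `^ (- m2).
Proof. by rewrite /profile gerDl mulNr oppr_le0 mulr_ge0 ?powR_ge0. Qed.

Lemma profile_le0 x : rho <= bracket c x -> profile x <= 0.
Proof.
move=> h; rewrite profileE mulr_ge0_le0 ?powR_ge0// subr_le0.
have b1 : 1 <= bracket c x / rho by rewrite ler_pdivlMr// mul1r.
by rewrite -[leLHS](powRr0 (bracket c x / rho)) ler_powR// subr_ge0 ltW.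
Qed.

Lemma barrier_ge0 x : 0 <= barrier x.
Proof. exact: (ramp_ge0 ramp_width_gt0). Qed.

Lemma barrier_le x : barrier x <= bracket c x `^ (- m2).
Proof.
have [p0|/ltW p0] := leP (profile x) 0; first by rewrite /barrier rampN// powR_ge0.
by rewrite (le_trans (ramp_le ramp_width_gt0 p0))// profile_le.
Qed.

Lemma barrier_out x : rho <= edot x x -> barrier x = 0.
Proof.
move=> h; rewrite /barrier rampN// profile_le0// (le_trans h)// lerDl ltW//.
Qed.

Let eta : R := 1 - 4 `^ (m1 - m2).

Definition barrier_ratio : R := eta * (eta / (eta + del / (4 * lam))).

Let eta0 : 0 < eta.
Proof.
rewrite subr_gt0 -opprB powRN invf_lt1 ?powR_gt0//.
suff: 1 `^ (m2 - m1) < 4 `^ (m2 - m1) :> R by rewrite powR1.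
apply: gt0_ltr_powR; rewrite ?nnegrE ?subr_gt0//; lra.
Qed.

Lemma barrier_ratio_gt0 : 0 < barrier_ratio.
Proof. by rewrite mulr_gt0// divr_gt0// addr_gt0// divr_gt0// mulr_gt0. Qed.

Lemma barrier_ge x : 4 * bracket c x <= rho ->
  barrier_ratio * bracket c x `^ (- m2) <= barrier x.
Proof.
move=> h; set A := bracket c x `^ _; have A0 : 0 <= A by exact: powR_ge0.
have p1 : eta * A <= profile x.
  rewrite profileE -/A mulrC ler_wpM2l// lerB//.
  have e1 : 4 `^ (m1 - m2) = 4^-1 `^ (m2 - m1) :> R.
    by rewrite -powR_inv1// -powRrM; congr (_ `^ _); ring.
  rewrite e1 ge0_ler_powR ?nnegrE ?subr_ge0 ?(ltW m12)//.
    by rewrite divr_ge0 ?(ltW (bgt0 x)) ?(ltW rho0).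
  by rewrite ler_pdivrMr// mulrC ler_pdivlMr// mulrC.
have p2 : rho `^ (- m2) <= A.
  rewrite /A !powRN lef_pV2 ?posrE ?powR_gt0// ge0_ler_powR ?nnegrE ?(ltW m20) ?(ltW rho0) ?(ltW (bgt0 x))//.
  by rewrite (le_trans _ h)// ler_peMl ?(ltW (bgt0 x))//; lra.
have w0 : 0 <= eta * rho `^ (- m2) <= profile x.
  by rewrite mulr_ge0 ?powR_ge0 ?(ltW eta0)//= (le_trans _ p1)// ler_wpM2l// ltW.
apply: le_trans (ramp_ge ramp_width_gt0 w0).
have r0 : 0 < rho `^ (- m2) by exact: powR_gt0.
rewrite /ramp_width -mulrDl -mulf_div divff ?gt_eqF// mulr1.
rewrite /barrier_ratio mulrAC ler_wpM2r// divr_ge0 ?(ltW eta0)// addr_ge0 ?(ltW eta0)//.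
by rewrite divr_ge0 ?(ltW del0)// mulr_ge0 ?(ltW lam0).
Qed.

Lemma regular_profile : exists C, regular profile C.
Proof.
have [C1 r1] := @regular_bracket R N c c0 m1 m10.
have [C2 r2] := @regular_bracket R N c c0 m2 m20.
by eexists; exact: (regularD r2 (regularZ r1 (- rho `^ (m1 - m2)))).
Qed.

Lemma regular_barrier : exists C, regular barrier C.
Proof.
have [C rC] := regular_profile; have [mW C0 bW lW sW] := rC.
have k0 := ramp_width_gt0; have kV : 0 <= ramp_width^-1 by rewrite invr_ge0 ltW.
eexists; apply: (@regular_comp R N profile C [set a | `|a| <= C] (ramp ramp_width)
  (dramp ramp_width) (C + 1 + ramp_width^-1)) => //.
- exact: measurable_ramp.
- by rewrite !addr_ge0.
- move=> a aC; have := ramp_lipschitz k0 a 0; rewrite (rampN _ (lexx 0)) !subr0 => h.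
  by rewrite (le_trans h)// (le_trans aC)// -addrA lerDl addr_ge0.
- move=> a _; rewrite ger0_norm ?dramp_ge0// (le_trans (dramp_le1 _ _))//; lra.
- move=> a b _ _; rewrite (le_trans (ramp_lipschitz k0 a b))// ler_peMl//; lra.
- move=> a b _ _; have /andP[t0 t1] := ramp_taylor k0 a b.
  rewrite ger0_norm// (le_trans t1)// mulrC ler_wpM2r ?sqr_ge0//; lra.
Qed.

(** Convexity of [ramp], applied to both increments of a second difference. *)
Lemma symLap_barrier_le x :
  symLap s barrier x <= dramp ramp_width (profile x) * symLap s profile x.
Proof.
have [C rC] := regular_barrier; have [C' rC'] := regular_profile.
rewrite -(symLapZ N0 s01 _ _ rC') /symLap; apply: le_Rintegral => //.
- exact: (integrable_sdiff_kern N0 s01 rC).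
- exact: (integrable_sdiff_kern N0 s01 (regularZ rC' _)).
move=> y _; rewrite ler_wpM2r ?kern_ge0// /sdiff -/(profile _) /barrier.
have /andP[t1 _] := ramp_taylor ramp_width_gt0 (profile x) (profile (x + y)).
have /andP[t2 _] := ramp_taylor ramp_width_gt0 (profile x) (profile (x - y)).
move: t1 t2; set D := dramp _ _; lra.
Qed.

Lemma symLap_profile x : symLap s profile x =
  symLap s (fun z => bracket c z `^ (- m2)) x
  - rho `^ (m1 - m2) * symLap s (fun z => bracket c z `^ (- m1)) x.
Proof.
have [C1 r1] := @regular_bracket R N c c0 m1 m10.
have [C2 r2] := @regular_bracket R N c c0 m2 m20.
by rewrite (symLapD N0 s01 x r2 (regularZ r1 _)) (symLapZ N0 s01 _ x r1) mulNr.
Qed.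

End fixed_parameters.

(** The regularization of the powers is only felt in a core of size comparable
    to $\sqrt c$; elsewhere the gap [del] survives the smoothing of the positive
    part, with half of it to spare. *)
Lemma fracLap_barrier : exists C K, [/\ 0 <= C, 0 < K &
  forall c rho (x : 'rV[R]_N), 0 < c -> 0 < rho ->
  let b := bracket c x in
  fracLap s (barrier c rho) x <=
    lam * b `^ (- s) * barrier c rho x - del / 2 * rho `^ (- s) * barrier c rho x
    + (if b < K * c then C * b `^ (- s) * b `^ (- m2) else 0)].
Proof.
have [C [th [C0 th0 HC]]] := fracLap_bracket N0 s01 m20 m2N.
have [C' [th' [_ _ HC']]] := fracLap_bracket N0 s01 m10 m1N.
pose E := 4 * C / del + 1.
have E1 : 0 < E by rewrite ltr_wpDl// divr_ge0 ?(ltW del0)// mulr_ge0.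
have K0 : 0 < E `^ th^-1 by exact: powR_gt0.
exists C, (E `^ th^-1); split => // c rho x c0 rho0 /=; set b := bracket c x.
have b0 : 0 < b by exact: bracket_gt0.
have [C1 r1] := regular_barrier c0 rho0.
rewrite (fracLap_regular N0 s01 r1).
have cst0 := @fracLap_const_gt0 R N s s01.
set k := ramp_width rho; have k0 : 0 < k by exact: ramp_width_gt0.
set W := profile c rho x; set D := dramp k W.
have D0 : 0 <= D by exact: dramp_ge0. have D1 : D <= 1 by exact: dramp_le1.
pose A := b `^ (- m2); pose S := b `^ (- s); pose e := (c / b) `^ th.
have A0 : 0 < A by exact: powR_gt0. have S0 : 0 < S by exact: powR_gt0.
have e0 : 0 <= e by exact: powR_ge0.
have SA : b `^ (- (s + m2)) = S * A.
  by rewrite opprD powRD// (gt_eqF b0) implybT.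
have SM : rho `^ (m1 - m2) * b `^ (- (s + m1)) = S * (A - W).
  rewrite opprD [b `^ _]powRD; last by rewrite (gt_eqF b0) implybT.
  by rewrite /W /profile -/b -/S -/A; ring.
have LE : fracLap_const N s / 2 * symLap s (barrier c rho) x <= D * (S * (lam * W - del * A + C * e * A)).
  apply: (@le_trans _ _ (D * (fracLap_const N s / 2 * symLap s (profile c rho) x))).
    rewrite [leRHS]mulrCA; apply: ler_wpM2l; first by rewrite divr_ge0 ?(ltW cst0).
    exact: (symLap_barrier_le c0 rho0).
  rewrite ler_wpM2l// symLap_profile// mulrBr [X in _ - X <= _]mulrCA.
  have /andP[_ h2] := HC c x c0; have /andP[h1 _] := HC' c x c0.
  rewrite -/b lamE in h1; rewrite -/b lam2 SA -/e in h2.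
  have h3 := ler_wpM2l (powR_ge0 rho (m1 - m2)) h1.
  rewrite mulrCA SM in h3.
  apply: (le_trans (lerB h2 h3)); rewrite le_eqVlt; apply/orP; left; apply/eqP; ring.
apply: (le_trans LE); rewrite -/S -/A.
have [W0|W0] := leP W 0.
  have D00 : D = 0 by rewrite /D drampN.
  rewrite D00 mul0r (_ : barrier _ _ _ = 0) ?mulr0 ?subr0 ?add0r; last by rewrite /barrier -/W rampN.
  by case: ifP => // _; rewrite !mulr_ge0// ltW.
have brho : b < rho by rewrite ltNge; apply/negP => /(profile_le0 c0 rho0); rewrite leNgt W0.
set psi := barrier c rho x.
have psi1 : D * (W - k) <= psi by exact: dramp_le_ramp.
have psi2 : psi <= D * A.
  apply: (le_trans (ramp_le_dramp k0 W)); rewrite ler_wpM2l//; exact: profile_le.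
have lk : lam * k <= del / 4 * A.
  rewrite /k /ramp_width (_ : lam * _ = del / 4 * rho `^ (- m2)); last first.
    by move: (lt0r_neq0 lam0) => ?; field.
  rewrite ler_wpM2l ?divr_ge0 ?(ltW del0)// /A !powRN lef_pV2 ?posrE ?powR_gt0//.
  by rewrite ge0_ler_powR ?nnegrE ?(ltW m20) ?(ltW rho0) ?(ltW b0) ?(ltW brho).
have Srho : rho `^ (- s) <= S.
  rewrite /S !powRN lef_pV2 ?posrE ?powR_gt0//.
  by rewrite ge0_ler_powR ?nnegrE ?(ltW s0) ?(ltW rho0) ?(ltW b0) ?(ltW brho).
have main : D * (lam * W) <= lam * psi + D * (del / 4 * A).
  have h1 := ler_wpM2l (ltW lam0) psi1; have h2 := ler_wpM2l D0 lk; lra.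
have good : rho `^ (- s) * psi <= S * (D * A).
  by apply: ler_pM => //; [exact: powR_ge0|exact: barrier_ge0].
have good' : del / 2 * rho `^ (- s) * psi <= del / 2 * (S * (D * A)).
  by rewrite -mulrA ler_wpM2l// divr_ge0// ltW.
have DA0 : 0 <= S * (D * A) by rewrite !mulr_ge0 ?(ltW S0) ?(ltW A0).
have main' := ler_wpM2l (ltW S0) main.
case: ifPn => [_|].
  have e1 : e <= 1.
    rewrite /e -(powRr0 (c / b)) ger_powR ?(ltW th0)// divr_gt0//= ler_pdivrMr// mul1r.
    exact: bracket_ge.
  have h : C * e * (S * (D * A)) <= C * S * A.
    rewrite (_ : C * S * A = C * 1 * (S * (1 * A))); last by ring.
    apply: ler_pM; [by rewrite mulr_ge0|done|by rewrite ler_wpM2l|].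
    by rewrite ler_wpM2l ?(ltW S0)// ler_wpM2r ?(ltW A0).
  have dDA : 0 <= del * (S * (D * A)) by rewrite mulr_ge0// ltW.
  move: main' good' h dDA; clear; move: (rho `^ _) => rs; nra.
rewrite -leNgt addr0 => Kcb.
have Ce : C * e <= del / 4.
  have cb : c / b <= (E `^ th^-1)^-1.
    by rewrite ler_pdivrMr// mulrC ler_pdivlMr// mulrC.
  have : e <= E^-1.
    apply: (le_trans (ge0_ler_powR (ltW th0) _ _ cb)).
    - by rewrite nnegrE divr_ge0 ?(ltW c0) ?(ltW b0).
    - by rewrite nnegrE invr_ge0 ltW.
    by rewrite -powRN -powRrM mulNr mulVf ?gt_eqF// powR_inv1 ?(ltW E1).
  move=> eE; have := ler_wpM2l C0 eE => h; apply: (le_trans h).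
  by rewrite ler_pdivrMr// /E; move: del0 C0; set q := del; set Cc := C => q0 Cc0;
    rewrite mulrDr mulr1 (_ : q / 4 * (4 * Cc / q) = Cc) ?lerDl ?divr_ge0 ?(ltW q0)//; field; exact: lt0r_neq0.
have h := ler_wpM2r DA0 Ce.
move: main' good' h; clear; move: (rho `^ _) => rs; nra.
Qed.

End barrier.

(** * Mass of the barrier and its behaviour far away *)

Section barrier_mass.
Context {R : realType}.
Notation mu_ n := (lebesgue_rV R n).
Variables (N : nat) (s m1 m2 lam del : R).
Hypotheses (N0 : (0 < N)%N) (s01 : 0 < s < 1) (m10 : 0 < m1) (m12 : m1 < m2)
  (lam0 : 0 < lam) (del0 : 0 < del).
Let s0 : 0 < s. Proof. by case/andP: s01. Qed.
Let m20 : 0 < m2. Proof. exact: lt_trans m12. Qed.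

Lemma coord_le_enorm (x : 'rV[R]_N) i : `|x ord0 i| <= enorm x.
Proof.
rewrite -sqrtr_sqr; apply: ler_wsqrtr; rewrite /edot (bigD1 i)//= -expr2 lerDl.
by apply: sumr_ge0 => j _; rewrite -expr2 sqr_ge0.
Qed.

Definition cube (h : R) : set 'rV[R]_N := [set x | forall i, `|x ord0 i| <= h].

Lemma measurable_cube0 h : measurable (cube h).
Proof.
rewrite [X in measurable X](_ : _ = [set x : 'rV[R]_N |
  forall i, `|x ord0 i - (0 : 'rV[R]_N) ord0 i| <= h]); first exact: measurable_cube.
by apply/seteqP; split => x /= H i; have := H i; rewrite mxE subr0.
Qed.

Lemma integral_cube (k h : R) : 0 <= k -> 0 <= h ->
  (\int[mu_ N]_x (k * \1_(cube h) x)%:E = (k * (h *+ 2) ^+ N)%:E)%E.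
Proof.
move=> k0 h0; have mC := measurable_cube0 h.
have mi : measurable_fun setT (\1_(cube h) : 'rV[R]_N -> R) by exact: measurable_indic.
rewrite ge0_integralrZ; [|exact: mi|by move=> x; rewrite indicE|exact: k0].
have E : mu_ N (cube h) = ((h *+ 2) ^+ N)%:E by exact: lebesgue_rV_cube.
rewrite integral_indic; [|exact: measurableT|exact: mC].
by rewrite setIT EFinM -E.
Qed.

Lemma bracket_lt_cube c h (x : 'rV[R]_N) : 0 < c -> bracket c x < h -> cube (Num.sqrt h) x.
Proof.
move=> c0 bh i; rewrite (le_trans (coord_le_enorm x i))//; apply: ler_wsqrtr.
by rewrite (le_trans _ (ltW bh))// lerDl ltW.
Qed.

Lemma edot_cube h (x : 'rV[R]_N) : cube h x -> edot x x <= N%:R * h ^+ 2.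
Proof.
move=> H; apply: (@le_trans _ _ (\sum_(i < N) h ^+ 2)); last first.
  by rewrite sumr_const card_ord mulr_natl.
apply: ler_sum => i _; rewrite -expr2 -[leLHS]real_normK ?num_real//.
have h0 : 0 <= h by rewrite (le_trans _ (H i)).
by rewrite lerXn2r ?nnegrE.
Qed.

Variables (c rho : R).
Hypotheses (c0 : 0 < c) (rho0 : 0 < rho).
Notation psi := (barrier (N := N) m1 m2 lam del c rho).

Let psi0 x : 0 <= psi x.
Proof. exact: barrier_ge0. Qed.

Let psi_out x : rho <= edot x x -> psi x = 0.
Proof. by move=> h; apply: barrier_out. Qed.

Let mpsi : measurable_fun setT psi.
Proof. by have [C []] := regular_barrier N m10 m12 lam0 del0 c0 rho0. Qed.

Definition barrier_mass : R := \int[mu_ N]_x psi x.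

Let psi_le x : psi x <= c `^ (- m2) * \1_(cube (Num.sqrt rho)) x.
Proof.
have [h|h] := leP rho (edot x x); first by rewrite psi_out// mulr_ge0 ?powR_ge0// indicE.
rewrite indicE mem_set/= ?mulr1; last first.
  by move=> i; rewrite (le_trans (coord_le_enorm x i))//; apply: ler_wsqrtr; exact: ltW.
apply: le_trans (barrier_le m1 m2 lam0 del0 c rho0 x) _.
rewrite !powRN lef_pV2 ?posrE ?powR_gt0 ?bracket_gt0//.
by rewrite ge0_ler_powR ?nnegrE ?(ltW m20) ?(ltW c0) ?bracket_ge// ltW ?bracket_gt0.
Qed.

Lemma integral_barrier_lty : (\int[mu_ N]_x (psi x)%:E < +oo)%E.
Proof.
apply: (@le_lt_trans _ _ (\int[mu_ N]_x (c `^ (- m2) * \1_(cube (Num.sqrt rho)) x)%:E)%E).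
  apply: ge0_le_integralr => //; apply: measurable_funM; first exact: measurable_cst.
  by apply: measurable_indic; exact: measurable_cube0.
by rewrite integral_cube ?powR_ge0 ?sqrtr_ge0// ltry.
Qed.

Lemma integral_barrier : (\int[mu_ N]_x (psi x)%:E = barrier_mass%:E)%E.
Proof.
rewrite /barrier_mass /Rintegral fineK// ge0_fin_numE ?integral_barrier_lty//.
by apply: integral_ge0 => x _; rewrite lee_fin.
Qed.

Lemma barrier_mass_ge0 : 0 <= barrier_mass.
Proof. by apply: fine_ge0; apply: integral_ge0 => x _; rewrite lee_fin. Qed.

(** On a cube of size comparable to $\sqrt\rho$ the barrier is bounded below
    independently of [c]. *)
Lemma barrier_mass_ge : 8 * c <= rho ->
  barrier_ratio m1 m2 lam del * (rho / 4) `^ (- m2) * ((Num.sqrt rho / (4 * N%:R)) *+ 2) ^+ N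
    <= barrier_mass.
Proof.
move=> cr; have sg0 : 0 < barrier_ratio m1 m2 lam del by exact: barrier_ratio_gt0.
have N1 : 1 <= N%:R :> R by rewrite ler1n.
have k0 : 0 <= barrier_ratio m1 m2 lam del * (rho / 4) `^ (- m2).
  by rewrite mulr_ge0 ?powR_ge0// ltW.
have h0 : 0 <= Num.sqrt rho / (4 * N%:R) by rewrite divr_ge0 ?sqrtr_ge0// mulr_ge0.
rewrite -lee_fin -integral_barrier -integral_cube//.
apply: ge0_le_integralr => //.
- apply: measurable_funM; first exact: measurable_cst.
  by apply: measurable_indic; exact: measurable_cube0.
- by move=> x; rewrite mulr_ge0// indicE.
move=> x; rewrite indicE; have [/set_mem Cx|_] := boolP (_ \in _); last by rewrite mulr0.
rewrite mulr1.
have b0 : 0 < bracket c x by exact: bracket_gt0.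
have b4 : 4 * bracket c x <= rho.
  have e := edot_cube Cx.
  have e' : N%:R * (Num.sqrt rho / (4 * N%:R)) ^+ 2 <= rho / 16.
    have Nn : N%:R != 0 :> R by rewrite pnatr_eq0 -lt0n.
    have -> : N%:R * (Num.sqrt rho / (4 * N%:R)) ^+ 2 = Num.sqrt rho ^+ 2 / 16 * N%:R^-1 by field.
    rewrite (sqr_sqrtr (ltW rho0)) ler_piMr ?divr_ge0 ?(ltW rho0)// invf_le1//.
    exact: lt_le_trans N1.
  by have := le_trans e e'; rewrite /bracket; set z := edot x x => e''; have := rho0; have := cr; lra.
apply: le_trans (barrier_ge m10 m12 lam0 del0 c0 rho0 b4).
rewrite ler_wpM2l ?(ltW sg0)// !powRN lef_pV2 ?posrE ?powR_gt0 ?divr_gt0//.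
rewrite ge0_ler_powR ?nnegrE ?(ltW m20) ?(ltW b0) ?divr_ge0 ?(ltW rho0)//.
by rewrite ler_pdivlMr// mulrC.
Qed.

(** Outside its support a nonnegative function has a negative fractional
    Laplacian, of the size of its mass. *)
Lemma fracLap_barrier_far (x : 'rV[R]_N) : rho <= edot x x ->
  fracLap s psi x <=
  - (fracLap_const N s * barrier_mass * (enorm x + Num.sqrt rho) `^ (- (N%:R + 2 * s))).
Proof.
move=> rx; have [C rC] := regular_barrier N m10 m12 lam0 del0 c0 rho0.
rewrite (fracLap_regular N0 s01 rC).
have cst0 := @fracLap_const_gt0 R N s s01.
set k := (_ + _) `^ _; have k0 : 0 <= k by exact: powR_ge0.
pose f y := psi (x + y); pose g y := psi (x - y).
have mf : measurable_fun setT f by apply: measurable_comp_rV => //; meas.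
have mg : measurable_fun setT g by apply: measurable_comp_rV => //; meas.
have Ef : (\int[mu_ N]_y (f y)%:E = barrier_mass%:E)%E.
  rewrite -integral_barrier -[RHS](integral_shift_rV x); last exact/measurable_EFinP.
  by apply: eq_integral => y _; rewrite /f addrC.
have Eg : (\int[mu_ N]_y (g y)%:E = barrier_mass%:E)%E.
  by rewrite -integral_barrier -[RHS](integral_reflect_rV x)//; exact/measurable_EFinP.
have fg y : (f y + g y) * k <= (f y + g y) * kern s y.
  have [->|fg0] := eqVneq (f y + g y) 0; first by rewrite !mul0r.
  rewrite ler_wpM2l ?addr_ge0 ?psi0//.
  have yx : enorm y <= enorm x + Num.sqrt rho.
    apply: contraNT fg0; rewrite -ltNge => h; rewrite /f /g.
    have far z : Num.sqrt rho <= enorm z -> psi z = 0.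
      move=> hz; apply: psi_out; rewrite -sqr_enorm -(sqr_sqrtr (ltW rho0)).
      by rewrite lerXn2r ?nnegrE ?sqrtr_ge0 ?enorm_ge0.
    rewrite !far ?addr0//.
      have := ler_enormD (x - y) (- x); rewrite addrAC subrr add0r !enormN; lra.
    have := ler_enormD (x + y) (- x); rewrite addrAC subrr add0r enormN; lra.
  have y0 : 0 < enorm y.
    rewrite lt_neqAle enorm_ge0 andbT eq_sym; apply: contraNneq fg0 => ey.
    by rewrite (enorm_eq0 ey) /f /g addr0 subr0 psi_out// addr0.
  have e0 : 0 <= N%:R + 2 * s by rewrite addr_ge0// mulr_ge0// ltW.
  rewrite /k powRN /kern lef_pV2 ?posrE ?powR_gt0//; last by rewrite (lt_le_trans y0).
  by rewrite ge0_ler_powR ?nnegrE ?enorm_ge0// (le_trans (ltW y0)).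
have lim : 2 * barrier_mass * k <= - symLap s psi x.
  have E : (\int[mu_ N]_y ((f y + g y) * kern s y)%:E = (- symLap s psi x)%:E)%E.
    rewrite -mulN1r EFinM -(EFin_symLap N0 s01 rC) -integralZl; last 2 first.
    - exact: measurableT.
    - exact: (integrable_sdiff_kern N0 s01 rC).
    apply: eq_integral => y _; rewrite -EFinM; congr EFin.
    by rewrite /sdiff (psi_out rx) -/(f y) -/(g y); ring.
  rewrite -lee_fin -E (_ : (2 * barrier_mass * k)%:E = \int[mu_ N]_y (k * (f y + g y))%:E)%E.
    apply: ge0_le_integralr => //.
    - apply: measurable_funM; first exact: measurable_cst.
      exact: measurable_funD.
    - by move=> y; rewrite mulr_ge0// addr_ge0 ?psi0.
    - by apply: measurable_funM; [exact: measurable_funD|exact: measurable_kern].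
    - by move=> y; rewrite mulrC.
  rewrite ge0_integralrZ//; [|exact: measurable_funD|by move=> y; rewrite addr_ge0 ?psi0].
  rewrite ge0_integralrD//; [|by move=> y; exact: psi0|by move=> y; exact: psi0].
  by rewrite Ef Eg -EFinD -EFinM; congr EFin; ring.
have := ler_wpM2l (ltW cst0) lim; lra.
Qed.

End barrier_mass.

Section pointwise.
Context {R : realType}.

(** Compare $A$ with $u^{p-1}/2$. *)
Lemma young_half (p : R) : 1 < p -> exists2 C, 0 <= C & forall A u : R, 0 <= A -> 0 <= u ->
  A * u <= u `^ p / 2 + C * A `^ (p / (p - 1)).
Proof.
move=> p1; have q0 : 0 < p - 1 by rewrite subr_gt0.
exists (2 `^ (p - 1)^-1); first exact: powR_ge0.
move=> A u A0 u0; have [->|un0] := eqVneq u 0.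
  by rewrite mulr0 addr_ge0 ?mulr_ge0 ?powR_ge0.
have up : 0 < u by rewrite lt_neqAle eq_sym un0.
have [h|h] := leP (2 * A) (u `^ (p - 1)).
  have e : u `^ p = u `^ (p - 1) * u.
    rewrite -{3}(powRr1 u0) -powRD ?subrK// un0 implybT//.
  have := ler_wpM2r u0 h; rewrite -e => h'.
  by rewrite (@le_trans _ _ (u `^ p / 2)) ?lerDl ?mulr_ge0 ?powR_ge0//; lra.
have A0' : 0 < A by have := powR_ge0 u (p - 1); lra.
have u1 : u <= (2 * A) `^ (p - 1)^-1.
  have {1}-> : u = (u `^ (p - 1)) `^ (p - 1)^-1 by rewrite -powRrM mulfV ?lt0r_neq0// powRr1.
  by rewrite ge0_ler_powR ?nnegrE ?powR_ge0 ?invr_ge0 ?(ltW q0) ?mulr_ge0 ?(ltW h).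
rewrite (@le_trans _ _ (2 `^ (p - 1)^-1 * A `^ (p / (p - 1))))//; last first.
  by rewrite lerDr mulr_ge0 ?powR_ge0 ?invr_ge0.
apply: le_trans (ler_wpM2l A0 u1) _.
rewrite powRM// mulrCA ler_wpM2l ?powR_ge0//.
rewrite -{1}(powRr1 A0) -powRD; last by rewrite (gt_eqF A0') implybT.
by rewrite le_eqVlt; apply/orP; left; apply/eqP; congr (_ `^ _); field; exact: lt0r_neq0.
Qed.

(** For $\tau$ away from $0$ the time derivative is dominated by the gap
    between the two Hardy constants; near $\tau=0$ Young's inequality applies
    and the high power of $\tau$ makes the remainder small. *)
Lemma time_absorption (p s del : R) (n : nat) : 1 < p -> 0 < s -> 0 < del ->
  p / (p - 1) < n.+1%:R -> exists2 C, 0 <= C &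
  forall u tau rho : R, 0 <= u -> 0 < tau -> 0 < rho ->
    u * (n.+1%:R * tau ^+ n) - u * tau ^+ n.+1 * (del / 2 * rho `^ (- s))
    <= tau ^+ n.+1 * (u `^ p / 2) + C * rho `^ (s * (n.+1%:R - p / (p - 1))).
Proof.
move=> p1 s0 del0 nq; have [Cy Cy0 HY] := young_half p1.
set q := p / (p - 1) in nq HY *; have M0 : 0 < n.+1%:R - q by rewrite subr_gt0.
have n0 : 0 < n.+1%:R :> R by rewrite ltr0n.
exists (Cy * n.+1%:R `^ q * (2 * n.+1%:R / del) `^ (n.+1%:R - q)).
  by rewrite !mulr_ge0 ?powR_ge0.
move=> u t rho u0 t0 rho0; have tn : 0 <= t ^+ n by rewrite exprn_ge0 ?ltW.
have tn1 : 0 <= t ^+ n.+1 by rewrite exprn_ge0 ?ltW.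
have r0 : 0 < rho `^ (- s) by exact: powR_gt0.
have C0 : 0 <= Cy * n.+1%:R `^ q * (2 * n.+1%:R / del) `^ (n.+1%:R - q) * rho `^ (s * (n.+1%:R - q)).
  by rewrite !mulr_ge0 ?powR_ge0.
have up0 : 0 <= t ^+ n.+1 * (u `^ p / 2) by rewrite mulr_ge0 ?divr_ge0 ?powR_ge0.
have [h|h] := leP n.+1%:R (t * (del / 2 * rho `^ (- s))).
  have : u * t ^+ n * n.+1%:R <= u * t ^+ n * (t * (del / 2 * rho `^ (- s))).
    by rewrite ler_wpM2l// mulr_ge0.
  by rewrite exprS; set a := rho `^ (- s); set b := t ^+ n; move: C0 up0; rewrite exprS -/b; lra.
have tt0 : t <= 2 * n.+1%:R / del * rho `^ s.
  rewrite powRN in h; have rs : 0 < rho `^ s by exact: powR_gt0.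
  rewrite mulrAC ler_pdivlMr// mulrC.
  have := ltr_pM2r rs (t * (del / 2 * (rho `^ s)^-1)) n.+1%:R; rewrite h => /idP.
  rewrite (_ : _ * rho `^ s = t * del / 2); last by field; exact: lt0r_neq0.
  lra.
have A0 : 0 <= n.+1%:R / t by rewrite divr_ge0 ?ltW.
have := ler_wpM2l tn1 (HY _ _ A0 u0); rewrite mulrDr.
rewrite (_ : t ^+ n.+1 * (n.+1%:R / t * u) = u * (n.+1%:R * t ^+ n)); last first.
  by rewrite exprS; field; exact: lt0r_neq0.
move=> h1.
have h2 : t ^+ n.+1 * (Cy * (n.+1%:R / t) `^ q) <=
    Cy * n.+1%:R `^ q * (2 * n.+1%:R / del) `^ (n.+1%:R - q) * rho `^ (s * (n.+1%:R - q)).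
  have e : t ^+ n.+1 * t^-1 `^ q = t `^ (n.+1%:R - q).
    rewrite powRD ?(gt_eqF t0) ?implybT// powR_mulrn ?(ltW t0)//; congr (_ * _).
    by rewrite -(powR_inv1 (ltW t0)) -powRrM mulN1r.
  have f : t `^ (n.+1%:R - q) <=
      (2 * n.+1%:R / del) `^ (n.+1%:R - q) * rho `^ (s * (n.+1%:R - q)).
    rewrite powRrM -powRM ?powR_ge0//; last by rewrite divr_ge0 ?mulr_ge0 ?(ltW del0).
    rewrite ge0_ler_powR ?nnegrE ?(ltW M0) ?(ltW t0)// mulr_ge0 ?powR_ge0//.
    by rewrite divr_ge0 ?mulr_ge0 ?(ltW del0).
  have := ler_wpM2l (mulr_ge0 Cy0 (powR_ge0 n.+1%:R q)) f; rewrite -e.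
  rewrite (powRM q (ler0n R n.+1) (_ : 0 <= t^-1)) ?invr_ge0 ?(ltW t0)//.
  by move: (t ^+ n.+1) (n.+1%:R `^ q) (t^-1 `^ q) (_ `^ _) (_ `^ _) => *; lra.
have h3 : 0 <= u * t ^+ n.+1 * (del / 2 * rho `^ (- s)).
  by rewrite !mulr_ge0 ?invr_ge0 ?(ltW del0) ?(ltW r0).
lra.
Qed.

End pointwise.

(** * The pointwise differential inequality *)

Section almost_everywhere.
Context d (T : measurableType d) (R : realType).
Variables (m : {measure set T -> \bar R}) (D : set T).
Hypothesis mD : measurable D.

(** No integrability is assumed, so that the smaller integral may be $-\infty$. *)
Lemma ae_le_integral (f g : T -> \bar R) : measurable_fun D f -> measurable_fun D g ->
  {ae m, forall x, D x -> (f x <= g x)%E} ->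
  (\int[m]_(x in D) f x <= \int[m]_(x in D) g x)%E.
Proof.
move=> mf mg fg; rewrite [leLHS]integralE [leRHS]integralE; apply: leeB.
  apply: ae_ge0_le_integral => //; [exact: measurable_funepos|exact: measurable_funepos|].
  by apply: filterS fg => x h /h fgx; rewrite !funeposE ge_max !le_max fgx lexx orbT.
apply: ae_ge0_le_integral => //; [exact: measurable_funeneg|exact: measurable_funeneg|].
by apply: filterS fg => x h /h fgx; rewrite !funenegE ge_max !le_max leeN2 fgx lexx orbT.
Qed.

Lemma ae_integral_ge0 (f : T -> \bar R) : measurable_fun D f ->
  {ae m, forall x, D x -> (0 <= f x)%E} -> (0 <= \int[m]_(x in D) f x)%E.
Proof.
move=> mf f0; rewrite -(integral0 m D); apply: ae_le_integral => //.
Qed.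

End almost_everywhere.

Section origin.
Context {R : realType}.
Notation mu_ n := (lebesgue_rV R n).
Variables (N : nat).
Hypothesis N0 : (0 < N)%N.

Lemma ae_neq0 : {ae lebesgue_xt R N, forall z, z.1 != 0}.
Proof.
exists (cube 0 `*` setT); split.
- by apply: measurableX => //; exact: measurable_cube0.
- have mC := measurable_cube0 (N := N) (0 : R).
  transitivity (mu_ N (cube 0) * @lebesgue_measure R [set: measurableTypeR R])%E.
    exact: (product_measure1E (mu_ N) (@lebesgue_measure R) mC measurableT).
  have -> : mu_ N (cube 0) = 0%:E.
    have E : mu_ N (cube (0 : R)) = (((0 : R) *+ 2) ^+ N)%:E by exact: lebesgue_rV_cube.
    by rewrite E mul0rn expr0n -(prednK N0).
  by rewrite mul0e.
move=> z /= /negP; rewrite negbK => /eqP z0; split => // i.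
by rewrite z0 mxE normr0.
Qed.

Lemma ae_time_neq0 : {ae lebesgue_xt R N, forall z, (z.2 : R) != 0}.
Proof.
exists (setT `*` [set (0 : measurableTypeR R)]); split.
- by apply: measurableX => //; exact: (measurable_set1 (0 : R)).
- transitivity (mu_ N setT * @lebesgue_measure R [set (0%R : measurableTypeR R)])%E.
    exact: (product_measure1E (mu_ N) (@lebesgue_measure R) measurableT (measurable_set1 (0 : R))).
  have -> : @lebesgue_measure R [set 0] = 0%E by exact: lebesgue_measure_set1.
  by rewrite mule0.
by move=> z /= /negP; rewrite negbK => /eqP z0; split.
Qed.

Lemma powR_small (e Y eta : R) : 0 < e -> 0 <= Y -> 0 < eta ->
  exists2 c1, 0 < c1 & forall c, 0 < c -> c <= c1 -> Y * c `^ e <= eta.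
Proof.
move=> e0 Y0 eta0; have Y1 : 0 < Y + 1 by lra.
have q0 : 0 < eta / (Y + 1) by rewrite divr_gt0.
exists ((eta / (Y + 1)) `^ e^-1); first exact: powR_gt0.
move=> c c0 cc1; have h : c `^ e <= eta / (Y + 1).
  apply: (le_trans (ge0_ler_powR (ltW e0) _ _ cc1)); rewrite ?nnegrE ?powR_ge0 ?(ltW c0)//.
  by rewrite -powRrM mulVf ?lt0r_neq0// powRr1 ?(ltW q0).
apply: (le_trans (ler_wpM2l Y0 h)); rewrite mulrA ler_pdivrMr// mulrC ler_wpM2l ?(ltW eta0)//; lra.
Qed.

End origin.

Section barrier_pointwise.
Context {R : realType}.
Variables (N : nat) (s m1 m2 lam del p T : R) (n : nat).
Hypotheses (N0 : (0 < N)%N) (s01 : 0 < s < 1) (m10 : 0 < m1) (m12 : m1 < m2)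
  (m2N : 0 < N%:R / 2 - (s + m2)) (lam0 : 0 < lam) (del0 : 0 < del)
  (lamE : hardy_symbol N s m1 = lam) (lam2 : hardy_symbol N s m2 = lam - del)
  (p1 : 1 < p) (np : p / (p - 1) < n.+1%:R).
Let s0 : 0 < s. Proof. by case/andP: s01. Qed.
Let m20 : 0 < m2. Proof. exact: lt_trans m12. Qed.

(** Young's inequality is used twice with half of $u^p$: once for the time
    derivative and once in the core, where the barrier is comparable to the
    most singular power and hence absorbs the error. *)
Lemma barrier_pointwise : exists C1 C2 K, [/\ 0 <= C1, 0 <= C2, 0 < K &
  forall c rho (x : 'rV[R]_N) (tau u : R), 0 < c -> 0 < rho -> 4 * (K * c) <= rho ->
  x != 0 -> 0 < tau <= T -> 0 <= u ->
  u * (tau ^+ n.+1 * fracLap s (barrier m1 m2 lam del c rho) x) <=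
  (lam * (u / enorm x `^ (2 * s)) + u `^ p) * (tau ^+ n.+1 * barrier m1 m2 lam del c rho x)
  - u * (n.+1%:R * tau ^+ n * barrier m1 m2 lam del c rho x)
  + (C1 * rho `^ (s * (n.+1%:R - p / (p - 1))) * barrier m1 m2 lam del c rho x
     + C2 * c `^ (- (m2 + s * (p / (p - 1)))) * \1_(cube (Num.sqrt (K * c))) x)].
Proof.
have [C [K [C0 K0 HF]]] := fracLap_barrier N0 s01 m10 m12 m2N lam0 del0 lamE lam2.
have [Ct Ct0 HT] := time_absorption p1 s0 del0 np.
have [Cy Cy0 HY] := young_half p1.
set q := p / (p - 1) in HT HY *.
have q0 : 0 < q by apply: divr_gt0; [exact: lt_trans p1|rewrite subr_gt0].
have sg0 := barrier_ratio_gt0 m12 lam0 del0; set sg := barrier_ratio _ _ _ _ in sg0.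
exists Ct, (`|T| ^+ n.+1 * (Cy * (C / sg) `^ q)), K; split => //.
  by rewrite mulr_ge0 ?exprn_ge0// mulr_ge0 ?powR_ge0.
move=> c rho x tau u c0 rho0 Kc x0 /andP[t0 tT] u0.
have := HF c rho x c0 rho0; set psi := barrier _ _ _ _ _ _ _; set b := bracket c x => /= F.
have b0 : 0 < b by exact: bracket_gt0.
have psi0 : 0 <= psi by exact: barrier_ge0.
have ex : 0 < enorm x.
  by rewrite lt_neqAle enorm_ge0 andbT eq_sym; apply: contra x0 => /eqP/enorm_eq0 ->.
have tn0 : 0 < tau ^+ n.+1 by rewrite exprn_gt0.
have utn0 : 0 <= u * tau ^+ n.+1 by apply: mulr_ge0 u0 (ltW tn0).
have tpsi0 : 0 <= tau ^+ n.+1 * psi by apply: mulr_ge0 (ltW tn0) psi0.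
have hardy : b `^ (- s) <= (enorm x `^ (2 * s))^-1.
  rewrite powRN lef_pV2 ?posrE ?powR_gt0// enorm_powR (_ : 2 * s / 2 = s); last by field.
  by rewrite ge0_ler_powR ?nnegrE ?edot_ge0 ?(ltW s0) ?(ltW b0)// lerDl ltW.
have H1 : u * tau ^+ n.+1 * (lam * b `^ (- s) * psi) <=
    lam * (u / enorm x `^ (2 * s)) * (tau ^+ n.+1 * psi).
  have k0 : 0 <= u * tau ^+ n.+1 * lam * psi by apply: mulr_ge0 => //; apply: mulr_ge0 (ltW lam0); exact: utn0.
  by have := ler_wpM2l k0 hardy; move: (b `^ _) ((enorm x `^ _)^-1) => ? ?; lra.
have H2 := ler_wpM2r psi0 (HT u tau rho u0 t0 rho0).
have H3 : u * tau ^+ n.+1 * (if b < K * c then C * b `^ (- s) * b `^ (- m2) else 0) <=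
    tau ^+ n.+1 * psi * (u `^ p / 2) +
    `|T| ^+ n.+1 * (Cy * (C / sg) `^ q) * c `^ (- (m2 + s * q)) * \1_(cube (Num.sqrt (K * c))) x.
  case: ifPn => [bK|_]; last first.
    rewrite mulr0; apply: addr_ge0.
      by apply: mulr_ge0; [exact: tpsi0|rewrite divr_ge0 ?powR_ge0].
    by rewrite indicE !mulr_ge0 ?powR_ge0 ?exprn_ge0.
  rewrite indicE mem_set ?mulr1; last exact: bracket_lt_cube bK.
  have b4 : 4 * b <= rho by apply: le_trans Kc; rewrite ler_wpM2l// ltW.
  have low := barrier_ge m10 m12 lam0 del0 c0 rho0 b4.
  have up := barrier_le m1 m2 lam0 del0 c rho0 x.
  rewrite -/psi -/b in low up; rewrite -/sg in low.
  pose Aq := C / sg * b `^ (- s).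
  have Aq0 : 0 <= Aq by rewrite mulr_ge0 ?powR_ge0 ?divr_ge0 ?(ltW sg0).
  have h1 : C * b `^ (- s) * b `^ (- m2) <= Aq * psi.
    apply: le_trans (ler_wpM2l Aq0 low); rewrite le_eqVlt; apply/orP; left; apply/eqP.
    by rewrite /Aq; field; exact: lt0r_neq0.
  have h2 := ler_wpM2r psi0 (HY Aq u Aq0 u0).
  have h3 : Aq `^ q * psi <= (C / sg) `^ q * c `^ (- (m2 + s * q)).
    rewrite /Aq powRM ?powR_ge0 ?divr_ge0 ?(ltW sg0)// -mulrA ler_wpM2l ?powR_ge0//.
    apply: le_trans (ler_wpM2l (powR_ge0 _ _) up) _.
    rewrite -powRrM -powRD; last by rewrite (gt_eqF b0) implybT.
    rewrite (_ : - s * q + - m2 = - (m2 + s * q)); last by ring.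
    rewrite !powRN lef_pV2 ?posrE ?powR_gt0//.
    rewrite ge0_ler_powR ?nnegrE ?(ltW c0) ?(ltW b0) ?bracket_ge//.
    exact: addr_ge0 (ltW m20) (mulr_ge0 (ltW s0) (ltW q0)).
  have h4 := ler_wpM2l u0 h1.
  have h5 := ler_wpM2l Cy0 h3.
  have h6 : tau ^+ n.+1 * (u * (C * b `^ (- s) * b `^ (- m2))) <=
     tau ^+ n.+1 * (u `^ p / 2 * psi + Cy * ((C / sg) `^ q * c `^ (- (m2 + s * q)))).
    apply: ler_wpM2l; first exact: ltW.
    apply: (le_trans h4); move: h2 h5; move: (Aq `^ q) (u `^ p) => ? ?; lra.
  have T1 : tau ^+ n.+1 <= `|T| ^+ n.+1.
    apply: lerXn2r; rewrite ?nnegrE ?(ltW t0)//.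
    by rewrite (le_trans tT)// ler_norm.
  have k0 : 0 <= Cy * ((C / sg) `^ q * c `^ (- (m2 + s * q))).
    by apply: mulr_ge0 Cy0 _; apply: mulr_ge0; exact: powR_ge0.
  have h7 := ler_wpM2r k0 T1.
  move: h6 h7; lra.
have H0 : u * (tau ^+ n.+1 * fracLap s (barrier m1 m2 lam del c rho) x) <=
   u * tau ^+ n.+1 * (lam * b `^ (- s) * psi - del / 2 * rho `^ (- s) * psi
     + (if b < K * c then C * b `^ (- s) * b `^ (- m2) else 0)).
  by rewrite mulrA; apply: ler_wpM2l.
apply: (le_trans H0); move: H1 H2 H3.
lra.
Qed.

End barrier_pointwise.

(** * Testing a supersolution with the barrier *)

Section almost_everywhere_combination.
Context d (X : measurableType d) (R : realType) (m : {measure set X -> \bar R}).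
Implicit Types P Q S : X -> Prop.

Lemma ae_imply P S : (forall x, P x -> S x) ->
  {ae m, forall x, P x} -> {ae m, forall x, S x}.
Proof. by move=> h; apply: filterS. Qed.

Lemma ae_imply2 P Q S : (forall x, P x -> Q x -> S x) ->
  {ae m, forall x, P x} -> {ae m, forall x, Q x} -> {ae m, forall x, S x}.
Proof. by move=> h; apply: filterS2. Qed.

Lemma ae_imply3 P Q Q' S : (forall x, P x -> Q x -> Q' x -> S x) ->
  {ae m, forall x, P x} -> {ae m, forall x, Q x} -> {ae m, forall x, Q' x} ->
  {ae m, forall x, S x}.
Proof. by move=> h; apply: filterS3. Qed.

End almost_everywhere_combination.

Section zero_extension.
Context d (X : measurableType d) (R : realType).
Variables (m : {measure set X -> \bar R}) (A B : set X).
Hypotheses (mA : measurable A) (mB : measurable B) (AB : A `<=` B).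
Variable g : X -> R.
Hypothesis g0 : forall x, B x -> ~ A x -> g x = 0.

Let patchE : (fun x => (g x)%:E) \_ A = (fun x => (g x)%:E) \_ B.
Proof.
apply/funext => x; rewrite !patchE; have [xA|xA] := pselect (A x).
  by rewrite !mem_set//; exact: AB.
by rewrite memNset//; case: ifPn => // /set_mem xB; rewrite g0.
Qed.

Lemma integral_zero_extension : (\int[m]_(x in A) (g x)%:E = \int[m]_(x in B) (g x)%:E)%E.
Proof. by rewrite integral_mkcond patchE -integral_mkcond. Qed.

Lemma integrable_zero_extension : m.-integrable A (fun x => (g x)%:E) ->
  m.-integrable B (fun x => (g x)%:E).
Proof. by move=> /(integrable_mkcond _ mA); rewrite patchE => /(integrable_mkcond _ mB). Qed.

End zero_extension.

Section estimate.
Context {R : realType}.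
Notation mu_ n := (lebesgue_rV R n).
Variables (N : nat) (s : R) (Om : set 'rV[R]_N) (T lam p : R) (f : 'rV[R]_N -> R -> R)
  (u0 : 'rV[R]_N -> R) (u : 'rV[R]_N -> R -> R) (m1 m2 del : R) (n : nat).
Hypotheses (N0 : (0 < N)%N) (s01 : 0 < s < 1) (oOm : open Om) (bOm : bounded_set Om)
  (T0 : 0 < T) (m10 : 0 < m1) (m12 : m1 < m2)
  (m2N : 0 < N%:R / 2 - (s + m2)) (lam0 : 0 < lam) (del0 : 0 < del)
  (lamE : hardy_symbol N s m1 = lam) (lam2 : hardy_symbol N s m2 = lam - del)
  (p1 : 1 < p) (np : p / (p - 1) < n.+1%:R)
  (m2p : 0 < N%:R / 2 - (m2 + s * (p / (p - 1)))).
Variable r0 : R.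
Hypotheses (r00 : 0 < r0) (r0Om : forall x : 'rV[R]_N, edot x x < r0 -> Om x).
Hypotheses (Hu : weak_supersolution s Om T (hardy_source s lam p f) u0 u)
  (f_ge0 : {ae lebesgue_xt R N, forall z, Om z.1 -> 0 < (z.2 : R) < T -> 0 <= f z.1 z.2})
  (u0_L1 : (mu_ N).-integrable Om (fun x => (u0 x)%:E))
  (u0_ge0 : {ae mu_ N, forall x, Om x -> 0 <= u0 x})
  (u_ge0 : {ae lebesgue_xt R N, forall z, Om z.1 -> 0 < (z.2 : R) < T -> 0 <= u z.1 z.2}).
Let s0 : 0 < s. Proof. by case/andP: s01. Qed.
Let mOm : measurable Om. Proof. exact: open_measurable_rV. Qed.
Let I : set (measurableTypeR R) := `]0, T[%classic.
Let mI : measurable I. Proof. exact: measurable_itv. Qed.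
Let D : set ('rV[R]_N * measurableTypeR R)%type := setT `*` I.
Let E : set ('rV[R]_N * measurableTypeR R)%type := Om `*` I.
Let mD : measurable D. Proof. exact: measurableX. Qed.
Let mE : measurable E. Proof. exact: measurableX. Qed.
Let ED : E `<=` D. Proof. by move=> z [_ ?]; split. Qed.
Let inD z : D z -> 0 < (z.2 : R) < T.
Proof. by case=> _; rewrite /I/= in_itv. Qed.

Let U (z : 'rV[R]_N * measurableTypeR R) : R := u z.1 z.2.
Let F (z : 'rV[R]_N * measurableTypeR R) : R := hardy_source s lam p f z.1 z.2 (U z).

Let mU : measurable_fun D U.
Proof.
have m := ws_measurable Hu.
apply: (measurable_funS _ _ m).
  by apply: measurableX => //; exact: (measurable_itv (`[0, T[ : interval R)).
move=> z /inD /andP[t0 tT]; split => //=; by rewrite in_itv/= ltW.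
Qed.

Let U_ge0 : {ae lebesgue_xt R N, forall z, D z -> 0 <= U z}.
Proof.
have e := ws_exterior Hu; apply: (ae_imply2 _ u_ge0 e) => z h1 h2 Dz.
have /andP[t0 tT] := inD Dz; have [Oz|nOz] := pselect (Om z.1); first by apply: h1 => //; rewrite t0.
by apply: h2 => //; rewrite tT ltW.
Qed.

Let iF : (lebesgue_xt R N).-integrable E (EFin \o F).
Proof. exact: (ws_source Hu). Qed.

Let F_ge : {ae lebesgue_xt R N, forall z, E z ->
  lam * (U z / enorm z.1 `^ (2 * s)) + U z `^ p <= F z}.
Proof.
apply: (ae_imply _ f_ge0) => z h Ez; rewrite /F /hardy_source lerDl; apply: h; first by case: Ez.
exact: (inD (ED Ez)).
Qed.

Let iU : (lebesgue_xt R N).-integrable E (EFin \o U).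
Proof.
have mUE : measurable_fun E U by exact: measurable_funS mU.
apply/integrableP; split; first exact/measurable_EFinP.
have [M M0 HM] := bounded_set_cube bOm.
pose B := Num.sqrt (N%:R * M ^+ 2) + 1; have B0 : 0 < B by rewrite ltr_wpDl ?sqrtr_ge0.
have xB x : Om x -> enorm x <= B.
  move=> Ox; rewrite (@le_trans _ _ (Num.sqrt (N%:R * M ^+ 2)))//; last by rewrite lerDl.
  by apply: ler_wsqrtr; apply: edot_cube; exact: HM.
pose b := B `^ (2 * s) / lam; have b0 : 0 <= b by rewrite divr_ge0 ?powR_ge0 ?(ltW lam0).
have iFE := iF; have [mF fF] := integrableP _ _ _ iFE.
apply: (@le_lt_trans _ _ (\int[lebesgue_xt R N]_(z in E) (b%:E * `|(F z)%:E|))%E).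
  apply: ae_ge0_le_integral => //.
  - by apply: measurableT_comp => //; exact/measurable_EFinP.
  - by move=> z _; rewrite mule_ge0.
  - by apply: measurable_funeM; exact: measurableT_comp.
  apply: (ae_imply3 _ U_ge0 F_ge (@ae_neq0 R N N0)) => z h1 h2 z0 Ez.
  have Uz := h1 (ED Ez); rewrite /= lee_fin (ger0_norm Uz).
  have ex : 0 < enorm z.1.
    by rewrite lt_neqAle enorm_ge0 andbT eq_sym; apply: contra z0 => /eqP/enorm_eq0 ->.
  have e0 : 0 < enorm z.1 `^ (2 * s) by exact: powR_gt0.
  apply: (@le_trans _ _ (b * F z)); last by rewrite ler_wpM2l// ler_norm.
  have h3 : lam * (U z / enorm z.1 `^ (2 * s)) <= F z.
    by rewrite (le_trans _ (h2 Ez))// lerDl powR_ge0.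
  apply: le_trans (ler_wpM2l b0 h3).
  have eB : enorm z.1 `^ (2 * s) <= B `^ (2 * s).
    rewrite ge0_ler_powR ?nnegrE ?enorm_ge0 ?(ltW B0) ?mulr_ge0 ?(ltW s0)//.
    by apply: xB; case: Ez.
  rewrite (_ : b * _ = U z * (B `^ (2 * s) / enorm z.1 `^ (2 * s))); last first.
    by rewrite /b; field; rewrite !lt0r_neq0.
  by rewrite ler_peMr// ler_pdivlMr// mul1r.
rewrite ge0_integralZl//; last by apply: measurableT_comp.
by rewrite lte_mul_pinfty// lee_fin.
Qed.

Let W (z : 'rV[R]_N * measurableTypeR R) : R := Num.min (Num.max (U z) 0) 1.
Let W_ge0 z : 0 <= W z. Proof. by rewrite le_min le_max lexx orbT ler01. Qed.
Let W_le1 z : W z <= 1. Proof. by rewrite ge_min lexx orbT. Qed.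
Let mW : measurable_fun D W.
Proof.
by apply: measurable_minr; [apply: measurable_maxr => //; exact: measurable_cst|exact: measurable_cst].
Qed.

Variables (rho1 h1 : R).
Hypothesis rho10 : 0 < rho1.
Let A : set 'rV[R]_N := [set x | rho1 <= edot x x] `&` cube h1.
Let mA : measurable A.
Proof.
apply: measurableI; last exact: measurable_cube0.
rewrite [X in measurable X](_ : _ = setT `&` (fun x : 'rV[R]_N => edot x x) @^-1` `[rho1, +oo[%classic).
  by apply: measurable_edot => //; exact: measurable_itv.
by apply/seteqP; split => x /=; rewrite in_itv/= andbT //; case.
Qed.

(** Truncating $u$ at height $1$ and to a bounded set makes the density
    integrable, although nothing is known about the size of $u$ outside $\Omega$;
    truncation only weakens a lower bound and keeps the zero set. *)
Definition exterior_density (z : 'rV[R]_N * measurableTypeR R) : R :=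
  W z * ((T - z.2) ^+ n.+1 * ((enorm z.1 + 1) `^ (- (N%:R + 2 * s)) * \1_A z.1)).
Let P := exterior_density.

Let time_ge0 (z : 'rV[R]_N * measurableTypeR R) m : D z -> 0 <= (T - z.2) ^+ m <= T ^+ m.
Proof. by move=> /inD /andP[/ltW t0 /ltW tT]; apply: time_le; rewrite t0. Qed.

Lemma exterior_density_ge0 z : D z -> 0 <= P z.
Proof.
move=> Dz; have /andP[t0 _] := time_ge0 n.+1 Dz.
apply: mulr_ge0 => //; apply: mulr_ge0 t0 _; apply: mulr_ge0; first exact: powR_ge0.
by rewrite indicE.
Qed.

Let P_le z : D z -> P z <= \1_A z.1 * T ^+ n.+1.
Proof.
move=> Dz; have /andP[t0 tT] := time_ge0 n.+1 Dz.
have i0 : 0 <= \1_A z.1 :> R by rewrite indicE.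
have k1 : (enorm z.1 + 1) `^ (- (N%:R + 2 * s)) <= 1.
  rewrite powRN invf_le1 ?powR_gt0// ?ltr_wpDl ?enorm_ge0//.
  rewrite -[leLHS](powRr0 (enorm z.1 + 1)) ler_powR ?lerDr ?enorm_ge0//.
  by rewrite addr_ge0// mulr_ge0// ltW.
have k0 := powR_ge0 (enorm z.1 + 1) (- (N%:R + 2 * s)).
rewrite /P /exterior_density -[leRHS]mul1r; apply: ler_pM => //.
  by apply: mulr_ge0 t0 _; exact: mulr_ge0.
by rewrite mulrC; apply: ler_pM => //; [exact: mulr_ge0|rewrite ler_piMl].
Qed.

Let mtime m : measurable_fun setT (fun z : 'rV[R]_N * measurableTypeR R => (T - z.2) ^+ m).
Proof.
apply: (measurableT_comp (continuous_measurable_fun (@continuous_time R T m))).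
exact: measurable_snd.
Qed.

Let mP : measurable_fun D P.
Proof.
apply: measurable_funM => //; apply: measurable_funTS; apply: measurable_funM; first exact: mtime.
apply: measurable_funM.
  by apply: measurable_powR_comp; apply: measurable_funD; [meas|exact: measurable_cst].
by apply: measurable_comp_rV; [exact: measurable_indic|meas].
Qed.

Let i1T (k : R) : (@lebesgue_measure R).-integrable I (EFin \o cst k).
Proof.
apply/integrableP; split; first by apply/measurable_EFinP; exact: measurable_cst.
rewrite (eq_integral (cst `|k|%:E))// integral_cst//.
have e := lebesgue_measure_itv `]0%R, T[; rewrite /= lte_fin T0 -EFinB in e.
by rewrite [X in (_ * X)%E]e -EFinM ltry.
Qed.

Let int1T (k : R) : \int[@lebesgue_measure R]_(t in I) k = k * T.
Proof.
have e := lebesgue_measure_itv `]0%R, T[; rewrite /= lte_fin T0 -EFinB subr0 in e.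
rewrite Rintegral_cst//; congr (_ * _).
exact: (congr1 fine e).
Qed.

Let sepI (a : 'rV[R]_N -> R) k : (mu_ N).-integrable setT (EFin \o a) ->
  (lebesgue_xt R N).-integrable D (fun z => (a z.1 * k)%:E).
Proof.
move=> ia; exact: (@integrable_separated _ _ _ (measurableTypeR R) R (mu_ N) (@lebesgue_measure R)
  setT I a (cst k) measurableT mI ia (i1T k)).
Qed.

Let sepE (a : 'rV[R]_N -> R) k : (mu_ N).-integrable setT (EFin \o a) ->
  \int[lebesgue_xt R N]_(z in D) (a z.1 * k) = (\int[mu_ N]_x a x) * (k * T).
Proof.
move=> ia; rewrite -int1T.
exact: (@Rintegral_separated _ _ _ (measurableTypeR R) R (mu_ N) (@lebesgue_measure R)
  setT I a (cst k) measurableT mI ia (i1T k)).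
Qed.

Let Ecube h : 0 <= h -> (\int[mu_ N]_x (\1_(cube h) x)%:E = ((h *+ 2) ^+ N)%:E)%E.
Proof.
move=> h0; rewrite -[in RHS](mul1r (_ ^+ N)) -integral_cube//.
by apply: eq_integral => x _; rewrite mul1r.
Qed.

Let icube h : 0 <= h -> (mu_ N).-integrable setT (EFin \o (\1_(cube h) : 'rV[R]_N -> R)).
Proof.
move=> h0; apply: ge0_integrabler.
- by apply: measurable_indic; exact: measurable_cube0.
- by move=> x; rewrite indicE.
by rewrite (Ecube h0) ltry.
Qed.

Let Rcube h : 0 <= h -> \int[mu_ N]_x (\1_(cube h) x : R) = (h *+ 2) ^+ N.
Proof.
by move=> h0; rewrite /Rintegral (Ecube h0).
Qed.

Lemma integrable_exterior_density : (lebesgue_xt R N).-integrable D (EFin \o P).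
Proof.
have iA : (mu_ N).-integrable setT (EFin \o (\1_A : 'rV[R]_N -> R)).
  have [h0|h0] := leP 0 h1.
    apply: (le_integrable measurableT _ _ (icube h0)).
      by apply/measurable_EFinP; exact: measurable_indic.
    move=> x _; rewrite /= lee_fin !indicE !ger0_norm// ler_nat.
    by case: (boolP (x \in A)) => // /set_mem[_ ?]; rewrite mem_set.
  rewrite (_ : EFin \o _ = cst 0%E); first exact: integrable0.
  apply/funext => x /=; rewrite indicE memNset// => -[_ /(_ (Ordinal N0)) h].
  by move: (le_lt_trans (le_trans (normr_ge0 _) h) h0); rewrite ltxx.
apply: (le_integrable mD _ _ (sepI (T ^+ n.+1) iA)); first exact/measurable_EFinP.
move=> z Dz; have P0 := exterior_density_ge0 Dz; rewrite /= lee_fin (ger0_norm P0).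
by rewrite (le_trans (P_le Dz))// ler_norm.
Qed.

(** The inequality obtained by testing with $(T-t)^{n+1}$ times the barrier. *)
Lemma tested_inequality (c rho C1 C2 : R) :
  0 < c -> 0 < rho -> rho <= rho1 -> rho <= 1 -> rho <= r0 -> 0 <= C1 -> 0 <= C2 ->
  forall h, 0 <= h ->
  (forall (x : 'rV[R]_N) (tau u : R), x != 0 -> 0 < tau <= T -> 0 <= u ->
    let psi := barrier m1 m2 lam del c rho x : R in
    u * (tau ^+ n.+1 * fracLap s (barrier m1 m2 lam del c rho) x) <=
    (lam * (u / enorm x `^ (2 * s)) + u `^ p) * (tau ^+ n.+1 * psi)
    - u * (n.+1%:R * tau ^+ n * psi) + (C1 * psi + C2 * \1_(cube h) x)) ->
  let mass := barrier_mass N m1 m2 lam del c rho in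
  fracLap_const N s * mass * \int[lebesgue_xt R N]_(z in D) P z <=
    C1 * (mass * T) + C2 * ((h *+ 2) ^+ N * T).
Proof.
move=> c0 rho0 rr1 rr2 rr0 C10 C20 h h0 HP /=; set mass := barrier_mass _ _ _ _ _ _ _.
have [C rC] := regular_barrier N m10 m12 lam0 del0 c0 rho0.
rewrite /= in HP; set psi := barrier m1 m2 lam del c rho in rC HP.
have psi0 x : 0 <= psi x by exact: barrier_ge0.
have [mpsi C0 bpsi _ _] := rC.
have psi_ext x : ~ Om x -> psi x = 0.
  move=> nOx; apply: barrier_out => //; rewrite (le_trans rr0)// leNgt; apply/negP => /r0Om.
  exact: nOx.
have mass0 : 0 <= mass by exact: barrier_mass_ge0.
have cst0 := @fracLap_const_gt0 R N s s01; set a := fracLap_const N s in cst0 *.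
have mpsi1 : measurable_fun setT (fun z : 'rV[R]_N * measurableTypeR R => psi z.1).
  by apply: measurable_comp_rV => //; meas.
pose phi (z : 'rV[R]_N * measurableTypeR R) := (T - z.2) ^+ n.+1 * psi z.1.
pose g1 z := U z * (n.+1%:R * (T - z.2) ^+ n * psi z.1).
pose g3 z := F z * phi z.
pose Q z := U z * ((T - z.2) ^+ n.+1 * fracLap s psi z.1).
have mphi : measurable_fun setT phi by apply: measurable_funM => //; exact: mtime.
have i1E : (lebesgue_xt R N).-integrable E (fun z => (g1 z)%:E).
  apply: (le_integrable mE _ _ (integrableZl mE (n.+1%:R * T ^+ n * C) iU)).
    apply/measurable_EFinP; apply: measurable_funM; first exact: measurable_funS mU.
    apply: measurable_funTS; apply: measurable_funM => //.
    by apply: measurable_funM; [exact: measurable_cst|exact: mtime].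
  move=> z Ez; have /andP[t0 tT] := time_ge0 n (ED Ez).
  have a1 : `|n.+1%:R : R| * `|(T - z.2) ^+ n| <= `|n.+1%:R : R| * `|T ^+ n|.
    by rewrite ler_wpM2l// (ger0_norm t0) (le_trans tT)// ler_norm.
  have a2 : `|psi z.1| <= `|C| by rewrite (le_trans (bpsi _))// ler_norm.
  rewrite /= lee_fin /g1 (normrM (U z)) [leRHS]normrM [leRHS]mulrC; apply: ler_wpM2l => //.
  rewrite (normrM _ (psi z.1)) (normrM n.+1%:R) (normrM _ C) (normrM n.+1%:R (T ^+ n)).
  exact: (ler_pM (mulr_ge0 (normr_ge0 _) (normr_ge0 _)) (normr_ge0 _) a1 a2).
have i3E : (lebesgue_xt R N).-integrable E (fun z => (g3 z)%:E).
  apply: (le_integrable mE _ _ (integrableZl mE (T ^+ n.+1 * C) iF)).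
    apply/measurable_EFinP; apply: measurable_funM.
      by apply/measurable_EFinP; case/integrableP: iF.
    exact: measurable_funTS.
  move=> z Ez; have /andP[t0 tT] := time_ge0 n.+1 (ED Ez).
  have a1 : `|(T - z.2) ^+ n.+1| <= `|T ^+ n.+1|.
    by rewrite (ger0_norm t0) (le_trans tT)// ler_norm.
  have a2 : `|psi z.1| <= `|C| by rewrite (le_trans (bpsi _))// ler_norm.
  rewrite /= lee_fin /g3 (normrM (F z)) [leRHS]normrM [leRHS]mulrC; apply: ler_wpM2l => //.
  rewrite /phi (normrM _ (psi z.1)) (normrM _ C).
  exact: (ler_pM (normr_ge0 _) (normr_ge0 _) a1 a2).
have e13 z : D z -> ~ E z -> g1 z = 0 /\ g3 z = 0.
  move=> [_ Iz] nE; have nO : ~ Om z.1 by move=> Oz; apply: nE.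
  by rewrite /g1 /g3 /phi psi_ext// !mulr0.
have i1 : (lebesgue_xt R N).-integrable D (fun z => (g1 z)%:E).
  by apply: (integrable_zero_extension mE mD ED) i1E => z Dz nE; case: (e13 _ Dz nE).
have i3 : (lebesgue_xt R N).-integrable D (fun z => (g3 z)%:E).
  by apply: (integrable_zero_extension mE mD ED) i3E => z Dz nE; case: (e13 _ Dz nE).
have WI := ws_inequality Hu (test_fun_class n N0 s01 oOm bOm T0 rC psi_ext).
have {WI} WI := WI (fun x t h => mulr_ge0 (proj1 (andP (time_le n.+1 h))) (psi0 x)).
have EQ1 : (\int[lebesgue_xt R N]_(z in Om `*` `]0%R, T[)
    (u z.1 z.2 * - derive1 (test_fun T n psi z.1) z.2)%:E
    = \int[lebesgue_xt R N]_(z in D) (g1 z)%:E)%E.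
  transitivity (\int[lebesgue_xt R N]_(z in E) (g1 z)%:E)%E.
    apply: eq_integral => z _; congr EFin; have d := derive_test_fun T n psi z.1 z.2.
    by rewrite derive1E (derive_val (is_derive := d)) mulNr opprK.
  by apply: (integral_zero_extension (lebesgue_xt R N) ED) => z Dz nE; case: (e13 _ Dz nE).
have EQ3 : (\int[lebesgue_xt R N]_(z in Om `*` `]0%R, T[)
    (hardy_source s lam p f z.1 z.2 (u z.1 z.2) * test_fun T n psi z.1 z.2)%:E
    = \int[lebesgue_xt R N]_(z in D) (g3 z)%:E)%E.
  by apply: (integral_zero_extension (lebesgue_xt R N) ED) => z Dz nE; case: (e13 _ Dz nE).
have EQ2 : (\int[lebesgue_xt R N]_(z in [set: 'rV[R]_N] `*` `]0%R, T[)
    (u z.1 z.2 * fracLap s (test_fun T n psi ^~ z.2) z.1)%:E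
    = \int[lebesgue_xt R N]_(z in D) (Q z)%:E)%E.
  by apply: eq_integral => z _; rewrite (fracLap_test_fun T n N0 s01 rC).
have I0 : (0 <= \int[mu_ N]_(x in Om) (u0 x * test_fun T n psi x 0%R)%:E)%E.
  apply: ae_integral_ge0 => //.
    apply/measurable_EFinP; apply: measurable_funM.
      by apply/measurable_EFinP; case/integrableP: u0_L1.
    by apply: measurable_funTS; apply: measurable_funM => //; exact: measurable_cst.
  apply: (ae_imply _ u0_ge0) => x h' Ox; rewrite lee_fin mulr_ge0 ?h'// mulr_ge0//.
  by rewrite exprn_ge0// subr0 ltW.
rewrite {}EQ1 {}EQ2 {}EQ3 in WI.
have ipsi : (mu_ N).-integrable setT (EFin \o psi).
  by apply: ge0_integrabler => //; exact: integral_barrier_lty.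
have j1 := sepI C1 ipsi; have j2 := sepI C2 (icube h0).
have jP := integrable_exterior_density.
have j3 := integrableZl mD (a * mass) jP.
pose Rm (z : 'rV[R]_N * measurableTypeR R) :=
  psi z.1 * C1 + \1_(cube h) z.1 * C2 - a * mass * P z.
have jR : (lebesgue_xt R N).-integrable D (fun z => (Rm z)%:E).
  exact: (integrableB mD (integrableD mD j1 j2) j3).
have jB : (lebesgue_xt R N).-integrable D (fun z => (g3 z - g1 z)%:E) by exact: (integrableB mD i3 i1).
have jS : (lebesgue_xt R N).-integrable D (fun z => (g3 z - g1 z + Rm z)%:E).
  exact: (integrableD mD jB jR).
have mL : measurable_fun setT (fracLap s psi).
  rewrite (_ : fracLap s psi = fun x => fracLap_const N s / 2 * symLap s psi x).
    by apply: measurable_funM; [exact: measurable_cst|exact: (measurable_symLap s rC)].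
  by apply/funext => x; rewrite (fracLap_regular N0 s01 rC).
have mQ : measurable_fun D Q.
  apply: measurable_funM => //; apply: measurable_funTS; apply: measurable_funM; first exact: mtime.
  by apply: measurable_comp_rV => //; meas.
have QR : (\int[lebesgue_xt R N]_(z in D) (Q z)%:E <=
    \int[lebesgue_xt R N]_(z in D) (g3 z - g1 z + Rm z)%:E)%E.
  apply: ae_le_integral => //; first exact/measurable_EFinP.
    by case/integrableP: jS.
  apply: (ae_imply3 _ U_ge0 F_ge (@ae_neq0 R N N0)) => -[x t] hU hF x0 Dz.
  have Uz := hU Dz; rewrite lee_fin; rewrite /= in x0.
  have t0T : 0 < T - t <= T by have /andP[/= ? ?] := inD Dz; apply/andP; split; lra.
  have tn : 0 <= (T - t) ^+ n.+1 by have /andP[] := time_ge0 n.+1 Dz.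
  have Cc : 0 <= \1_(cube h) x * C2 :> R by rewrite mulr_ge0// indicE.
  have [Ax|nAx] := pselect (A x).
    have rx : rho <= edot x x by case: Ax => ? _; exact: le_trans rr1 _.
    have px : psi x = 0 by exact: barrier_out.
    rewrite /g3 /g1 /phi /Rm /Q /= px !mulr0 subrr add0r mul0r add0r.
    have fl := fracLap_barrier_far N0 s01 m10 m12 lam0 del0 c0 rho0 rx.
    apply: (@le_trans _ _ (- (a * mass * P (x, t)))); last by rewrite lerDr.
    rewrite /P /exterior_density /= indicE mem_set// mulr1.
    set k := (enorm x + 1) `^ _; set k' := (enorm x + Num.sqrt rho) `^ _ in fl.
    have sr : 0 < Num.sqrt rho by rewrite sqrtr_gt0.
    have kk : k <= k'.
      have e0 : 0 <= N%:R + 2 * s by rewrite addr_ge0// mulr_ge0// ltW.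
      have ex := enorm_ge0 x.
      have kb : enorm x + Num.sqrt rho <= enorm x + 1.
        by rewrite lerD2l -[leRHS]sqrtr1; apply: ler_wsqrtr.
      rewrite /k /k' !powRN lef_pV2 ?posrE ?powR_gt0 ?ltr_wpDl//.
      by apply: (ge0_ler_powR e0 _ _ kb); rewrite nnegrE addr_ge0// ltW.
    have WU : W (x, t) <= U (x, t) by rewrite ge_min ge_max lexx Uz.
    have k0 : 0 <= k by exact: powR_ge0.
    have Wk : W (x, t) * k <= U (x, t) * k' by apply: ler_pM.
    have am : 0 <= a * mass by rewrite mulr_ge0// ltW.
    have h1' := ler_wpM2l (mulr_ge0 am tn) Wk.
    have h2' := ler_wpM2l (mulr_ge0 Uz tn) fl.
    move: h1' h2'; rewrite -/a -/mass -/psi; lra.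
  have P0 : P (x, t) = 0 by rewrite /P /exterior_density /= indicE memNset// !mulr0.
  have H := HP x (T - t) (U (x, t)) x0 t0T Uz.
  have Hphi : (lam * (U (x, t) / enorm x `^ (2 * s)) + U (x, t) `^ p) * phi (x, t) <= g3 (x, t).
    have [Ox|nOx] := pselect (Om x).
      rewrite /g3; apply: ler_wpM2r; first exact: mulr_ge0.
      by apply: hF; split => //; case: Dz.
    by rewrite /g3 /phi /= psi_ext// !mulr0.
  by move: H Hphi; rewrite /Q /g1 /Rm P0 /phi /= -/psi; lra.
have F1 := integrable_fin_num mD i1; have F3 := integrable_fin_num mD i3.
have FR := integrable_fin_num mD jR.
have SE : (\int[lebesgue_xt R N]_(z in D) (g3 z - g1 z + Rm z)%:E
   = \int[lebesgue_xt R N]_(z in D) (g3 z)%:E - \int[lebesgue_xt R N]_(z in D) (g1 z)%:E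
     + \int[lebesgue_xt R N]_(z in D) (Rm z)%:E)%E.
  transitivity (\int[lebesgue_xt R N]_(z in D) ((g3 z - g1 z)%:E + (Rm z)%:E))%E.
    by apply: eq_integral => z _; rewrite EFinD.
  rewrite integralD//; congr (_ + _)%E.
  transitivity (\int[lebesgue_xt R N]_(z in D) ((g3 z)%:E - (g1 z)%:E))%E.
    by apply: eq_integral => z _; rewrite EFinB.
  by rewrite integralB.
rewrite SE -(fineK F1) -(fineK F3) -(fineK FR) in QR; rewrite -(fineK F1) -(fineK F3) in WI.
have RE : fine (\int[lebesgue_xt R N]_(z in D) (Rm z)%:E)%E =
    mass * (C1 * T) + (h *+ 2) ^+ N * (C2 * T)
    - a * mass * \int[lebesgue_xt R N]_(z in D) P z.
  transitivity (\int[lebesgue_xt R N]_(z in D) Rm z); first by [].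
  rewrite /Rm RintegralB//; [|exact: (integrableD mD j1 j2)].
  rewrite RintegralD// (sepE C1 ipsi) (sepE C2 (icube h0)) Rcube//.
  by rewrite RintegralZl.
rewrite RE in QR.
have := le_trans (le_trans (leeDl _ I0) WI) (leeD2l _ QR).
rewrite -!EFinB -!EFinD lee_fin; lra.
Qed.

(** The radius $\sqrt\rho$ of the barrier is fixed first, so that its mass stays
    bounded below while the regularization [c] is made small. *)
Lemma exterior_density_integral0 : \int[lebesgue_xt R N]_(z in D) P z = 0.
Proof.
have [C1 [C2 [K [C10 C20 K0 HB]]]] :=
  barrier_pointwise T N0 s01 m10 m12 m2N lam0 del0 lamE lam2 p1 np.
set q := p / (p - 1) in HB.
have M0 : 0 < s * (n.+1%:R - q) by rewrite mulr_gt0// subr_gt0.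
have cst0 := @fracLap_const_gt0 R N s s01; set a := fracLap_const N s in cst0.
set V := \int[_]_(z in D) _.
have V0 : 0 <= V.
  apply: fine_ge0; apply: integral_ge0 => z Dz; rewrite lee_fin; exact: exterior_density_ge0.
suff Veta eta : 0 < eta -> a * V <= eta.
  apply/eqP; rewrite eq_le V0 andbT leNgt; apply/negP => Vp.
  have aV : 0 < a * V by exact: mulr_gt0.
  by have := Veta (a * V / 2) ltac:(by rewrite divr_gt0); lra.
move=> eta0; have eta2 : 0 < eta / 2 by rewrite divr_gt0.
have C1T : 0 <= C1 * T by rewrite mulr_ge0// ltW.
have [rA rA0 HrA] := powR_small M0 C1T eta2.
pose rho := Num.min (Num.min rho1 1) (Num.min r0 rA).
have rho0 : 0 < rho by rewrite !lt_min rho10 r00 rA0 ltr01.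
have [/andP[ra rb] /andP[rc rd]] : (rho <= rho1 <= rho1) && (rho <= 1) /\ (rho <= r0) && (rho <= rA).
  by split; rewrite ?lexx ?andbT !ge_min !lexx ?orbT.
have {}ra : rho <= rho1 by case/andP: ra.
pose J := barrier_ratio m1 m2 lam del * (rho / 4) `^ (- m2) *
  ((Num.sqrt rho / (4 * N%:R)) *+ 2) ^+ N.
have J0 : 0 < J.
  apply: mulr_gt0; first apply: mulr_gt0; first exact: barrier_ratio_gt0.
    by rewrite powR_gt0// divr_gt0.
  by rewrite exprn_gt0// pmulrn_lgt0// divr_gt0 ?sqrtr_gt0// mulr_gt0// ltr0n.
pose Z := C2 * T * (2 * Num.sqrt K) ^+ N.
have Z0 : 0 <= Z.
  apply: mulr_ge0; first by rewrite mulr_ge0// ltW.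
  by rewrite exprn_ge0// mulr_ge0 ?sqrtr_ge0.
have ZJ : 0 <= Z / J by rewrite divr_ge0// ltW.
have [cA cA0 HcA] := powR_small m2p ZJ eta2.
pose c := Num.min cA (Num.min (rho / 8) (rho / (4 * K))).
have c0 : 0 < c by rewrite !lt_min cA0 !divr_gt0// mulr_gt0.
have cc1 : c <= cA by rewrite ge_min lexx.
have cc2 : 8 * c <= rho.
  by rewrite mulrC -ler_pdivlMr// !ge_min lexx !orbT.
have cc3 : 4 * (K * c) <= rho.
  by rewrite mulrA mulrC -ler_pdivlMr ?mulr_gt0// !ge_min lexx !orbT.
have mJ := barrier_mass_ge N0 m10 m12 lam0 del0 c0 rho0 cc2; rewrite -/J in mJ.
set mass := barrier_mass _ _ _ _ _ _ _ in mJ.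
have mass0 : 0 < mass by exact: lt_le_trans mJ.
have C1' : 0 <= C1 * rho `^ (s * (n.+1%:R - q)) by rewrite mulr_ge0 ?powR_ge0.
have C2' : 0 <= C2 * c `^ (- (m2 + s * q)) by rewrite mulr_ge0 ?powR_ge0.
have TI := tested_inequality c0 rho0 ra rb rc C1' C2' (sqrtr_ge0 (K * c))
  (fun x tau v x0 tau0 v0 => HB c rho x tau v c0 rho0 cc3 x0 tau0 v0).
rewrite /= -/mass -/a -/V in TI.
have core : C2 * c `^ (- (m2 + s * q)) * ((Num.sqrt (K * c) *+ 2) ^+ N * T)
    = Z * c `^ (N%:R / 2 - (m2 + s * q)).
  rewrite powRD; last by rewrite (gt_eqF c0) implybT.
  rewrite (_ : c `^ (N%:R / 2) = Num.sqrt c ^+ N); last first.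
    rewrite -powR12_sqrt ?(ltW c0)// -powR_mulrn ?powR_ge0// -powRrM; congr (_ `^ _); ring.
  have -> : (Num.sqrt (K * c) *+ 2) ^+ N = (2 * Num.sqrt K) ^+ N * Num.sqrt c ^+ N.
    by rewrite -exprMn (sqrtrM _ (ltW K0)); congr (_ ^+ _); ring.
  by rewrite /Z; ring.
rewrite core in TI.
have h1' := HrA rho rho0 rd.
have h2' := HcA c c0 cc1.
have h3' : Z * c `^ (N%:R / 2 - (m2 + s * q)) <= eta / 2 * mass.
  apply: (@le_trans _ _ (eta / 2 * J)); last by rewrite ler_wpM2l// ltW.
  by rewrite -ler_pdivrMr// mulrAC.
have h4' := ler_wpM2r (ltW mass0) h1'.
rewrite -(ler_pM2r mass0); move: TI h3' h4'; lra.
Qed.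

Lemma exterior_nonpos : {ae lebesgue_xt R N, forall z, 0 < (z.2 : R) < T ->
  rho1 <= edot z.1 z.1 -> cube h1 z.1 -> u z.1 z.2 <= 0}.
Proof.
have jP := integrable_exterior_density.
have E0 : (\int[lebesgue_xt R N]_(z in D) `|(EFin \o P) z| = 0)%E.
  rewrite (eq_integral (EFin \o P)); last first.
    by move=> z /set_mem Dz; rewrite /= ger0_norm//; exact: exterior_density_ge0.
  have finP := integrable_fin_num mD jP.
  by rewrite -(fineK finP); congr EFin; exact: exterior_density_integral0.
have mPE : measurable_fun D (EFin \o P) by exact/measurable_EFinP.
have /(ae_eq_integral_abs _ mD mPE) := E0; apply: ae_imply => z h zT rz cz.
have Dz : D z by split => //=; rewrite /I/= in_itv.
have := h Dz; rewrite /= => -[].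
rewrite /P /exterior_density indicE mem_set//= mulr1 => /eqP.
rewrite !mulf_eq0 => /orP[/eqP W0|]; last first.
  rewrite (gt_eqF (powR_gt0 _ _)) ?ltr_wpDl ?enorm_ge0// orbF expf_eq0/= subr_eq0.
  by move=> /eqP TE; move: zT; rewrite -TE ltxx andbF.
rewrite leNgt; apply/negP => u0'; have : 0 < W z by rewrite lt_min lt_max u0' ltr01.
by rewrite W0 ltxx.
Qed.

End estimate.

(** * Vanishing of supersolutions *)

Section countable_almost_everywhere.
Context d (X : measurableType d) (R : realType) (m : {measure set X -> \bar R}).

Lemma ae_forall_nat (P : nat -> X -> Prop) :
  (forall k, {ae m, forall x, P k x}) -> {ae m, forall x, forall k, P k x}.
Proof.
move=> h; apply: negligibleS (negligible_bigcup h) => x /= /existsNP[k nP].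
by exists k.
Qed.

End countable_almost_everywhere.

Section vanishing.
Context {R : realType}.
Notation mu_ n := (lebesgue_rV R n).
Variables (N : nat) (s : R) (Om : set 'rV[R]_N) (T lam alpha p : R)
  (f : 'rV[R]_N -> R -> R) (u0 : 'rV[R]_N -> R).
Hypotheses (s01 : 0 < s < 1) (hN : 2 * s < N%:R) (oOm : open Om) (bOm : bounded_set Om)
  (Om0 : Om 0) (T0 : 0 < T) (lam0 : 0 < lam)
  (ha : 0 <= alpha < (N%:R - 2 * s) / 2) (lamE : lam = hardy_param N s alpha)
  (hp : p_plus N s alpha < p).
Let s0 : 0 < s. Proof. by case/andP: s01. Qed.

Lemma dimension_gt0 : (0 < N)%N.
Proof. by rewrite -(ltr0n R); apply: le_lt_trans hN; rewrite mulr_ge0// ltW. Qed.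

Lemma p_gt1 : 1 < p.
Proof.
apply: le_lt_trans hp; rewrite /p_plus lerDl divr_ge0//; first by rewrite mulr_ge0// ltW.
by case/andP: ha => _; lra.
Qed.

Lemma open_contains_ball : exists2 r0, 0 < r0 & forall x : 'rV[R]_N, edot x x < r0 -> Om x.
Proof.
have /nbhs_ballP[e /= e0 He] : nbhs (0 : 'rV[R]_N) Om by exact: open_nbhs_nbhs.
exists (e ^+ 2); first by rewrite exprn_gt0.
move=> x xe; apply: He; split=> // i j; rewrite ord1 mxE -ball_normE /= sub0r normrN.
apply: le_lt_trans (coord_le_enorm x j) _.
by rewrite -(ltr_pXn2r (n := 2)) ?nnegrE ?enorm_ge0 ?(ltW e0)// sqr_enorm.
Qed.

Lemma domain_measure_gt0 :
  ~ {ae lebesgue_xt R N, forall z, Om z.1 -> 0 < (z.2 : R) < T -> False}.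
Proof.
have N0 := dimension_gt0; have [r0 r00 Hr0] := open_contains_ball.
have N1 : 1 <= N%:R :> R by rewrite ler1n.
pose h := Num.sqrt r0 / (2 * N%:R).
have h0 : 0 < h by rewrite divr_gt0 ?sqrtr_gt0// mulr_gt0// ltr0n.
have cO x : cube h x -> Om x.
  move=> /edot_cube e; apply: Hr0; apply: (le_lt_trans e).
  have Nn : N%:R != 0 :> R by rewrite pnatr_eq0 -lt0n.
  have -> : N%:R * h ^+ 2 = Num.sqrt r0 ^+ 2 / 4 * N%:R^-1 by rewrite /h; field.
  rewrite (sqr_sqrtr (ltW r00)); apply: (@le_lt_trans _ _ (r0 / 4)); last by lra.
  by rewrite ler_piMr ?divr_ge0 ?(ltW r00)// invf_le1//; exact: lt_le_trans N1.
have mC := @measurable_cube0 R N h.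
have mI : measurable (`]0, T[%classic : set (measurableTypeR R)) by exact: measurable_itv.
move=> [Z [mZ Z0 HZ]].
have sub : cube h `*` (`]0, T[%classic : set (measurableTypeR R)) `<=` Z.
  move=> z [/= zc zT]; apply: HZ => /=; apply; first exact: cO.
  by rewrite in_itv/= in zT.
have M0 := subset_measure0 (measurableX mC mI) mZ sub Z0.
have : (mu_ N (cube h) * @lebesgue_measure R `]0%R, T[ = 0)%E.
  rewrite -[RHS]M0; symmetry.
  exact: (product_measure1E (mu_ N) (@lebesgue_measure R) mC mI).
have -> : mu_ N (cube h) = ((h *+ 2) ^+ N)%:E by apply: lebesgue_rV_cube; exact: ltW.
have -> : @lebesgue_measure R `]0%R, T[ = T%:E.
  by rewrite lebesgue_measure_itv/= lte_fin T0 -EFinB subr0.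
rewrite -EFinM => -[/eqP]; rewrite gt_eqF// mulr_gt0// exprn_gt0// pmulrn_lgt0//.
Qed.

(** Choice of the exponents: twice $m_2$ lies strictly between the Hardy
    exponent $2m_1$ and $N-2sp/(p-1)$, which is possible exactly when $p>p_+$. *)
Lemma supersolution_vanishes u :
  {ae lebesgue_xt R N, forall z, Om z.1 -> 0 < (z.2 : R) < T -> 0 <= f z.1 z.2} ->
  (mu_ N).-integrable Om (fun x => (u0 x)%:E) ->
  {ae mu_ N, forall x, Om x -> 0 <= u0 x} ->
  weak_supersolution s Om T (hardy_source s lam p f) u0 u ->
  {ae lebesgue_xt R N, forall z, Om z.1 -> 0 < (z.2 : R) < T -> 0 <= u z.1 z.2} ->
  {ae lebesgue_xt R N, forall z, 0 <= (z.2 : R) < T -> u z.1 z.2 = 0}.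
Proof.
move=> f_ge0 u0_L1 u0_ge0 Hu u_ge0.
have N0 := dimension_gt0; have p1 := p_gt1; have [r0 r00 Hr0] := open_contains_ball.
have pm1 : 0 < p - 1 by rewrite subr_gt0.
have /andP[a0 a1] := ha.
pose q := p / (p - 1).
have qE : q = 1 + (p - 1)^-1 by rewrite /q; field; exact: lt0r_neq0.
pose m1 := ((N%:R - 2 * s) / 2 + alpha) / 2.
have m10 : 0 < m1 by rewrite /m1; move: hN a0; lra.
have lamE1 : hardy_symbol N s m1 = lam by rewrite lamE hardy_paramE.
have gap : s * (p - 1)^-1 < ((N%:R - 2 * s) / 2 - alpha) / 2.
  have d0 : 0 < (N%:R - 2 * s) / 2 - alpha by lra.
  move: hp; rewrite /p_plus -ltrBrDl ltr_pdivrMr// => h.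
  by rewrite ltr_pdivrMr//; lra.
have sp0 : 0 < s * (p - 1)^-1 by rewrite mulr_gt0// invr_gt0.
pose m2 := (m1 + (N%:R / 2 - s * q)) / 2.
have sq : s * q = s + s * (p - 1)^-1 by rewrite qE; ring.
have m12 : m1 < m2 by rewrite /m2 sq /m1; lra.
have m2N : 0 < N%:R / 2 - (s + m2) by rewrite /m2 sq /m1; lra.
have m2p : 0 < N%:R / 2 - (m2 + s * (p / (p - 1))).
  by rewrite -/q /m2 sq /m1; lra.
pose del := lam - hardy_symbol N s m2.
have del0 : 0 < del.
  by rewrite subr_gt0 -lamE1; apply: hardy_symbol_lt => //; [rewrite /m1; lra|lra].
have lam2 : hardy_symbol N s m2 = lam - del by rewrite /del; ring.
have np : p / (p - 1) < (Num.bound q).+1%:R.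
  have q0 : 0 <= q by rewrite divr_ge0 ?(ltW pm1)//; lra.
  by apply: (lt_trans (archi_boundP q0)); rewrite ltr_nat.
have Hk (k : nat) := @exterior_nonpos R N s Om T lam p f u0 u m1 m2 del (Num.bound q)
  N0 s01 oOm bOm T0 m10 m12 m2N lam0 del0 lamE1 lam2 p1 np m2p r0 r00 Hr0 Hu f_ge0 u0_L1
  u0_ge0 u_ge0 (k.+1%:R^-1) (k%:R) ltac:(by rewrite invr_gt0 ltr0n).
have H1 := ae_forall_nat Hk.
have H2 : {ae lebesgue_xt R N, forall z, 0 < (z.2 : R) < T -> 0 <= u z.1 z.2}.
  apply: (ae_imply2 _ u_ge0 (ws_exterior Hu)) => z h1 h2 zT.
  have [Oz|nOz] := pselect (Om z.1); [exact: h1|apply: h2 => //].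
  by case/andP: zT => /ltW -> ->.
have H3 : {ae lebesgue_xt R N, forall z, z.1 != 0 /\ (z.2 : R) != 0}.
  by apply: (ae_imply2 _ (@ae_neq0 R N N0) (@ae_time_neq0 R N)) => z ? ?; split.
apply: (ae_imply3 _ H1 H2 H3) => z hz hU [x0 t0] /andP[t0' tT].
have zT : 0 < (z.2 : R) < T by rewrite lt_neqAle eq_sym t0 t0' tT.
apply/eqP; rewrite eq_le; apply/andP; split; last exact: hU.
have e0 : 0 < edot z.1 z.1.
  rewrite -sqr_enorm exprn_gt0// lt_neqAle enorm_ge0 andbT eq_sym.
  by apply: contra x0 => /eqP/enorm_eq0 ->.
pose B := (edot z.1 z.1)^-1 + enorm z.1.
have B0 : 0 <= B by rewrite addr_ge0 ?invr_ge0 ?(ltW e0) ?enorm_ge0.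
have BB := archi_boundP B0.
apply: (hz (Num.bound B)) => //.
  rewrite invf_ple ?posrE ?ltr0n//; apply: (@le_trans _ _ B); first by rewrite lerDl enorm_ge0.
  by rewrite (le_trans (ltW BB))// ler_nat.
move=> i; rewrite (le_trans (coord_le_enorm _ i))// (le_trans _ (ltW BB))//.
by rewrite lerDr invr_ge0 ltW.
Qed.

Lemma zero_supersolution :
  measurable_fun (Om `*` `]0, T[) (fun z : 'rV[R]_N * R => f z.1 z.2) ->
  (mu_ N).-integrable Om (fun x => (u0 x)%:E) ->
  {ae lebesgue_xt R N, forall z, Om z.1 -> 0 < (z.2 : R) < T -> f z.1 z.2 = 0} ->
  {ae mu_ N, forall x, Om x -> u0 x = 0} ->
  weak_supersolution s Om T (hardy_source s lam p f) u0 (fun _ _ => 0).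
Proof.
move=> mf u0_L1 f0 u00.
have mOm : measurable Om by exact: open_measurable_rV.
have mI : measurable (`]0, T[%classic : set (measurableTypeR R)) by exact: measurable_itv.
have mE : measurable (Om `*` (`]0, T[%classic : set (measurableTypeR R))) by exact: measurableX.
have p0 : p != 0 by rewrite gt_eqF// (lt_trans ltr01 p_gt1).
have FE x t : hardy_source s lam p f x t 0 = f x t.
  by rewrite /hardy_source mul0r mulr0 powR0// !add0r.
have inI (z : 'rV[R]_N * measurableTypeR R) : (Om `*` `]0, T[) z -> Om z.1 /\ 0 < (z.2 : R) < T.
  by case=> ? /=; rewrite in_itv.
split.
- exact: measurable_cst.
- by move=> t _; exact: integrable0.
- move=> t _; rewrite (_ : (fun r : R => _) = cst 0%E); first exact: cvg_cst.
  by apply/funext => r; apply: integral0_eq => x _; rewrite subrr normr0.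
- apply/integrableP; split.
    by apply/measurable_EFinP; apply: eq_measurable_fun mf => z _; rewrite FE.
  rewrite [X in (X < _)%E](_ : _ = 0%E) ?ltry//.
  apply/ae_eq_integral_abs => //.
    by apply/measurable_EFinP; apply: eq_measurable_fun mf => z _; rewrite FE.
  by apply: (ae_imply _ f0) => z h /inI[Oz tz] /=; rewrite FE h.
- by apply: aeW => z.
- by apply: (ae_imply _ u00) => x h /h ->.
move=> phi [h _ Hphi] phi0.
have mphi := tf_measurable Hphi.
rewrite [X in (_ <= X)%E](_ : _ = 0%E); last first.
  by rewrite !integral0_eq ?adde0// => z _; rewrite mul0r.
have i1 : (\int[lebesgue_xt R N]_(z in Om `*` `]0%R, T[)
    (hardy_source s lam p f z.1 z.2 0 * phi z.1 z.2)%:E <= 0)%E.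
  rewrite -(integral0 (lebesgue_xt R N) (Om `*` `]0, T[)); apply: ae_le_integral => //.
    apply/measurable_EFinP; apply: measurable_funM.
      by apply: eq_measurable_fun mf => z _; rewrite FE.
    apply: (measurable_funS _ _ mphi).
      by apply: measurableX => //; exact: (measurable_itv (`[0, T] : interval R)).
    by move=> z /inI[_ /andP[? ?]]; split => //=; rewrite in_itv/= !ltW.
  by apply: (ae_imply _ f0) => z hz /inI[Oz tz]; rewrite FE hz// mul0r.
have i2 : (\int[mu_ N]_(x in Om) (u0 x * phi x 0%R)%:E <= 0)%E.
  rewrite -(integral0 (mu_ N) Om); apply: ae_le_integral => //.
    apply/measurable_EFinP; apply: measurable_funM.
      by apply/measurable_EFinP; case/integrableP: u0_L1.
    have mS : measurable ([set: 'rV[R]_N] `*` (`[0, T]%classic : set (measurableTypeR R))).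
      by apply: measurableX => //; exact: (measurable_itv (`[0, T] : interval R)).
    pose g (x : 'rV[R]_N) : 'rV[R]_N * measurableTypeR R := (x, 0).
    have mg : measurable_fun setT g.
      by apply: measurable_fun_pair; [exact: measurable_id|exact: measurable_cst].
    have gS : g @` setT `<=` [set: 'rV[R]_N] `*` (`[0, T]%classic : set (measurableTypeR R)).
      by move=> _ [x _ <-]; split => //=; rewrite in_itv/= lexx ltW.
    by apply: measurable_funTS; exact: (measurable_comp mS gS mphi mg).
  by apply: (ae_imply _ u00) => x hx /hx ->; rewrite mul0r.
by rewrite -(adde0 0%E); apply: leeD.
Qed.

End vanishing.

Theorem theorem6p3 (R : realType) (N : nat) (s : R) (Om : set 'rV[R]_N)
    (T lambda alpha p : R) (f : 'rV[R]_N -> R -> R) (u0 : 'rV[R]_N -> R)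
    (hs : 0 < s < 1) (hN : 2 * s < N%:R)
    (hOm : bounded_C11_domain Om) (hOm0 : Om 0) (hT : 0 < T)
    (hlambda : 0 < lambda <= hardy_const N s)
    (halpha : 0 <= alpha < (N%:R - 2 * s) / 2)
    (hlambda_alpha : lambda = hardy_param N s alpha)
    (mf : measurable_fun (Om `*` `]0, T[) (fun z : 'rV[R]_N * R => f z.1 z.2))
    (f_ge0 : {ae lebesgue_xt R N, forall z,
       Om z.1 -> 0 < (z.2 : R) < T -> 0 <= f z.1 z.2})
    (u0_L1 : (lebesgue_rV R N).-integrable Om (fun x => (u0 x)%:E))
    (u0_ge0 : {ae lebesgue_rV R N, forall x, Om x -> 0 <= u0 x})
    (hp : p_plus N s alpha < p) :
  (~ exists u : 'rV[R]_N -> R -> R,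
       weak_supersolution s Om T (hardy_source s lambda p f) u0 u /\
       {ae lebesgue_xt R N, forall z,
          Om z.1 -> 0 < (z.2 : R) < T -> 0 < u z.1 z.2})
  /\
  ({ae lebesgue_xt R N, forall z,
      Om z.1 -> 0 < (z.2 : R) < T -> f z.1 z.2 = 0} ->
   (forall u : 'rV[R]_N -> R -> R,
      weak_supersolution s Om T (hardy_source s lambda p f) u0 u ->
      {ae lebesgue_xt R N, forall z,
         Om z.1 -> 0 < (z.2 : R) < T -> 0 <= u z.1 z.2} ->
      {ae lebesgue_xt R N, forall z, 0 <= (z.2 : R) < T -> u z.1 z.2 = 0})
   /\
   ({ae lebesgue_rV R N, forall x, Om x -> u0 x = 0} ->
      weak_supersolution s Om T (hardy_source s lambda p f) u0
        (fun _ _ => 0))).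
Proof.
have /andP[lam0 _] := hlambda; have oOm := domain_open hOm; have bOm := domain_bounded hOm.
split.
  move=> [u [Hu u_gt0]].
  have u_ge0 : {ae lebesgue_xt R N, forall z,
      Om z.1 -> 0 < (z.2 : R) < T -> 0 <= u z.1 z.2}.
    by apply: (ae_imply _ u_gt0) => z h Oz tz; exact: ltW (h Oz tz).
  have u_eq0 := supersolution_vanishes hs hN oOm bOm hOm0 hT lam0 halpha hlambda_alpha hp
    f_ge0 u0_L1 u0_ge0 Hu u_ge0.
  apply: (domain_measure_gt0 hs hN oOm hOm0 hT).
  apply: (ae_imply2 _ u_gt0 u_eq0) => z h1 h2 Oz tz.
  have /andP[t0 tT] := tz; have := h1 Oz tz.
  by rewrite h2 ?ltxx// (ltW t0).
move=> f_eq0; split.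
  move=> u Hu u_ge0.
  exact: (supersolution_vanishes hs hN oOm bOm hOm0 hT lam0 halpha hlambda_alpha hp
    f_ge0 u0_L1 u0_ge0 Hu u_ge0).
move=> u0_eq0.
exact: (zero_supersolution lambda hs oOm hT halpha hp mf u0_L1 f_eq0 u0_eq0).
Qed.
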